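(* Let $\mathcal{M}$ denote the set of all prime functions in $\mathrm{elh}(\mathbb{C})$. Then $\mathcal{M}\neq\emptyset$.
   Context: $\mathrm{elh}(\mathbb{C})$ is the set of all entire functions $f:\mathbb{C}\to\mathbb{C}$ with $f'(z)\neq 0$ for all $z\in\mathbb{C}$ and $f'(0)=1$. $\mathrm{Aut}(\mathbb{C})=\{z+a : a\in\mathbb{C}\}\subseteq\mathrm{elh}(\mathbb{C})$. A function $c\in\mathrm{elh}(\mathbb{C})$ is composite if there are entire functions $f,g$, neither of which is an affine map $z\mapsto \alpha z+\beta$ ($\alpha\in\mathbb{C}^\times$, $\beta\in\mathbb{C}$), such that $c=f\circ g$. The factors $f,g$ are not required to lie in $\mathrm{elh}(\mathbb{C})$. A function $p\in\mathrm{elh}(\mathbb{C})\setminus\mathrm{Aut}(\mathbb{C})$ is prime if it is not composite. *)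

(* Defs.v *)
From Stdlib Require Import Reals.
From Coquelicot Require Export Coquelicot.

Open Scope C_scope.

(* The domain is a module over [C_AbsRing], so this is complex (not real)
   differentiability at every point of the plane. *)
Definition entire (f : C -> C) : Prop :=
  forall z : C, @ex_derive C_AbsRing C_NormedModule f z.

(* [C_derive] is total and computed as a limit along a horizontal line; it is
   the complex derivative since [f] is required to be entire
   (see [C_derive_correct]). *)
Definition elh (f : C -> C) : Prop :=
  entire f /\ (forall z : C, C_derive f z <> 0) /\ C_derive f 0 = 1.

Definition AutC (f : C -> C) : Prop :=
  exists a : C, forall z : C, f z = z + a.

Definition affine (f : C -> C) : Prop :=
  exists alpha beta : C, alpha <> 0 /\ forall z : C, f z = alpha * z + beta.

Definition composite (c : C -> C) : Prop :=
  elh c /\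
  exists f g : C -> C,
    entire f /\ entire g /\ ~ affine f /\ ~ affine g /\
    forall z : C, c z = f (g z).

Definition elh_prime (p : C -> C) : Prop :=
  elh p /\ ~ AutC p /\ ~ composite p.

(* Main.v *)
Require Import Defs.
From Stdlib Require Import Reals.
From Coquelicot Require Import Coquelicot.
From Stdlib Require Import Factorial Lra Lia ClassicalEpsilon Classical FunctionalExtensionality.
Open Scope C_scope.

(* The example is the primitive p of exp(z^2), normalised so that p'(0) = 1.

   Suppose p = f o g.  Since f'(g) g' = exp(z^2), neither g' nor f' o g vanishes.  For the
   mean T(F, r) of ln (1 + |F|^2) over |z| = r one has T(g, r) <= K (1 + T(f o g, r)) as soon
   as f' is not identically zero: subtracting from ln (1 + |f|^2) a small multiple of a
   function of w growing like 2 ln |w|, whose Laplacian is positive only near a point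
   where f' <> 0, leaves a subharmonic function of w.  Hence T(g, r) = O(r^2), and the same
   bound holds for g' at arbitrarily large r; a zero-free entire function with such a bound
   is the exponential of a polynomial of degree at most 2.
   - If f'(a) = 0, then g omits a, so g - a = k exp(h) with h quadratic; as h' has no zero,
     h is linear and g is periodic.
   - If f' has no zero, write f' = k1 exp(A) and g' = k2 exp(B) with B quadratic.  Then
     A(g) = z^2 - B + c is a polynomial; if A is constant then f is affine, and otherwise
     T(g, r) = O(ln r) by the inequality applied to A o g, so that B is linear, and g is
     affine or periodic.
   If g is periodic then so is p, hence also exp(z^2), which is absurd. *)

(** * Complex derivatives and curves *)

(** The difficulty is that f is an arbitrary entire function: a bound on f o g has to be turned into
    a bound on g with no knowledge of the growth of f. Means over |z| = r are treated as functions
    of x = ln r. Then F(exp(x + it)) is holomorphic on a strip and periodic in t, the second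
    derivative in t integrates to zero, and the second derivative of a mean in x is the mean of r^2
    times the Laplacian. Subharmonicity becomes convexity in x. Since the slope tends to 0 as x ->
    -infinity, which is regularity at r = 0, a convex mean is nondecreasing, and radius r can be
    compared with radius 1. The weight ln (1 + |F|^2) is smooth, so zeros of F are never counted and
    derivatives pass under the integral. For g', only the second derivative of the mean of g is
    available, and the mean value theorem bounds it merely at some point of each unit interval of x;
    hence the restriction to suitable large r. Growth is stated for circles around every centre: if
    one Taylor coefficient vanishes at each centre, the corresponding derivative is identically
    zero, without recourse to power series. *)

Definition cderiv (f : C -> C) (z l : C) : Prop :=
  forall eps : R, (0 < eps)%R ->
  exists d : R, (0 < d)%R /\
    forall h, (Cmod h < d)%R -> (Cmod (f (z + h) - f z - l * h)%C <= eps * Cmod h)%R.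

Definition ccont (f : C -> C) (z : C) : Prop :=
  forall eps : R, (0 < eps)%R ->
  exists d : R, (0 < d)%R /\
    forall h, (Cmod h < d)%R -> (Cmod (f (z + h) - f z)%C < eps)%R.

Lemma cderiv_is_derive f z l :
  cderiv f z l <-> @is_derive C_AbsRing C_NormedModule f z l.
Proof.
split.
- intros H. split. { apply is_linear_scal_l. }
  intros x Hx eps.
  apply (@is_filter_lim_locally_unique C_AbsRing (AbsRing_NormedModule C_AbsRing)) in Hx. subst x.
  destruct (H eps (cond_pos eps)) as [d [Hd H1]].
  exists (mkposreal d Hd).
  (* The goal is this statement up to conversion: norm, ball and scalar product over [C_AbsRing]
     unfold to [Cmod] and [Cmult]. *)
  cut (forall y : C, (Cmod (y - z)%C < d)%R ->
    (Cmod (f y - f z - (y - z) * l)%C <= eps * Cmod (y - z)%C)%R); [exact (fun K => K)|].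
  intros y Hy. specialize (H1 (y - z) Hy).
  replace (z + (y - z)) with y in H1 by ring.
  replace ((y - z) * l) with (l * (y - z)) by ring. exact H1.
- intros [_ H] eps Heps.
  destruct (H z (fun P HP => HP) (mkposreal eps Heps)) as [d Hd].
  exists d. split; [apply cond_pos|]. intros h Hh.
  specialize (Hd (z + h)).
  change (Cmod (z + h - z)%C < d ->
    Cmod (f (z + h) - f z - (z + h - z) * l)%C <= eps * Cmod (z + h - z)%C)%R in Hd.
  replace (z + h - z) with h in Hd by ring.
  replace (l * h) with (h * l) by ring. apply Hd. exact Hh.
Qed.

Lemma entire_cderiv f : entire f <-> forall z, cderiv f z (C_derive f z).
Proof.
split; intros H z.
- apply cderiv_is_derive. apply C_derive_correct; [exact z | apply H].
- exists (C_derive f z). apply cderiv_is_derive, H.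
Qed.

Lemma cderiv_C_derive f z l : cderiv f z l -> C_derive f z = l.
Proof. intros H. apply is_C_derive_unique, cderiv_is_derive, H. Qed.

Lemma cderiv_entire f f' : (forall z, cderiv f z (f' z)) -> entire f.
Proof. intros H z. exists (f' z). apply cderiv_is_derive, H. Qed.

Lemma Cmod_minus_sym a b : Cmod (a - b)%C = Cmod (b - a)%C.
Proof. rewrite <- Cmod_opp. f_equal. ring. Qed.

Lemma cderiv_ext f g z l : (forall w, f w = g w) -> cderiv f z l -> cderiv g z l.
Proof.
intros E H eps He. destruct (H eps He) as [d [Hd H1]].
exists d. split; auto. intros h Hh. rewrite <- !E. auto.
Qed.

Lemma cderiv_ccont f z l : cderiv f z l -> ccont f z.
Proof.
intros H eps He. destruct (H 1%R Rlt_0_1) as [d [Hd H1]].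
assert (Hl := Cmod_ge_0 l).
exists (Rmin d (eps / (Cmod l + 2))). split.
- apply Rmin_pos; auto. apply Rdiv_lt_0_compat; lra.
- intros h Hh.
  assert (H2 := H1 h (Rlt_le_trans _ _ _ Hh (Rmin_l _ _))).
  assert (H3 := Rlt_le_trans _ _ _ Hh (Rmin_r _ _)).
  replace (f (z + h) - f z) with (f (z + h) - f z - l * h + l * h) by ring.
  eapply Rle_lt_trans; [apply Cmod_triangle|].
  rewrite Cmod_mult.
  apply Rlt_div_r in H3; [|lra].
  assert (H4 := Cmod_ge_0 h). nra.
Qed.

Lemma ccont_const c z : ccont (fun _ => c) z.
Proof.
intros eps He. exists 1%R. split; [lra|]. intros.
replace (c - c) with (RtoC 0) by ring. rewrite Cmod_0. auto.
Qed.

Lemma ccont_plus f g z : ccont f z -> ccont g z -> ccont (fun w => f w + g w) z.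
Proof.
intros Hf Hg eps He.
destruct (Hf (eps/2)%R) as [d1 [Hd1 H1]]; [lra|].
destruct (Hg (eps/2)%R) as [d2 [Hd2 H2]]; [lra|].
exists (Rmin d1 d2). split; [apply Rmin_pos; auto|]. intros h Hh.
specialize (H1 h (Rlt_le_trans _ _ _ Hh (Rmin_l _ _))).
specialize (H2 h (Rlt_le_trans _ _ _ Hh (Rmin_r _ _))).
replace (f (z + h) + g (z + h) - (f z + g z))
  with ((f (z + h) - f z) + (g (z + h) - g z)) by ring.
eapply Rle_lt_trans; [apply Cmod_triangle|]. lra.
Qed.

Lemma cderiv_const c z : cderiv (fun _ => c) z 0.
Proof.
intros eps He. exists 1%R. split; [lra|]. intros h _.
replace (c - c - 0 * h) with (RtoC 0) by ring. rewrite Cmod_0.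
assert (H4 := Cmod_ge_0 h). nra.
Qed.

Lemma cderiv_id z : cderiv (fun w => w) z 1.
Proof.
intros eps He. exists 1%R. split; [lra|]. intros h _.
replace (z + h - z - 1 * h) with (RtoC 0) by ring. rewrite Cmod_0.
assert (H4 := Cmod_ge_0 h). nra.
Qed.

Lemma cderiv_plus f g z a b :
  cderiv f z a -> cderiv g z b -> cderiv (fun w => f w + g w) z (a + b).
Proof.
intros Hf Hg eps He.
destruct (Hf (eps/2)%R) as [d1 [Hd1 H1]]; [lra|].
destruct (Hg (eps/2)%R) as [d2 [Hd2 H2]]; [lra|].
exists (Rmin d1 d2). split; [apply Rmin_pos; auto|]. intros h Hh.
specialize (H1 h (Rlt_le_trans _ _ _ Hh (Rmin_l _ _))).
specialize (H2 h (Rlt_le_trans _ _ _ Hh (Rmin_r _ _))).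
replace (f (z + h) + g (z + h) - (f z + g z) - (a + b) * h)
  with ((f (z + h) - f z - a * h) + (g (z + h) - g z - b * h)) by ring.
eapply Rle_trans; [apply Cmod_triangle|]. lra.
Qed.

Lemma cderiv_comp f g z a b :
  cderiv f (g z) a -> cderiv g z b -> cderiv (fun w => f (g w)) z (a * b).
Proof.
intros Hf Hg eps He.
assert (Ha := Cmod_ge_0 a). assert (Hb := Cmod_ge_0 b).
(* The error splits into one for f at the increment k of g, at most e1 * |k|, and a times the error
   for g. As |k| <= (|b| + 1) * |h|, these choices make each part at most eps / 2 * |h|; the 1 in e2
   yields the bound on k. *)
set (e1 := (eps / (2 * (Cmod b + 1)))%R).
assert (He1 : (0 < e1)%R) by (apply Rdiv_lt_0_compat; lra).
assert (E1 : (e1 * (Cmod b + 1) = eps / 2)%R) by (unfold e1; field; lra).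
set (e2 := Rmin 1 (eps / (2 * (Cmod a + 1)))).
assert (He2 : (0 < e2)%R) by (apply Rmin_pos; [lra|apply Rdiv_lt_0_compat; lra]).
assert (E2 : (e2 * (Cmod a + 1) <= eps / 2)%R).
{ apply Rle_trans with (eps / (2 * (Cmod a + 1)) * (Cmod a + 1))%R.
  - apply Rmult_le_compat_r; [lra|apply Rmin_r].
  - right. field. lra. }
destruct (Hf e1 He1) as [d1 [Hd1 H1]].
destruct (Hg e2 He2) as [d2 [Hd2 H2]].
destruct (cderiv_ccont _ _ _ Hg d1 Hd1) as [d3 [Hd3 H3]].
exists (Rmin d2 d3). split; [apply Rmin_pos; auto|]. intros h Hh.
specialize (H2 h (Rlt_le_trans _ _ _ Hh (Rmin_l _ _))).
specialize (H3 h (Rlt_le_trans _ _ _ Hh (Rmin_r _ _))).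
specialize (H1 _ H3).
replace (g z + (g (z + h) - g z)) with (g (z + h)) in H1 by ring.
set (k := g (z + h) - g z) in *.
assert (Hk : (Cmod k <= (Cmod b + 1) * Cmod h)%R).
{ replace k with (k - b * h + b * h) by ring.
  eapply Rle_trans; [apply Cmod_triangle|]. rewrite Cmod_mult.
  assert (H4 := Cmod_ge_0 h). assert (e2 <= 1)%R by apply Rmin_l. nra. }
replace (f (g (z + h)) - f (g z) - a * b * h)
  with ((f (g (z + h)) - f (g z) - a * k) + a * (k - b * h)) by ring.
eapply Rle_trans; [apply Cmod_triangle|]. rewrite Cmod_mult.
assert (H4 := Cmod_ge_0 h). assert (H5 := Cmod_ge_0 k).
assert (e1 * Cmod k <= eps / 2 * Cmod h)%R by (rewrite <- E1; nra).
assert (Cmod a * Cmod (k - b * h)%C <= eps / 2 * Cmod h)%R.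
{ apply Rle_trans with ((Cmod a + 1) * (e2 * Cmod h))%R; [|nra].
  apply Rmult_le_compat; auto using Cmod_ge_0; lra. }
lra.
Qed.

Lemma cderiv_sqr z : cderiv (fun w => w * w) z (2 * z).
Proof.
intros eps He. exists eps. split; auto. intros h Hh.
replace ((z + h) * (z + h) - z * z - 2 * z * h) with (h * h) by ring.
rewrite Cmod_mult. assert (H4 := Cmod_ge_0 h). nra.
Qed.

Lemma cderiv_scal c f z a : cderiv f z a -> cderiv (fun w => c * f w) z (c * a).
Proof.
intros H eps He.
assert (Hc := Cmod_ge_0 c).
destruct (H (eps / (Cmod c + 1))%R) as [d [Hd H1]].
{ apply Rdiv_lt_0_compat; lra. }
exists d. split; auto. intros h Hh. specialize (H1 h Hh).
replace (c * f (z + h) - c * f z - c * a * h)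
  with (c * (f (z + h) - f z - a * h)) by ring.
rewrite Cmod_mult.
apply Rle_trans with (Cmod c * (eps / (Cmod c + 1) * Cmod h))%R.
- apply Rmult_le_compat_l; auto.
- assert (H4 := Cmod_ge_0 h).
  replace eps with (eps / (Cmod c + 1) * (Cmod c + 1))%R at 2 by (field; lra).
  assert (0 <= eps / (Cmod c + 1))%R by (left; apply Rdiv_lt_0_compat; lra).
  nra.
Qed.

Lemma cderiv_minus f g z a b :
  cderiv f z a -> cderiv g z b -> cderiv (fun w => f w - g w) z (a - b).
Proof.
intros Hf Hg. apply cderiv_ext with (fun w => f w + (-(1)) * g w).
- intros w. ring.
- replace (a - b) with (a + (-(1)) * b) by ring.
  apply cderiv_plus; auto. apply cderiv_scal; auto.
Qed.

(* Polarisation reduces products to squares. *)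
Lemma cderiv_mult f g z a b :
  cderiv f z a -> cderiv g z b -> cderiv (fun w => f w * g w) z (a * g z + f z * b).
Proof.
intros Hf Hg.
apply cderiv_ext with
  (fun w => (/4) * ((f w + g w) * (f w + g w) - (f w - g w) * (f w - g w))).
- intros w. field.
- replace (a * g z + f z * b) with
    ((/4) * (2 * (f z + g z) * (a + b) - 2 * (f z - g z) * (a - b))) by field.
  apply cderiv_scal, cderiv_minus.
  + apply (cderiv_comp (fun w => w * w) (fun w => f w + g w)).
    * apply cderiv_sqr. * apply cderiv_plus; auto.
  + apply (cderiv_comp (fun w => w * w) (fun w => f w - g w)).
    * apply cderiv_sqr. * apply cderiv_minus; auto.
Qed.

Lemma cderiv_inv (z : C) : z <> 0 -> cderiv (fun w => / w) z (- / (z * z)).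
Proof.
intros Hz eps He.
assert (Pz : (0 < Cmod z)%R) by (apply (proj1 (Cmod_gt_0 z)); exact Hz).
set (m := Cmod z) in *.
exists (Rmin (m / 2) (eps * (m * m * m / 2))). split.
{ apply Rmin_pos; [lra|]. assert (0 < m * m * m)%R by (repeat apply Rmult_lt_0_compat; lra).
  apply Rmult_lt_0_compat; lra. }
intros h Hh.
assert (H1 := Rlt_le_trans _ _ _ Hh (Rmin_l _ _)).
assert (H2 := Rlt_le_trans _ _ _ Hh (Rmin_r _ _)).
assert (Hzh : (m / 2 <= Cmod (z + h)%C)%R).
{ assert (H3 : (m <= Cmod (z + h)%C + Cmod h)%R).
  { unfold m. replace z with (z + h + - h) at 1 by ring.
    rewrite <- (Cmod_opp h). apply Cmod_triangle. }
  lra. }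
assert (N : z + h <> 0) by (apply (proj2 (Cmod_gt_0 _)); lra).
replace (/ (z + h) - / z - - / (z * z) * h) with (h * h * / (z * z * (z + h)))
  by (field; auto).
rewrite Cmod_mult, Cmod_inv, !Cmod_mult; [|repeat apply Cmult_neq_0; auto].
fold m.
assert (H4 := Cmod_ge_0 h).
apply Rle_trans with (Cmod h * Cmod h * / (m * m * (m / 2)))%R.
- apply Rmult_le_compat_l; [nra|]. apply Rinv_le_contravar.
  + repeat apply Rmult_lt_0_compat; lra.
  + apply Rmult_le_compat_l; [nra|auto].
- apply Rle_trans with ((eps * (m * m * m / 2)) * Cmod h * / (m * m * (m / 2)))%R.
  + apply Rmult_le_compat_r.
    * left. apply Rinv_0_lt_compat. repeat apply Rmult_lt_0_compat; lra.
    * apply Rmult_le_compat_r; lra.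
  + right. field. lra.
Qed.

Lemma entire_comp f g : entire f -> entire g -> entire (fun z => f (g z)).
Proof.
rewrite !entire_cderiv. intros Hf Hg.
apply entire_cderiv, (cderiv_entire _ (fun z => C_derive f (g z) * C_derive g z)).
intros z. apply (cderiv_comp f g); auto.
Qed.

(** Curves are differentiated in C as a real normed module, the structure over which [RInt] and the
    fundamental theorem of calculus are applied to them. *)
Definition curve_deriv (c : R -> C) (t : R) (v : C) : Prop :=
  @is_derive R_AbsRing C_R_NormedModule c t v.

Lemma norm_C_R (x : C) : @norm R_AbsRing C_R_NormedModule x = Cmod x.
Proof. symmetry. apply Cmod_norm. Qed.

Lemma curve_deriv_eps c t v :
  curve_deriv c t v <->
  forall eps : R, (0 < eps)%R -> exists d : R, (0 < d)%R /\
   forall h : R, (Rabs h < d)%R -> (Cmod (c (t + h)%R - c t - h * v)%C <= eps * Rabs h)%R.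
Proof.
assert (S : forall (h : R) (v : C), @scal R_AbsRing C_R_NormedModule h v = h * v).
{ intros h [v1 v2]. unfold scal; simpl. unfold prod_scal; simpl.
  unfold scal; simpl; unfold mult; simpl. unfold Cmult, RtoC; simpl. f_equal; ring. }
split.
- intros [_ H] eps Heps.
  destruct (H t (fun P HP => HP) (mkposreal eps Heps)) as [d Hd].
  exists d. split; [apply cond_pos|]. intros h Hh.
  specialize (Hd (t + h)%R).
  change (Rabs (t + h - t) < d ->
    @norm R_AbsRing C_R_NormedModule
      (minus (minus (c (t + h)%R) (c t)) (scal (minus (t + h)%R t) v))
      <= eps * Rabs (t + h - t))%R in Hd.
  replace (t + h - t)%R with h in Hd by ring.
  specialize (Hd Hh). rewrite norm_C_R, S in Hd.
  replace (minus (t + h)%R t) with h in Hd by (change (h = t + h - t)%R; ring).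
  exact Hd.
- intros H. split. { apply is_linear_scal_l. }
  intros x Hx eps.
  apply (@is_filter_lim_locally_unique R_AbsRing (AbsRing_NormedModule R_AbsRing)) in Hx. subst x.
  destruct (H eps (cond_pos eps)) as [d [Hd H1]].
  exists (mkposreal d Hd).
  cut (forall y : R, (Rabs (y - t) < d)%R ->
    (Cmod (c y - c t - RtoC (y - t) * v)%C <= eps * Rabs (y - t))%R).
  { intros K y Hy. rewrite norm_C_R, S. exact (K y Hy). }
  intros y Hy. specialize (H1 (y - t)%R Hy).
  replace (t + (y - t))%R with y in H1 by ring. exact H1.
Qed.

Lemma curve_deriv_comp f c t l v :
  cderiv f (c t) l -> curve_deriv c t v -> curve_deriv (fun s => f (c s)) t (l * v).
Proof.
intros Hf Hc. rewrite curve_deriv_eps in *. intros eps He.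
assert (Ha := Cmod_ge_0 l). assert (Hb := Cmod_ge_0 v).
set (e1 := (eps / (2 * (Cmod v + 1)))%R).
assert (He1 : (0 < e1)%R) by (apply Rdiv_lt_0_compat; lra).
assert (E1 : (e1 * (Cmod v + 1) = eps / 2)%R) by (unfold e1; field; lra).
set (e2 := Rmin 1 (eps / (2 * (Cmod l + 1)))).
assert (He2 : (0 < e2)%R) by (apply Rmin_pos; [lra|apply Rdiv_lt_0_compat; lra]).
assert (E2 : (e2 * (Cmod l + 1) <= eps / 2)%R).
{ apply Rle_trans with (eps / (2 * (Cmod l + 1)) * (Cmod l + 1))%R.
  - apply Rmult_le_compat_r; [lra|apply Rmin_r].
  - right. field. lra. }
destruct (Hf e1 He1) as [d1 [Hd1 H1]].
destruct (Hc e2 He2) as [d2 [Hd2 H2]].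
exists (Rmin d2 (d1 / (Cmod v + 1))). split.
{ apply Rmin_pos; auto. apply Rdiv_lt_0_compat; lra. }
intros h Hh.
specialize (H2 h (Rlt_le_trans _ _ _ Hh (Rmin_l _ _))).
assert (H3 := Rlt_le_trans _ _ _ Hh (Rmin_r _ _)).
apply Rlt_div_r in H3; [|lra].
set (k := c (t + h)%R - c t) in *.
assert (H4 := Rabs_pos h).
assert (Hk : (Cmod k <= (Cmod v + 1) * Rabs h)%R).
{ replace k with (k - h * v + h * v) by ring.
  eapply Rle_trans; [apply Cmod_triangle|]. rewrite Cmod_mult, Cmod_R.
  assert (e2 <= 1)%R by apply Rmin_l. nra. }
assert (H5 : (Cmod k < d1)%R) by lra.
specialize (H1 _ H5).
replace (c t + k) with (c (t + h)%R) in H1 by (unfold k; ring).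
replace (f (c (t + h)%R) - f (c t) - h * (l * v))
  with ((f (c (t + h)%R) - f (c t) - l * k) + l * (k - h * v)) by ring.
eapply Rle_trans; [apply Cmod_triangle|]. rewrite Cmod_mult.
assert (H6 := Cmod_ge_0 k).
assert (e1 * Cmod k <= eps / 2 * Rabs h)%R by (rewrite <- E1; nra).
assert (Cmod l * Cmod (k - h * v)%C <= eps / 2 * Rabs h)%R.
{ apply Rle_trans with ((Cmod l + 1) * (e2 * Rabs h))%R; [|nra].
  apply Rmult_le_compat; auto using Cmod_ge_0; lra. }
lra.
Qed.

Lemma curve_deriv_pair (c : R -> C) t (v : C) :
  is_derive (fun s => fst (c s)) t (fst v) -> is_derive (fun s => snd (c s)) t (snd v) ->
  curve_deriv c t v.
Proof.
intros H1 H2.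
apply is_derive_ext with (fun s => (fst (c s), snd (c s))).
{ intros s. symmetry. apply surjective_pairing. }
destruct H1 as [L1 H1], H2 as [L2 H2].
split; [apply is_linear_scal_l|].
intros x Hx eps.
assert (He : (0 < eps / 2)%R) by (destruct eps; simpl; lra).
specialize (H1 x Hx (mkposreal _ He)). specialize (H2 x Hx (mkposreal _ He)).
generalize (filter_and _ _ H1 H2). apply filter_imp.
intros y [K1 K2]. rewrite norm_C_R. simpl in K1, K2.
match goal with |- (Cmod ?z <= _)%R => set (w := z) end.
assert (Cmod w <= Rabs (fst w) + Rabs (snd w))%R.
{ replace w with (RtoC (fst w) + Ci * RtoC (snd w)) at 1.
  - eapply Rle_trans; [apply Cmod_triangle|]. rewrite Cmod_mult, Cmod_Ci, !Cmod_R. lra.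
  - destruct w. unfold Cplus, Cmult, RtoC, Ci; simpl. f_equal; ring. }
change (Rabs (fst w) <= eps / 2 * norm (minus y x))%R in K1.
change (Rabs (snd w) <= eps / 2 * norm (minus y x))%R in K2.
eapply Rle_trans; [exact H|].
match goal with |- (_ <= _ * ?n)%R =>
  replace (eps * n)%R with (eps / 2 * n + eps / 2 * n)%R by field end.
apply Rplus_le_compat; assumption.
Qed.

Lemma curve_deriv_fst c t v : curve_deriv c t v -> is_derive (fun s => fst (c s)) t (fst v).
Proof.
intros [L1 H1]. split; [apply is_linear_scal_l|].
intros x Hx eps. specialize (H1 x Hx eps). revert H1. apply filter_imp.
intros y H. rewrite norm_C_R in H. eapply Rle_trans; [|exact H].
match goal with |- (_ <= Cmod ?z)%R => set (w := z) end.
change (Rabs (fst w) <= Cmod w)%R.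
eapply Rle_trans; [|apply Rmax_Cmod]. apply Rmax_l.
Qed.

Lemma curve_deriv_snd c t v : curve_deriv c t v -> is_derive (fun s => snd (c s)) t (snd v).
Proof.
intros [L1 H1]. split; [apply is_linear_scal_l|].
intros x Hx eps. specialize (H1 x Hx eps). revert H1. apply filter_imp.
intros y H. rewrite norm_C_R in H. eapply Rle_trans; [|exact H].
match goal with |- (_ <= Cmod ?z)%R => set (w := z) end.
change (Rabs (snd w) <= Cmod w)%R.
eapply Rle_trans; [|apply Rmax_Cmod]. apply Rmax_r.
Qed.

(* Continuity of a curve, for the product topology used by [RInt]. *)
Definition curve_cont (c : R -> C) (t : R) : Prop :=
  @continuous R_UniformSpace C_UniformSpace c t.

Lemma curve_cont_eps c t :
  (forall eps : R, (0 < eps)%R -> exists d : R, (0 < d)%R /\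
   forall h : R, (Rabs h < d)%R -> (Cmod (c (t + h)%R - c t)%C < eps)%R) ->
  curve_cont c t.
Proof.
intros H P [eps HP].
destruct (H eps (cond_pos eps)) as [d [Hd H1]].
exists (mkposreal d Hd).
cut (forall y : R, (Rabs (y - t) < d)%R -> (Cmod (c y - c t)%C < eps)%R).
{ intros K y Hy. apply HP, C_NormedModule_mixin_compat1. exact (K y Hy). }
intros y Hy. specialize (H1 _ Hy).
replace (t + (y - t))%R with y in H1 by ring. exact H1.
Qed.

Lemma curve_cont_eps_inv c t : curve_cont c t ->
  (forall eps : R, (0 < eps)%R -> exists d : R, (0 < d)%R /\
   forall h : R, (Rabs h < d)%R -> (Cmod (c (t + h)%R - c t)%C < eps)%R).
Proof.
intros H eps He.
(* Balls of the product uniform structure are squares; the square of half-side e lies in the disc of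
   radius sqrt 2 * e. *)
assert (He' : (0 < eps / sqrt 2)%R).
{ apply Rdiv_lt_0_compat; auto. apply sqrt_lt_R0; lra. }
destruct (H (ball (c t) (mkposreal _ He'))) as [d Hd].
{ exists (mkposreal _ He'). intros y Hy. exact Hy. }
exists d. split; [apply cond_pos|]. intros h Hh.
assert (B : ball (c t) (mkposreal _ He') (c (t + h)%R)).
{ apply Hd. change (Rabs (t + h - t) < d)%R. replace (t + h - t)%R with h by ring. auto. }
apply C_NormedModule_mixin_compat2 in B. simpl in B.
replace (sqrt 2 * (eps / sqrt 2))%R with eps in B; [exact B|].
field. apply Rgt_not_eq, sqrt_lt_R0; lra.
Qed.

Lemma ccont_comp_curve f c t : ccont f (c t) -> curve_cont c t -> curve_cont (fun s => f (c s)) t.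
Proof.
intros Hf Hc. apply curve_cont_eps. intros eps He.
destruct (Hf eps He) as [d1 [Hd1 H1]].
destruct (curve_cont_eps_inv _ _ Hc d1 Hd1) as [d [Hd H2]].
exists d. split; auto. intros h Hh. specialize (H1 _ (H2 h Hh)).
replace (c t + (c (t + h)%R - c t)) with (c (t + h)%R) in H1 by ring. auto.
Qed.

Lemma curve_deriv_cont c t v : curve_deriv c t v -> curve_cont c t.
Proof. intros H. apply (ex_derive_continuous c). exists v. exact H. Qed.

Lemma curve_cont_const a t : curve_cont (fun _ => a) t.
Proof. apply continuous_const. Qed.

Lemma curve_cont_plus a b t : curve_cont a t -> curve_cont b t -> curve_cont (fun s => a s + b s) t.
Proof. intros. apply (@continuous_plus _ _ C_R_NormedModule); auto. Qed.

Lemma curve_cont_scal k a t : curve_cont a t -> curve_cont (fun s => k * a s) t.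
Proof.
intros. apply (ccont_comp_curve (fun w => k * w)); auto.
apply (cderiv_ccont _ _ (k * 1)). apply cderiv_scal, cderiv_id.
Qed.

Lemma curve_cont_minus a b t : curve_cont a t -> curve_cont b t -> curve_cont (fun s => a s - b s) t.
Proof. intros. apply (@continuous_minus _ _ C_R_NormedModule); auto. Qed.

Lemma curve_cont_sqr a t : curve_cont a t -> curve_cont (fun s => a s * a s) t.
Proof.
intros. apply (ccont_comp_curve (fun w => w * w)); auto.
eapply cderiv_ccont, cderiv_sqr.
Qed.

Lemma curve_cont_mult a b t : curve_cont a t -> curve_cont b t -> curve_cont (fun s => a s * b s) t.
Proof.
intros Ha Hb.
apply (continuous_ext (fun s => (/4) * ((a s + b s) * (a s + b s) - (a s - b s) * (a s - b s)))).
- intros x. match goal with |- ?a = ?b => change (@eq C a b) end. field.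
- apply curve_cont_scal, curve_cont_minus; apply curve_cont_sqr.
  + apply curve_cont_plus; auto. + apply curve_cont_minus; auto.
Qed.

Lemma cderiv_val f z a b : a = b -> cderiv f z a -> cderiv f z b.
Proof. intros ->. auto. Qed.

Lemma cderiv_linear c z : cderiv (fun w => c * w) z c.
Proof. apply (cderiv_val _ _ (c * 1)); [ring|]. apply cderiv_scal, cderiv_id. Qed.

Ltac curve_cont_tac := intros; lazymatch goal with
  | |- curve_cont (fun _ => ?k) _ => apply curve_cont_const
  | |- curve_cont (fun s => Cmult (@?a s) (@?b s)) ?t => apply (curve_cont_mult a b t); curve_cont_tac
  | |- curve_cont (fun s => Cplus (@?a s) (@?b s)) ?t => apply (curve_cont_plus a b t); curve_cont_tac
  | |- curve_cont (fun s => Cminus (@?a s) (@?b s)) ?t => apply (curve_cont_minus a b t); curve_cont_tac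
  | _ => auto
  end.

(** * Goursat's theorem and primitives *)

Lemma Cplus_sub_cancel (a b : C) : a + (b - a) = b.
Proof. ring. Qed.

(** * Integrals of curves and integrals around rectangles *)

Definition CInt (c : R -> C) (a b : R) : C := @RInt C_R_CompleteNormedModule c a b.

Definition is_CInt (c : R -> C) (a b : R) (I : C) : Prop := @is_RInt C_R_NormedModule c a b I.

Lemma is_CInt_unique c a b I : is_CInt c a b I -> CInt c a b = I.
Proof. intros H. apply (@is_RInt_unique C_R_CompleteNormedModule), H. Qed.

Lemma CInt_correct c a b : (forall t, curve_cont c t) -> is_CInt c a b (CInt c a b).
Proof.
intros H. apply (@RInt_correct C_R_CompleteNormedModule).
apply (@ex_RInt_continuous C_R_CompleteNormedModule). intros t _. apply H.
Qed.

Lemma is_CInt_fst c a b I : is_CInt c a b I -> is_RInt (fun t => fst (c t)) a b (fst I).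
Proof. intros H. apply (@is_RInt_fct_extend_fst R_NormedModule R_NormedModule), H. Qed.

Lemma is_CInt_snd c a b I : is_CInt c a b I -> is_RInt (fun t => snd (c t)) a b (snd I).
Proof. intros H. apply (@is_RInt_fct_extend_snd R_NormedModule R_NormedModule), H. Qed.

Lemma CInt_ext c d a b : (forall t, c t = d t) -> CInt c a b = CInt d a b.
Proof. intros H. apply (@RInt_ext C_R_CompleteNormedModule). intros; apply H. Qed.

Lemma CInt_Chasles c a b d : (forall t, curve_cont c t) ->
  CInt c a b + CInt c b d = CInt c a d.
Proof.
intros H. symmetry. apply is_CInt_unique.
apply (@is_RInt_Chasles C_R_NormedModule _ _ b); apply CInt_correct, H.
Qed.

Lemma CInt_point c a : CInt c a a = 0.
Proof. apply (@RInt_point C_R_CompleteNormedModule). Qed.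

Lemma CInt_minus c d a b : (forall t, curve_cont c t) -> (forall t, curve_cont d t) ->
  CInt (fun t => c t - d t) a b = CInt c a b - CInt d a b.
Proof.
intros Hc Hd. apply is_CInt_unique.
apply (@is_RInt_minus C_R_NormedModule); apply CInt_correct; auto.
Qed.

Lemma CInt_plus c d a b : (forall t, curve_cont c t) -> (forall t, curve_cont d t) ->
  CInt (fun t => c t + d t) a b = CInt c a b + CInt d a b.
Proof.
intros Hc Hd. apply is_CInt_unique.
apply (@is_RInt_plus C_R_NormedModule); apply CInt_correct; auto.
Qed.

Lemma CInt_scal k c a b : (forall t, curve_cont c t) ->
  CInt (fun t => k * c t) a b = k * CInt c a b.
Proof.
intros H. apply is_CInt_unique. assert (K := CInt_correct c a b H).
assert (K1 := is_CInt_fst _ _ _ _ K). assert (K2 := is_CInt_snd _ _ _ _ K).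
apply (@is_RInt_fct_extend_pair R_NormedModule R_NormedModule).
- apply (is_RInt_minus (V := R_NormedModule)); apply (is_RInt_scal (V := R_NormedModule)); auto.
- apply (is_RInt_plus (V := R_NormedModule)); apply (is_RInt_scal (V := R_NormedModule)); auto.
Qed.

Lemma CInt_FTC F c a b : (forall t, curve_deriv F t (c t)) -> (forall t, curve_cont c t) ->
  CInt c a b = F b - F a.
Proof.
intros HF Hc. apply is_CInt_unique.
apply (@is_RInt_derive C_R_CompleteNormedModule); intros; [apply HF|apply Hc].
Qed.

Lemma Cmod_CInt_le c a b M : (forall t, curve_cont c t) ->
  (forall t, (Rmin a b <= t <= Rmax a b)%R -> (Cmod (c t)%C <= M)%R) ->
  (Cmod (CInt c a b)%C <= M * Rabs (b - a))%R.
Proof.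
intros Hc HM. rewrite <- norm_C_R, Rmult_comm.
apply (@norm_RInt_le_const_abs C_R_NormedModule c).
- intros t Ht. rewrite norm_C_R. auto.
- apply CInt_correct, Hc.
Qed.

Lemma curve_deriv_pt_h x (y : R) : curve_deriv (fun s => (s, y)) x 1.
Proof.
apply curve_deriv_pair; simpl.
- apply (@is_derive_id R_AbsRing). - apply (@is_derive_const R_AbsRing R_NormedModule).
Qed.

Lemma curve_deriv_pt_v (x : R) y : curve_deriv (fun s => (x, s)) y Ci.
Proof.
apply curve_deriv_pair; simpl.
- apply (@is_derive_const R_AbsRing R_NormedModule). - apply (@is_derive_id R_AbsRing).
Qed.

Lemma ccont_h Q (y : R) : (forall z, ccont Q z) -> forall t, curve_cont (fun s => Q (s, y)) t.
Proof.
intros H t. apply (ccont_comp_curve Q (fun s => (s, y))); auto.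
eapply curve_deriv_cont, curve_deriv_pt_h.
Qed.

Lemma ccont_v Q (x : R) : (forall z, ccont Q z) -> forall t, curve_cont (fun s => Q (x, s)) t.
Proof.
intros H t. apply (ccont_comp_curve Q (fun s => (x, s))); auto.
eapply curve_deriv_cont, curve_deriv_pt_v.
Qed.

(** For x1 <= x2 and y1 <= y2 this is the integral of Q dz counterclockwise around the boundary;
    [Ci] is dz / ds on the vertical sides. The corners may come in any order, with a change of sign,
    so that a primitive can be built from one base corner without distinguishing quadrants. *)
Definition rect_int (Q : C -> C) (x1 x2 y1 y2 : R) : C :=
  CInt (fun s => Q (s, y1)) x1 x2 + Ci * CInt (fun s => Q (x2, s)) y1 y2
  - CInt (fun s => Q (s, y2)) x1 x2 - Ci * CInt (fun s => Q (x1, s)) y1 y2.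

Section Rectangles.
Variable Q : C -> C.
Hypothesis HQ : forall z, ccont Q z.

Lemma rect_int_split_x x1 x2 x3 y1 y2 :
  rect_int Q x1 x3 y1 y2 = rect_int Q x1 x2 y1 y2 + rect_int Q x2 x3 y1 y2.
Proof.
unfold rect_int.
rewrite <- (CInt_Chasles (fun s => Q (s, y1)) x1 x2 x3), <- (CInt_Chasles (fun s => Q (s, y2)) x1 x2 x3)
  by (apply ccont_h; exact HQ). ring.
Qed.

Lemma rect_int_split_y x1 x2 y1 y2 y3 :
  rect_int Q x1 x2 y1 y3 = rect_int Q x1 x2 y1 y2 + rect_int Q x1 x2 y2 y3.
Proof.
unfold rect_int.
rewrite <- (CInt_Chasles (fun s => Q (x1, s)) y1 y2 y3), <- (CInt_Chasles (fun s => Q (x2, s)) y1 y2 y3)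
  by (apply ccont_v; exact HQ). ring.
Qed.

Lemma rect_int_point_x x y1 y2 : rect_int Q x x y1 y2 = 0.
Proof. unfold rect_int. rewrite !CInt_point. ring. Qed.

Lemma rect_int_point_y x1 x2 y : rect_int Q x1 x2 y y = 0.
Proof. unfold rect_int. rewrite !CInt_point. ring. Qed.

Lemma rect_int_le x1 x2 y1 y2 M : (x1 <= x2)%R -> (y1 <= y2)%R ->
  (forall x y, (x1 <= x <= x2)%R -> (y1 <= y <= y2)%R -> (Cmod (Q (x, y))%C <= M)%R) ->
  (Cmod (rect_int Q x1 x2 y1 y2)%C <= 2 * M * ((x2 - x1) + (y2 - y1)))%R.
Proof.
intros Hx Hy HM. unfold rect_int.
assert (Bh : forall y, (y1 <= y <= y2)%R ->
  (Cmod (CInt (fun s => Q (s, y)) x1 x2)%C <= M * (x2 - x1))%R).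
{ intros y H. rewrite <- (Rabs_pos_eq (x2 - x1)%R) by lra.
  apply Cmod_CInt_le; [apply ccont_h; exact HQ|].
  rewrite Rmin_left, Rmax_right by auto. intros t Ht. apply HM; lra. }
assert (Bv : forall x, (x1 <= x <= x2)%R ->
  (Cmod (CInt (fun s => Q (x, s)) y1 y2)%C <= M * (y2 - y1))%R).
{ intros x H. rewrite <- (Rabs_pos_eq (y2 - y1)%R) by lra.
  apply Cmod_CInt_le; [apply ccont_v; exact HQ|].
  rewrite Rmin_left, Rmax_right by auto. intros t Ht. apply HM; lra. }
assert (B1 := Bh y1 ltac:(lra)). assert (B2 := Bh y2 ltac:(lra)).
assert (B3 := Bv x1 ltac:(lra)). assert (B4 := Bv x2 ltac:(lra)).
unfold Cminus.
eapply Rle_trans; [apply Cmod_triangle|]. rewrite Cmod_opp.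
eapply Rle_trans; [apply Rplus_le_compat_r, Cmod_triangle|]. rewrite Cmod_opp.
eapply Rle_trans; [apply Rplus_le_compat_r, Rplus_le_compat_r, Cmod_triangle|].
rewrite !Cmod_mult, Cmod_Ci. lra.
Qed.

Lemma rect_int_primitive F x1 x2 y1 y2 :
  (forall z, cderiv F z (Q z)) -> rect_int Q x1 x2 y1 y2 = 0.
Proof.
intros HF.
assert (Eh : forall y, CInt (fun s => Q (s, y)) x1 x2 = F (x2, y) - F (x1, y)).
{ intros y. apply (CInt_FTC (fun s => F (s, y))).
  - intros t. replace (Q (t, y)) with (Q (t, y) * 1) by ring.
    apply (curve_deriv_comp F (fun s => (s, y))); [apply HF|apply curve_deriv_pt_h].
  - apply ccont_h; exact HQ. }
assert (Ev : forall x, Ci * CInt (fun s => Q (x, s)) y1 y2 = F (x, y2) - F (x, y1)).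
{ intros x. rewrite <- CInt_scal by (apply ccont_v; exact HQ).
  apply (CInt_FTC (fun s => F (x, s))).
  - intros t. rewrite Cmult_comm.
    apply (curve_deriv_comp F (fun s => (x, s))); [apply HF|apply curve_deriv_pt_v].
  - intros t. apply curve_cont_scal. apply ccont_v; exact HQ. }
unfold rect_int. rewrite !Eh, !Ev. ring.
Qed.

End Rectangles.

Lemma rect_int_minus Q L x1 x2 y1 y2 : (forall z, ccont Q z) -> (forall z, ccont L z) ->
  rect_int (fun z => Q z - L z) x1 x2 y1 y2 = rect_int Q x1 x2 y1 y2 - rect_int L x1 x2 y1 y2.
Proof.
intros HQ HL. unfold rect_int.
rewrite (CInt_minus (fun s => Q (s, y1)) (fun s => L (s, y1))) by (apply ccont_h; auto).
rewrite (CInt_minus (fun s => Q (s, y2)) (fun s => L (s, y2))) by (apply ccont_h; auto).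
rewrite (CInt_minus (fun s => Q (x1, s)) (fun s => L (x1, s))) by (apply ccont_v; auto).
rewrite (CInt_minus (fun s => Q (x2, s)) (fun s => L (x2, s))) by (apply ccont_v; auto).
ring.
Qed.

(** * Bisection, Goursat's theorem and the existence of primitives *)

(** Nested intervals, described by their left ends: every left end lies below every right end, so
    the supremum of the left ends belongs to all of them. *)
Lemma half_interval_limit (xs : nat -> R) (a : R) : (0 <= a)%R ->
  (forall n, xs (S n) = xs n \/ xs (S n) = xs n + a / 2 ^ S n)%R ->
  exists X, forall n, (xs n <= X <= xs n + a / 2 ^ n)%R.
Proof.
intros Ha H.
assert (P : forall n, (0 <= a / 2 ^ n)%R).
{ intros n. apply Rmult_le_pos; auto. left. apply Rinv_0_lt_compat, pow_lt. lra. }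
assert (Hs : forall n, (a / 2 ^ n = a / 2 ^ S n + a / 2 ^ S n)%R).
{ intros n. simpl. field. apply pow_nonzero. lra. }
assert (Up : forall n k, (xs n <= xs (n + k)%nat)%R).
{ intros n k. induction k.
  - rewrite Nat.add_0_r. lra.
  - rewrite Nat.add_succ_r. specialize (P (S (n + k))). destruct (H (n + k)%nat); lra. }
assert (Dn : forall n k, (xs (n + k)%nat + a / 2 ^ (n + k) <= xs n + a / 2 ^ n)%R).
{ intros n k. induction k.
  - rewrite Nat.add_0_r. lra.
  - rewrite Nat.add_succ_r. specialize (P (S (n + k))). specialize (Hs (n + k)%nat).
    destruct (H (n + k)%nat); lra. }
assert (B : forall m n, (xs m <= xs n + a / 2 ^ n)%R).
{ intros m n. destruct (Nat.le_ge_cases m n) as [L|L].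
  - replace n with (m + (n - m))%nat by lia.
    specialize (Up m (n - m)%nat). specialize (P (m + (n - m))%nat). lra.
  - replace m with (n + (m - n))%nat by lia.
    specialize (Dn n (m - n)%nat). specialize (P (n + (m - n))%nat). lra. }
destruct (completeness (fun x => exists m, x = xs m)) as [X [X1 X2]].
- exists (xs O + a / 2 ^ 0)%R. intros x [m ->]. apply B.
- exists (xs O). now exists O.
- exists X. intros n. split.
  + apply X1. now exists n.
  + apply X2. intros x [m ->]. apply B.
Qed.

(** A rectangle is given by its lower left corner and its side lengths. The hypothesis only asserts
    that some quarter retains a fourth of mu, so the nested sequence of quarters is obtained by
    choice. *)
Lemma bisection (mu : R -> R -> R -> R -> R) :
  (forall x y a b, exists x' y', (x' = x \/ x' = x + a / 2)%R /\ (y' = y \/ y' = y + b / 2)%R /\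
     (mu x y a b <= 4 * mu x' y' (a / 2) (b / 2))%R) ->
  forall x y a b, (0 <= a)%R -> (0 <= b)%R ->
  exists X Y, (x <= X <= x + a)%R /\ (y <= Y <= y + b)%R /\
    forall n, exists x' y', (x' <= X <= x' + a / 2 ^ n)%R /\ (y' <= Y <= y' + b / 2 ^ n)%R /\
      (mu x y a b <= 4 ^ n * mu x' y' (a / 2 ^ n) (b / 2 ^ n))%R.
Proof.
intros H x y a b Ha Hb.
assert (K : forall (n : nat) (p : R * R), { q : R * R |
   (fst q = fst p \/ fst q = fst p + a / 2 ^ S n)%R /\ (snd q = snd p \/ snd q = snd p + b / 2 ^ S n)%R /\
   (mu (fst p) (snd p) (a / 2 ^ n) (b / 2 ^ n)
     <= 4 * mu (fst q) (snd q) (a / 2 ^ S n) (b / 2 ^ S n))%R }).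
{ intros n p. apply constructive_indefinite_description.
  destruct (H (fst p) (snd p) (a / 2 ^ n)%R (b / 2 ^ n)%R) as (x' & y' & H1 & H2 & H3).
  assert (E : forall c : R, (c / 2 ^ S n = c / 2 ^ n / 2)%R).
  { intros c. simpl. field. apply pow_nonzero. lra. }
  exists (x', y'). rewrite !E. auto. }
set (ps := fix ps n := match n with O => (x, y) | S m => proj1_sig (K m (ps m)) end).
assert (Hps : forall n,
   (fst (ps (S n)) = fst (ps n) \/ fst (ps (S n)) = fst (ps n) + a / 2 ^ S n)%R /\
   (snd (ps (S n)) = snd (ps n) \/ snd (ps (S n)) = snd (ps n) + b / 2 ^ S n)%R /\
   (mu (fst (ps n)) (snd (ps n)) (a / 2 ^ n) (b / 2 ^ n)
     <= 4 * mu (fst (ps (S n))) (snd (ps (S n))) (a / 2 ^ S n) (b / 2 ^ S n))%R).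
{ intros n. exact (proj2_sig (K n (ps n))). }
destruct (half_interval_limit (fun n => fst (ps n)) a Ha) as [X HX]; [apply Hps|].
destruct (half_interval_limit (fun n => snd (ps n)) b Hb) as [Y HY]; [apply Hps|].
exists X, Y.
split; [specialize (HX O); simpl in HX; lra|].
split; [specialize (HY O); simpl in HY; lra|].
intros n. exists (fst (ps n)), (snd (ps n)). split; [apply HX|]. split; [apply HY|].
induction n.
- simpl. rewrite !Rdiv_1_r. lra.
- destruct (Hps n) as (_ & _ & H3).
  eapply Rle_trans; [exact IHn|].
  replace (4 ^ S n)%R with (4 ^ n * 4)%R by (simpl; ring).
  rewrite Rmult_assoc. apply Rmult_le_compat_l; [left; apply pow_lt; lra|exact H3].
Qed.

Lemma Cmod_le_abs (x y : R) : (Cmod (x, y)%C <= Rabs x + Rabs y)%R.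
Proof.
replace (x, y) with (RtoC x + Ci * RtoC y).
- eapply Rle_trans; [apply Cmod_triangle|]. rewrite Cmod_mult, Cmod_Ci, !Cmod_R. lra.
- unfold Cplus, Cmult, RtoC, Ci; simpl. f_equal; ring.
Qed.

Lemma exists_div_pow2_lt a d : (0 < d)%R -> exists n, (a / 2 ^ n < d)%R.
Proof.
intros Hd. destruct (Rle_lt_dec a 0) as [La|La].
{ exists O. simpl. lra. }
destruct (pow_lt_1_zero (/2) ltac:(rewrite Rabs_pos_eq; lra) (d / a)) as [n Hn].
{ apply Rdiv_lt_0_compat; auto. }
exists n. specialize (Hn n (Nat.le_refl _)).
rewrite Rabs_pos_eq in Hn by (apply pow_le; lra).
rewrite pow_inv in Hn. apply Rmult_lt_compat_r with (r := a) in Hn; auto.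
replace (d / a * a)%R with d in Hn by (field; lra).
unfold Rdiv. rewrite Rmult_comm. exact Hn.
Qed.

(** Near the limit point of the bisection, Q differs from its linearisation L by at most eps times
    the size of the rectangle, and L has a primitive. So the n-th boundary integral is O(eps / 4^n),
    although bisection keeps it at least m / 4^n. *)
Lemma goursat_pos Q x1 x2 y1 y2 : (forall z, ccont Q z) -> (x1 <= x2)%R -> (y1 <= y2)%R ->
  (forall x y, (x1 <= x <= x2)%R -> (y1 <= y <= y2)%R -> exists l, cderiv Q (x, y) l) ->
  rect_int Q x1 x2 y1 y2 = 0.
Proof.
intros HQ Hx Hy HD.
set (a := (x2 - x1)%R). set (b := (y2 - y1)%R).
destruct (bisection (fun x y a b => Cmod (rect_int Q x (x + a) y (y + b))%C)) with
  (x := x1) (y := y1) (a := a) (b := b) as (X & Y & BX & BY & HXY).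
{ clear - HQ. intros x y a b.
  set (r := fun x y => rect_int Q x (x + a / 2) y (y + b / 2)).
  assert (E : rect_int Q x (x + a) y (y + b) =
    (r x y + r (x + a / 2)%R y) + (r x (y + b / 2)%R + r (x + a / 2)%R (y + b / 2)%R)).
  { unfold r.
    replace (x + a / 2 + a / 2)%R with (x + a)%R by field.
    replace (y + b / 2 + b / 2)%R with (y + b)%R by field.
    rewrite <- !rect_int_split_x by exact HQ. apply rect_int_split_y; exact HQ. }
  assert (T : (Cmod (rect_int Q x (x + a) y (y + b))%C <=
    (Cmod (r x y)%C + Cmod (r (x + a / 2)%R y)%C) +
    (Cmod (r x (y + b / 2)%R)%C + Cmod (r (x + a / 2)%R (y + b / 2)%R)%C))%R).
  { rewrite E. eapply Rle_trans; [apply Cmod_triangle|].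
    apply Rplus_le_compat; apply Cmod_triangle. }
  set (m := Cmod (rect_int Q x (x + a) y (y + b))%C) in *.
  destruct (Rle_lt_dec m (4 * Cmod (r x y)%C)) as [L1|L1].
  { exists x, y. auto. }
  destruct (Rle_lt_dec m (4 * Cmod (r (x + a / 2)%R y)%C)) as [L2|L2].
  { exists (x + a / 2)%R, y. auto. }
  destruct (Rle_lt_dec m (4 * Cmod (r x (y + b / 2)%R)%C)) as [L3|L3].
  { exists x, (y + b / 2)%R. auto. }
  exists (x + a / 2)%R, (y + b / 2)%R. split; auto. split; auto.
  change (m <= 4 * Cmod (r (x + a / 2)%R (y + b / 2)%R)%C)%R. lra. }
{ unfold a; lra. } { unfold b; lra. }
replace (x1 + a)%R with x2 in * by (unfold a; ring).
replace (y1 + b)%R with y2 in * by (unfold b; ring).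
assert (Pa : (0 <= a)%R) by (unfold a; lra). assert (Pb : (0 <= b)%R) by (unfold b; lra).
destruct (HD X Y BX BY) as [l Hl].
apply Cmod_eq_0. apply Rle_antisym; [|apply Cmod_ge_0].
apply Rnot_lt_le. intros Hm.
set (m := Cmod (rect_int Q x1 x2 y1 y2)%C) in *.
(* This makes m = 4 * eps * (a + b + 1)^2, while the estimate below gives m <= 2 * eps * (a + b)^2.
   The 1 keeps the denominator positive for a degenerate rectangle. *)
set (eps := (m / (4 * ((a + b + 1) * (a + b + 1))))%R).
assert (Peps : (0 < eps)%R).
{ apply Rdiv_lt_0_compat; auto. nra. }
destruct (Hl eps Peps) as [d [Hd H1]].
destruct (exists_div_pow2_lt (a + b)%R d Hd) as [n Hn].
destruct (HXY n) as (x' & y' & Ax & Ay & Hmu).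
set (L := fun z => Q (X, Y) + l * (z - (X, Y))).
assert (HL : forall z, cderiv L z l).
{ intros z. cut (cderiv L z (0 + l * (1 - 0))).
  { intros K. replace (0 + l * (1 - 0)) with l in K by ring. exact K. }
  apply cderiv_plus; [apply cderiv_const|]. apply cderiv_scal.
  apply cderiv_minus; [apply cderiv_id|apply cderiv_const]. }
assert (cL : forall z, ccont L z) by (intros z; eapply cderiv_ccont, HL).
assert (E : rect_int Q x' (x' + a / 2 ^ n) y' (y' + b / 2 ^ n) =
  rect_int (fun z => Q z - L z) x' (x' + a / 2 ^ n) y' (y' + b / 2 ^ n)).
{ rewrite rect_int_minus by auto.
  rewrite (rect_int_primitive L cL (fun z => Q (X, Y) * z + l * (/2) * ((z - (X, Y)) * (z - (X, Y))))).
  - ring.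
  - intros z. unfold L.
    replace (Q (X, Y) + l * (z - (X, Y))) with
      (Q (X, Y) * 1 + l * (/2) * (2 * (z - (X, Y)) * (1 - 0))) by field.
    apply cderiv_plus; [apply cderiv_scal, cderiv_id|]. apply cderiv_scal.
    apply (cderiv_comp (fun w => w * w)); [apply cderiv_sqr|].
    apply cderiv_minus; [apply cderiv_id|apply cderiv_const]. }
assert (P2 : (0 < 2 ^ n)%R) by (apply pow_lt; lra).
set (a' := (a / 2 ^ n)%R) in *. set (b' := (b / 2 ^ n)%R) in *.
assert (Pa' : (0 <= a')%R) by (apply Rmult_le_pos; [lra|left; apply Rinv_0_lt_compat; lra]).
assert (Pb' : (0 <= b')%R) by (apply Rmult_le_pos; [lra|left; apply Rinv_0_lt_compat; lra]).
assert (Eab : ((a + b) / 2 ^ n = a' + b')%R) by (unfold a', b'; field; lra).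
assert (Bd : (Cmod (rect_int Q x' (x' + a') y' (y' + b'))%C <= 2 * (eps * (a' + b')) * (a' + b'))%R).
{ rewrite E.
  eapply Rle_trans; [apply rect_int_le with (M := (eps * (a' + b'))%R); try lra|right; ring].
  { intros z. apply (ccont_plus Q (fun z => - L z)); auto.
    apply (cderiv_ccont _ _ (-(1) * l)).
    apply cderiv_ext with (fun z => -(1) * L z); [intros; ring|]. apply cderiv_scal, HL. }
  intros s t Hs Ht.
  assert (Hk : (Cmod ((s, t) - (X, Y))%C <= a' + b')%R).
  { unfold Cminus, Cplus, Copp; simpl. eapply Rle_trans; [apply Cmod_le_abs|].
    apply Rplus_le_compat; apply Rabs_le; lra. }
  specialize (H1 ((s, t) - (X, Y)) ltac:(lra)).
  rewrite Cplus_sub_cancel in H1.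
  unfold L.
  replace (Q (s, t) - (Q (X, Y) + l * ((s, t) - (X, Y)))) with
    (Q (s, t) - Q (X, Y) - l * ((s, t) - (X, Y))) by ring.
  eapply Rle_trans; [exact H1|]. apply Rmult_le_compat_l; lra. }
assert (E4 : (4 ^ n = 2 ^ n * 2 ^ n)%R) by (rewrite <- Rpow_mult_distr; f_equal; ring).
assert (F : (4 ^ n * (2 * (eps * (a' + b')) * (a' + b')) = 2 * eps * ((a + b) * (a + b)))%R).
{ rewrite E4, <- Eab. field. lra. }
assert (m <= 2 * eps * ((a + b) * (a + b)))%R.
{ rewrite <- F. eapply Rle_trans; [exact Hmu|].
  apply Rmult_le_compat_l; [left; apply pow_lt; lra|exact Bd]. }
assert (m = 4 * eps * ((a + b + 1) * (a + b + 1)))%R by (unfold eps; field; nra).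
nra.
Qed.

Lemma goursat Q x1 x2 y1 y2 : (forall z, ccont Q z) ->
  (forall x y, (Rmin x1 x2 <= x <= Rmax x1 x2)%R -> (Rmin y1 y2 <= y <= Rmax y1 y2)%R ->
    exists l, cderiv Q (x, y) l) ->
  rect_int Q x1 x2 y1 y2 = 0.
Proof.
intros HQ.
assert (Sx : forall u v w s, rect_int Q u v w s = - rect_int Q v u w s).
{ intros. assert (E := rect_int_split_x Q HQ u v u w s). rewrite rect_int_point_x in E.
  replace (rect_int Q u v w s) with
   (rect_int Q u v w s + rect_int Q v u w s - rect_int Q v u w s) by ring.
  rewrite <- E. ring. }
assert (Sy : forall u v w s, rect_int Q w s u v = - rect_int Q w s v u).
{ intros. assert (E := rect_int_split_y Q HQ w s u v u). rewrite rect_int_point_y in E.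
  replace (rect_int Q w s u v) with
   (rect_int Q w s u v + rect_int Q w s v u - rect_int Q w s v u) by ring.
  rewrite <- E. ring. }
assert (Z : - (0) = 0) by ring.
destruct (Rle_lt_dec x1 x2) as [Lx|Lx]; destruct (Rle_lt_dec y1 y2) as [Ly|Ly];
rewrite ?(Rmin_left x1 x2), ?(Rmax_right x1 x2) by lra;
rewrite ?(Rmin_right x1 x2), ?(Rmax_left x1 x2) by lra;
rewrite ?(Rmin_left y1 y2), ?(Rmax_right y1 y2) by lra;
rewrite ?(Rmin_right y1 y2), ?(Rmax_left y1 y2) by lra; intros HD.
- apply goursat_pos; auto.
- rewrite Sy, goursat_pos; auto; lra.
- rewrite Sx, goursat_pos; auto; lra.
- rewrite Sx, Sy, goursat_pos; auto; try lra. ring.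
Qed.

Lemma goursat_avoiding Q (al be : R) x1 x2 y1 y2 : (forall z, ccont Q z) ->
  (forall z, z <> (al, be) -> exists l, cderiv Q z l) ->
  (al < Rmin x1 x2 \/ Rmax x1 x2 < al \/ be < Rmin y1 y2 \/ Rmax y1 y2 < be)%R ->
  rect_int Q x1 x2 y1 y2 = 0.
Proof.
intros HQ HD H. apply goursat; auto.
intros x y Hx Hy. apply HD. intros E. injection E as E1 E2. lra.
Qed.

(* The exceptional point is cut out by a small square, on which [Q] is bounded. *)
Lemma goursat_punctured Q (al be : R) x0 y0 x y : (forall z, ccont Q z) ->
  (forall z, z <> (al, be) -> exists l, cderiv Q z l) ->
  (x0 < al)%R -> (y0 < be)%R -> rect_int Q x0 x y0 y = 0.
Proof.
intros HQ HD Hx0 Hy0.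
assert (G := goursat_avoiding Q al be).
destruct (Rlt_le_dec x al) as [Lx|Lx].
{ apply G; auto. right; left. apply Rmax_lub_lt; lra. }
destruct (Rlt_le_dec y be) as [Ly|Ly].
{ apply G; auto. right; right; right. apply Rmax_lub_lt; lra. }
set (M := (Cmod (Q (al, be))%C + 1)%R).
destruct (HQ (al, be) 1%R Rlt_0_1) as [d [Hd HM]].
assert (PM : (0 < M)%R) by (unfold M; assert (K := Cmod_ge_0 (Q (al, be))); lra).
apply Cmod_eq_0. apply Rle_antisym; [|apply Cmod_ge_0].
apply Rnot_lt_le. intros Hm.
set (m := Cmod (rect_int Q x0 x y0 y)%C) in *.
(* In order: the square of half-side e stays where |Q| <= M; its left and lower sides stay beyond x0
   and y0; and its perimeter, at most 8 * e, gives an integral of at most 8 * M * e <= m / 2. *)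
set (e := Rmin (Rmin (d / 4) ((al - x0) / 2)) (Rmin ((be - y0) / 2) (m / (16 * M)))).
assert (Pe : (0 < e)%R).
{ repeat apply Rmin_pos; try lra. apply Rdiv_lt_0_compat; lra. }
assert (e1 : (e <= d / 4)%R) by (eapply Rle_trans; apply Rmin_l).
assert (e2 : (e <= (al - x0) / 2)%R) by (eapply Rle_trans; [apply Rmin_l|apply Rmin_r]).
assert (e3 : (e <= (be - y0) / 2)%R) by (eapply Rle_trans; [apply Rmin_r|apply Rmin_l]).
assert (e4 : (e <= m / (16 * M))%R) by (eapply Rle_trans; [apply Rmin_r|apply Rmin_r]).
(* If x or y lies within e of the exceptional point, the square is cut off there. *)
set (xi := Rmin x (al + e)). set (up := Rmin y (be + e)).
assert (X1 : (al <= xi)%R) by (apply Rmin_glb; lra).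
assert (X2 : (xi <= al + e)%R) by apply Rmin_r.
assert (Y1 : (be <= up)%R) by (apply Rmin_glb; lra).
assert (Y2 : (up <= be + e)%R) by apply Rmin_r.
assert (E : rect_int Q x0 x y0 y = rect_int Q (al - e) xi (be - e) up).
{ rewrite (rect_int_split_x Q HQ x0 (al - e) x), (rect_int_split_x Q HQ (al - e) xi x).
  rewrite (rect_int_split_y Q HQ (al - e) xi y0 (be - e) y),
    (rect_int_split_y Q HQ (al - e) xi (be - e) up y).
  rewrite (G x0 (al - e)%R y0 y); auto.
  2: { right; left. apply Rmax_lub_lt; lra. }
  rewrite (G (al - e)%R xi y0 (be - e)%R); auto.
  2: { right; right; right. apply Rmax_lub_lt; lra. }
  assert (Zx : rect_int Q xi x y0 y = 0).
  { destruct (Rle_lt_dec x (al + e)) as [L|L].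
    - unfold xi. rewrite Rmin_left by auto. apply rect_int_point_x.
    - apply G; auto. left. unfold xi. rewrite (Rmin_right x) by lra. apply Rmin_glb_lt; lra. }
  assert (Zy : rect_int Q (al - e) xi up y = 0).
  { destruct (Rle_lt_dec y (be + e)) as [L|L].
    - unfold up. rewrite Rmin_left by auto. apply rect_int_point_y.
    - apply G; auto. right; right; left.
      unfold up. rewrite (Rmin_right y) by lra. apply Rmin_glb_lt; lra. }
  rewrite Zx, Zy. ring. }
assert (B : (m <= 2 * M * ((xi - (al - e)) + (up - (be - e))))%R).
{ unfold m. rewrite E. apply rect_int_le; auto; try lra.
  intros s t Hs Ht.
  assert (Hk : (Cmod ((s, t) - (al, be))%C < d)%R).
  { unfold Cminus, Cplus, Copp; simpl. eapply Rle_lt_trans; [apply Cmod_le_abs|].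
    apply Rle_lt_trans with (e + e)%R; [|lra].
    apply Rplus_le_compat; apply Rabs_le; lra. }
  specialize (HM _ Hk).
  rewrite Cplus_sub_cancel in HM.
  replace (Q (s, t)) with (Q (s, t) - Q (al, be) + Q (al, be)) by ring.
  eapply Rle_trans; [apply Cmod_triangle|]. unfold M. lra. }
assert (m <= 8 * M * e)%R by nra.
assert (8 * M * e <= 8 * M * (m / (16 * M)))%R by (apply Rmult_le_compat_l; lra).
replace (8 * M * (m / (16 * M)))%R with (m / 2)%R in * by (field; lra).
lra.
Qed.

Lemma Cmod_le_snd (x s t : R) : (Rabs s <= Rabs t)%R -> (Cmod (x, s)%C <= Cmod (x, t)%C)%R.
Proof.
intros H. unfold Cmod; simpl fst; simpl snd. apply sqrt_le_1_alt.
apply Rplus_le_compat_l. rewrite <- (pow2_abs s), <- (pow2_abs t).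
apply pow_incr. split; [apply Rabs_pos|auto].
Qed.

Lemma Cmod_le_fst (s t y : R) : (Rabs s <= Rabs t)%R -> (Cmod (s, y)%C <= Cmod (t, y)%C)%R.
Proof.
intros H. unfold Cmod; simpl fst; simpl snd. apply sqrt_le_1_alt.
apply Rplus_le_compat_r. rewrite <- (pow2_abs s), <- (pow2_abs t).
apply pow_incr. split; [apply Rabs_pos|auto].
Qed.

Lemma CInt_const (k : C) a b : CInt (fun _ => k) a b = (b - a)%R * k.
Proof.
apply is_CInt_unique.
replace ((b - a)%R * k) with (@scal R_AbsRing C_R_NormedModule (b - a)%R k).
- apply (@is_RInt_const C_R_NormedModule).
- destruct k as [k1 k2]. unfold scal; simpl. unfold prod_scal; simpl.
  unfold scal; simpl; unfold mult; simpl. unfold Cmult, RtoC; simpl. f_equal; ring.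
Qed.

(** F integrates horizontally from (x0, y0) and then vertically. The rectangles ending at (x, y) and
    at (x + h1, y) together show that the increment of F is the integral along the short path
    through (x + h1, y), where Q is close to Q (x, y). Only rectangles with the corner (x0, y0)
    occur. *)
Lemma primitive_of_rect Q x0 y0 : (forall z, ccont Q z) ->
  (forall x y, rect_int Q x0 x y0 y = 0) -> exists F, forall z, cderiv F z (Q z).
Proof.
intros HQ HR.
exists (fun z => CInt (fun s => Q (s, y0)) x0 (fst z) + Ci * CInt (fun s => Q (fst z, s)) y0 (snd z)).
intros [x y] eps He.
destruct (HQ (x, y) (eps / 2)%R ltac:(lra)) as [d [Hd H1]].
exists d. split; auto. intros [h1 h2] Hh. simpl fst; simpl snd.
set (q := Q (x, y)) in *.
match goal with |- (Cmod ?e <= _)%R => replace e with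
  (Ci * CInt (fun s => Q ((x + h1)%R, s) - q) y (y + h2) +
   CInt (fun s => Q (s, y) - q) x (x + h1)) end.
- assert (B1 : (Cmod (CInt (fun s => Q ((x + h1)%R, s) - q) y (y + h2))%C <= eps / 2 * Cmod (h1, h2)%C)%R).
  { eapply Rle_trans; [apply Cmod_CInt_le with (M := (eps / 2)%R)|].
    - intros t. apply curve_cont_minus; [apply ccont_v; auto|apply curve_cont_const].
    - intros t Ht.
      assert (Hk : (Cmod (h1, t - y)%R <= Cmod (h1, h2)%C)%R).
      { apply Cmod_le_snd. revert Ht. unfold Rmin, Rmax, Rabs.
        repeat destruct Rle_dec; repeat destruct Rcase_abs; lra. }
      specialize (H1 (h1, t - y)%R (Rle_lt_trans _ _ _ Hk Hh)).
      replace ((x, y) + (h1, t - y)%R) with ((x + h1)%R, t) in H1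
        by (unfold Cplus; simpl; f_equal; ring). lra.
    - apply Rmult_le_compat_l; [lra|]. replace (y + h2 - y)%R with h2 by ring.
      eapply Rle_trans; [|apply Rmax_Cmod]. apply Rmax_r. }
  assert (B2 : (Cmod (CInt (fun s => Q (s, y) - q) x (x + h1))%C <= eps / 2 * Cmod (h1, h2)%C)%R).
  { eapply Rle_trans; [apply Cmod_CInt_le with (M := (eps / 2)%R)|].
    - intros t. apply curve_cont_minus; [apply ccont_h; auto|apply curve_cont_const].
    - intros t Ht.
      assert (Hk : (Cmod (t - x, 0)%R <= Cmod (h1, h2)%C)%R).
      { apply Rle_trans with (Cmod (h1, 0%R)%C).
        - apply Cmod_le_fst. revert Ht. unfold Rmin, Rmax, Rabs.
          repeat destruct Rle_dec; repeat destruct Rcase_abs; lra.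
        - apply Cmod_le_snd. rewrite Rabs_R0. apply Rabs_pos. }
      specialize (H1 (t - x, 0)%R (Rle_lt_trans _ _ _ Hk Hh)).
      replace ((x, y) + (t - x, 0)%R) with (t, y) in H1
        by (unfold Cplus; simpl; f_equal; ring). lra.
    - apply Rmult_le_compat_l; [lra|]. replace (x + h1 - x)%R with h1 by ring.
      eapply Rle_trans; [|apply Rmax_Cmod]. apply Rmax_l. }
  eapply Rle_trans; [apply Cmod_triangle|]. rewrite Cmod_mult, Cmod_Ci. lra.
- rewrite (CInt_minus (fun s => Q ((x + h1)%R, s)) (fun _ => q));
    [|apply ccont_v; exact HQ|intros; apply curve_cont_const].
  rewrite (CInt_minus (fun s => Q (s, y)) (fun _ => q));
    [|apply ccont_h; exact HQ|intros; apply curve_cont_const].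
  rewrite !CInt_const.
  assert (R1 := HR x y). assert (R2 := HR (x + h1)%R y). unfold rect_int in R1, R2.
  rewrite <- (CInt_Chasles (fun s => Q ((x + h1)%R, s)) y0 y (y + h2)) by (apply ccont_v; auto).
  rewrite <- (CInt_Chasles (fun s => Q (s, y)) x0 x (x + h1)) in R2 by (apply ccont_h; auto).
  replace (y + h2 - y)%R with h2 by ring. replace (x + h1 - x)%R with h1 by ring.
  replace ((h1, h2) : C) with (RtoC h1 + Ci * RtoC h2)
    by (unfold Cplus, Cmult, RtoC, Ci; simpl; f_equal; ring).
  set (A1 := CInt (fun s => Q (s, y0)) x0 x) in *.
  set (A2 := CInt (fun s => Q (s, y0)) x0 (x + h1)) in *.
  set (A3 := CInt (fun s => Q ((x + h1)%R, s)) y0 y) in *.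
  set (A4 := CInt (fun s => Q (x, s)) y0 y) in *.
  set (A5 := CInt (fun s => Q (s, y)) x0 x) in *.
  set (A6 := CInt (fun s => Q (s, y)) x (x + h1)) in *.
  set (A7 := CInt (fun s => Q ((x + h1)%R, s)) y (y + h2)) in *.
  set (A8 := CInt (fun s => Q (x0, s)) y0 y) in *.
  fold q.
  assert (K : A6 = A2 + Ci * A3 - A1 - Ci * A4).
  { replace A6 with (A2 + Ci * A3 - A5 - Ci * A8 - (A2 + Ci * A3 - (A5 + A6) - Ci * A8)) by ring.
    rewrite R2.
    replace (A2 + Ci * A3 - A1 - Ci * A4) with
     (A2 + Ci * A3 - A5 - Ci * A8 - (A1 + Ci * A4 - A5 - Ci * A8)) by ring.
    rewrite R1. ring. }
  rewrite K. ring.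
Qed.

(** One exceptional point is allowed because a difference quotient [diff_quot f a] is at first known
    only to be continuous at a. The base corner is placed below and to the left of that point, as
    [goursat_punctured] requires. *)
Lemma primitive_punctured Q a : (forall z, ccont Q z) ->
  (forall z, z <> a -> exists l, cderiv Q z l) -> exists F, forall z, cderiv F z (Q z).
Proof.
intros HQ HD. destruct a as [al be].
apply (primitive_of_rect Q (al - 1) (be - 1) HQ).
intros x y. apply (goursat_punctured Q al be); auto; lra.
Qed.

Lemma entire_primitive f : entire f -> exists F, forall z, cderiv F z (f z).
Proof.
rewrite entire_cderiv. intros H. apply (primitive_punctured f 0).
- intros z. eapply cderiv_ccont, H.
- intros z _. eexists. apply H.
Qed.

(** * Cauchy's formula *)

Lemma cderiv_ext_loc (f g : C -> C) z l r : (0 < r)%R ->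
  (forall w, (Cmod (w - z)%C < r)%R -> f w = g w) -> cderiv f z l -> cderiv g z l.
Proof.
intros Hr E H eps He. destruct (H eps He) as [d [Hd H1]].
exists (Rmin d r). split; [apply Rmin_pos; auto|]. intros h Hh.
rewrite <- !E.
- apply H1. eapply Rlt_le_trans; [exact Hh|apply Rmin_l].
- replace (z - z) with (RtoC 0) by ring. rewrite Cmod_0. auto.
- replace (z + h - z) with h by ring. eapply Rlt_le_trans; [exact Hh|apply Rmin_r].
Qed.

Lemma Cminus_neq (a b : C) : a <> b -> a - b <> 0.
Proof. intros H E. apply H. replace a with (a - b + b) by ring. rewrite E. ring. Qed.

Definition diff_quot (f : C -> C) (a z : C) : C :=
  if excluded_middle_informative (z = a) then C_derive f a else (f z - f a) * / (z - a).

Lemma diff_quot_neq f a z : z <> a -> diff_quot f a z = (f z - f a) * / (z - a).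
Proof. intros H. unfold diff_quot. destruct excluded_middle_informative; tauto. Qed.

Lemma diff_quot_cderiv f a z : entire f -> z <> a -> exists l, cderiv (diff_quot f a) z l.
Proof.
rewrite entire_cderiv. intros Hf Hz.
exists ((C_derive f z - 0) * / (z - a) + (f z - f a) * (- / ((z - a) * (z - a)) * (1 - 0))).
apply cderiv_ext_loc with (f := fun w => (f w - f a) * / (w - a)) (r := Cmod (z - a)%C).
- apply (proj1 (Cmod_gt_0 _)), Cminus_neq, Hz.
- intros w Hw. symmetry. apply diff_quot_neq. intros ->.
  rewrite Cmod_minus_sym in Hw. lra.
- apply (cderiv_mult (fun w => f w - f a) (fun w => / (w - a))).
  + apply cderiv_minus; [apply Hf|apply cderiv_const].
  + apply (cderiv_comp (fun w => / w) (fun w => w - a)).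
    * apply cderiv_inv, Cminus_neq, Hz.
    * apply cderiv_minus; [apply cderiv_id|apply cderiv_const].
Qed.

Lemma diff_quot_ccont f a z : entire f -> ccont (diff_quot f a) z.
Proof.
intros Hf. destruct (excluded_middle_informative (z = a)) as [->|Hz].
2: { destruct (diff_quot_cderiv f a z Hf Hz) as [l Hl]. eapply cderiv_ccont, Hl. }
apply entire_cderiv with (z := a) in Hf.
intros eps He. destruct (Hf (eps / 2)%R ltac:(lra)) as [d [Hd H]].
exists d. split; auto. intros h Hh.
unfold diff_quot at 2. destruct excluded_middle_informative as [_|N]; [|tauto].
unfold diff_quot. destruct excluded_middle_informative as [_|N].
{ replace (C_derive f a - C_derive f a) with (RtoC 0) by ring. rewrite Cmod_0. auto. }
assert (h0 : h <> 0). { intros ->. apply N. ring. }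
assert (Ph : (0 < Cmod h)%R) by (apply (proj1 (Cmod_gt_0 _)); auto).
replace (a + h - a) with h by ring.
replace ((f (a + h) - f a) * / h - C_derive f a) with
  ((f (a + h) - f a - C_derive f a * h) * / h) by (field; auto).
rewrite Cmod_mult, Cmod_inv by auto. specialize (H h Hh).
apply Rle_lt_trans with (eps / 2 * Cmod h * / Cmod h)%R.
- apply Rmult_le_compat_r; auto. left. apply Rinv_0_lt_compat; auto.
- replace (eps / 2 * Cmod h * / Cmod h)%R with (eps / 2)%R by (field; lra). lra.
Qed.

(** * Integrals over circles *)

Definition cis (t : R) : C := (cos t, sin t).

Lemma cis_deriv t : curve_deriv cis t (Ci * cis t).
Proof.
apply curve_deriv_pair; simpl.
- replace (0 * cos t - 1 * sin t)%R with (- sin t)%R by ring. apply is_derive_cos.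
- replace (0 * sin t + 1 * cos t)%R with (cos t) by ring. apply is_derive_sin.
Qed.

Lemma Cmod_cis t : Cmod (cis t)%C = 1%R.
Proof.
unfold Cmod, cis. simpl fst; simpl snd.
replace (cos t ^ 2 + sin t ^ 2)%R with 1%R; [apply sqrt_1|].
rewrite <- (sin2_cos2 t). unfold Rsqr. ring.
Qed.

Lemma cis_0 : cis 0 = 1.
Proof. unfold cis. rewrite cos_0, sin_0. reflexivity. Qed.

Lemma cis_2PI : cis (2 * PI) = 1.
Proof. unfold cis. rewrite cos_2PI, sin_2PI. reflexivity. Qed.

Lemma cis_plus s t : cis (s + t) = cis s * cis t.
Proof. unfold cis. rewrite cos_plus, sin_plus. unfold Cmult; simpl. f_equal; ring. Qed.

Lemma cis_neq_0 t : cis t <> 0.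
Proof. intros E. assert (K := Cmod_cis t). rewrite E, Cmod_0 in K. lra. Qed.

Lemma cis_cont t : curve_cont cis t.
Proof. eapply curve_deriv_cont, cis_deriv. Qed.

Lemma circle_deriv (r : R) t : curve_deriv (fun s => r * cis s) t (r * (Ci * cis t)).
Proof.
apply (curve_deriv_comp (fun w => r * w) cis).
- apply cderiv_linear.
- apply cis_deriv.
Qed.

Lemma circle_cont (r : R) t : curve_cont (fun s => r * cis s) t.
Proof. eapply curve_deriv_cont, circle_deriv. Qed.

Lemma Cmod_circle (r : R) t : (0 <= r)%R -> Cmod (r * cis t)%C = r.
Proof. intros H. rewrite Cmod_mult, Cmod_cis, Cmod_R, Rabs_pos_eq; auto. ring. Qed.

Lemma Ci_neq_0 : Ci <> 0.
Proof. intros E. assert (K := Cmod_Ci). rewrite E, Cmod_0 in K. lra. Qed.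

(** The factor [r * cis t] is dz / (i dt), so this is the contour integral of the difference
    quotient, which has a primitive. It is Cauchy's formula before the winding integral is
    evaluated. *)
Lemma diff_quot_circle f a (r : R) : entire f ->
  CInt (fun t => diff_quot f a (r * cis t) * (r * cis t)) 0 (2 * PI) = 0.
Proof.
intros Hf.
destruct (primitive_punctured (diff_quot f a) a) as [F HF].
- intros z. apply diff_quot_ccont, Hf.
- intros z Hz. apply diff_quot_cderiv; auto.
- assert (K : CInt (fun t => diff_quot f a (r * cis t) * (r * (Ci * cis t))) 0 (2 * PI) = 0).
  { rewrite (CInt_FTC (fun t => F (r * cis t))).
    - rewrite cis_0, cis_2PI. ring.
    - intros t. apply (curve_deriv_comp F (fun s => r * cis s)); [apply HF|apply circle_deriv].
    - intros t. apply curve_cont_mult.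
      + apply (ccont_comp_curve _ (fun s => r * cis s)); [apply diff_quot_ccont, Hf|apply circle_cont].
      + apply curve_cont_scal, curve_cont_scal, cis_cont. }
  rewrite (CInt_ext _ (fun t => Ci * (diff_quot f a (r * cis t) * (r * cis t)))) in K
    by (intros; ring).
  rewrite CInt_scal in K.
  + set (I := CInt _ _ _) in *. replace I with (/ Ci * (Ci * I)) by (field; apply Ci_neq_0).
    rewrite K. ring.
  + intros t. apply curve_cont_mult.
      * apply (ccont_comp_curve _ (fun s => r * cis s)); [apply diff_quot_ccont, Hf|apply circle_cont].
      * apply circle_cont.
Qed.

Lemma entire_ccont f z : entire f -> ccont f z.
Proof. intros H. eapply cderiv_ccont. apply entire_cderiv, H. Qed.

Lemma entire_circle_cont f (r : R) t : entire f -> curve_cont (fun s => f (r * cis s)) t.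
Proof.
intros H. apply (ccont_comp_curve f (fun s => r * cis s)); [apply entire_ccont, H|apply circle_cont].
Qed.

(** For a = 0 the quotient times [r * cis t] is f (r * cis t) - f 0, and no kernel is left. *)
Lemma mean_value f (r : R) : entire f -> (r <> 0)%R ->
  CInt (fun t => f (r * cis t)) 0 (2 * PI) = (2 * PI)%R * f 0.
Proof.
intros Hf Hr.
assert (r0 : RtoC r <> 0) by (intros E; apply Hr; injection E; auto).
assert (K := diff_quot_circle f 0 r Hf).
rewrite (CInt_ext _ (fun t => f (r * cis t) - f 0)) in K.
- rewrite CInt_minus, CInt_const in K.
  + replace (2 * PI - 0)%R with (2 * PI)%R in K by ring.
    set (I := CInt _ _ _) in *. replace I with (I - (2 * PI)%R * f 0 + (2 * PI)%R * f 0) by ring.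
    rewrite K. ring.
  + intros t. apply entire_circle_cont, Hf.
  + intros; apply curve_cont_const.
- intros t. assert (z0 : r * cis t <> 0) by (apply Cmult_neq_0; auto using cis_neq_0).
  rewrite diff_quot_neq by auto. field. split; auto. apply cis_neq_0.
Qed.

(** A quadratic remainder, uniform in t, is enough to differentiate under the integral; Cauchy
    kernels provide one by explicit algebra. *)
Lemma CInt_param_cderiv (K : R -> C -> C) (K' : R -> C) a (M d : R) : (0 < d)%R ->
  (forall b, (Cmod (b - a)%C < d)%R -> forall t, curve_cont (fun s => K s b) t) ->
  (forall t, curve_cont K' t) ->
  (forall t h, (0 <= t <= 2 * PI)%R -> (Cmod h < d)%R ->
    (Cmod (K t (a + h) - K t a - K' t * h)%C <= M * (Cmod h * Cmod h))%R) ->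
  cderiv (fun b => CInt (fun t => K t b) 0 (2 * PI)) a (CInt K' 0 (2 * PI)).
Proof.
intros Hd HK HK' H eps He.
set (M' := (Rabs M + 1)%R). assert (PM : (1 <= M')%R) by (unfold M'; assert (Q := Rabs_pos M); lra).
assert (Pp : (0 < 2 * PI)%R) by (assert (Q := PI_RGT_0); lra).
exists (Rmin d (eps / (M' * (2 * PI)))). split.
{ apply Rmin_pos; auto. apply Rdiv_lt_0_compat; auto. nra. }
intros h Hh.
assert (h1 := Rlt_le_trans _ _ _ Hh (Rmin_l _ _)).
assert (h2 := Rlt_le_trans _ _ _ Hh (Rmin_r _ _)).
assert (C1 : forall t, curve_cont (fun s => K s (a + h)) t).
{ apply HK. replace (a + h - a) with h by ring. auto. }
assert (C2 : forall t, curve_cont (fun s => K s a) t).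
{ apply HK. replace (a - a) with (RtoC 0) by ring. rewrite Cmod_0. auto. }
rewrite (Cmult_comm (CInt K' 0 (2 * PI)) h).
rewrite <- CInt_scal, <- CInt_minus, <- CInt_minus; auto.
2: { intros. apply curve_cont_minus; auto. }
2: { intros. apply curve_cont_scal; auto. }
eapply Rle_trans; [apply Cmod_CInt_le with (M := (M' * (Cmod h * Cmod h))%R)|].
- intros. apply curve_cont_minus; [apply curve_cont_minus|apply curve_cont_scal]; auto.
- intros t Ht. rewrite Rmin_left, Rmax_right in Ht by lra. rewrite (Cmult_comm h). eapply Rle_trans; [apply H; auto|].
  apply Rmult_le_compat_r; [assert (Q := Cmod_ge_0 h); nra|].
  unfold M'. assert (Q := Rle_abs M). lra.
- rewrite Rabs_pos_eq by lra.
  apply Rlt_div_r in h2; [|nra]. assert (Q := Cmod_ge_0 h). nra.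
Qed.

Lemma Cmod_reverse_triangle a b : (Rabs (Cmod a - Cmod b) <= Cmod (a - b)%C)%R.
Proof.
assert (T1 := Cmod_triangle (a - b) b). replace (a - b + b) with a in T1 by ring.
assert (T2 := Cmod_triangle (b - a) a). replace (b - a + a) with b in T2 by ring.
rewrite (Cmod_minus_sym b a) in T2. apply Rabs_le. lra.
Qed.

Lemma continuous_Cmod h t : curve_cont h t -> continuous (fun s => Cmod (h s)%C) t.
Proof.
intros H P [e HP]. destruct (curve_cont_eps_inv _ _ H e (cond_pos e)) as [d [Hd H1]].
exists (mkposreal d Hd). intros y Hy. apply HP.
change (Rabs (y - t) < d)%R in Hy.
change (Rabs (Cmod (h y)%C - Cmod (h t)%C) < e)%R.
eapply Rle_lt_trans; [apply Cmod_reverse_triangle|].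
replace y with (t + (y - t))%R by (simpl; ring). apply H1. exact Hy.
Qed.

Section CauchyKernel.
Variables (r : R) (h : R -> C).
Hypothesis Hh : forall t, curve_cont h t.

Lemma circle_neq (a : C) t : (Cmod a < r)%R -> r * cis t - a <> 0.
Proof.
intros Ha. apply Cminus_neq. intros E.
assert (K := Cmod_circle r t). rewrite E in K. assert (Q := Cmod_ge_0 a).
specialize (K ltac:(lra)). lra.
Qed.

Lemma circle_dist_ge (a : C) t : (Cmod a < r)%R -> (r - Cmod a <= Cmod (r * cis t - a)%C)%R.
Proof.
intros Ha. assert (Q := Cmod_ge_0 a). rewrite <- (Cmod_circle r t) at 1 by lra.
replace (r * cis t) with (r * cis t - a + a) at 1 by ring.
assert (T := Cmod_triangle (r * cis t - a) a). lra.
Qed.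

Lemma kernel_cont (a : C) t : (Cmod a < r)%R -> curve_cont (fun s => / (r * cis s - a)) t.
Proof.
intros Ha. apply (ccont_comp_curve (fun w => / w) (fun s => r * cis s - a)).
- eapply cderiv_ccont, cderiv_inv. apply circle_neq, Ha.
- apply curve_cont_minus; [apply circle_cont|apply curve_cont_const].
Qed.

Lemma curve_bounded (a b : R) : (a <= b)%R ->
  exists M, (0 <= M)%R /\ forall t, (a <= t <= b)%R -> (Cmod (h t)%C <= M)%R.
Proof.
intros Hab. destruct (continuity_ab_maj (fun t => Cmod (h t)%C) a b Hab) as [m [Hm _]].
- intros t _. apply continuity_pt_filterlim, continuous_Cmod, Hh.
- exists (Cmod (h m)%C). split; [apply Cmod_ge_0|exact Hm].
Qed.

Lemma integrand_bounded : exists B, (0 <= B)%R /\ forall t, (0 <= t <= 2 * PI)%R -> (Cmod (h t)%C <= B)%R.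
Proof. apply curve_bounded. assert (Q := PI_RGT_0). lra. Qed.

End CauchyKernel.

Lemma Cmod_sub_ge (w h : C) d : (d <= Cmod w)%R -> (Cmod h < d / 2)%R -> (d / 2 <= Cmod (w - h)%C)%R.
Proof.
intros Hw Hh. assert (T := Cmod_triangle (w - h) h). replace (w - h + h) with w in T by ring. lra.
Qed.

Lemma Cmod_pos_neq (w : C) : (0 < Cmod w)%R -> w <> 0.
Proof. apply (proj2 (Cmod_gt_0 w)). Qed.

Lemma cauchy_kernel_cderiv (r : R) (h : R -> C) (a : C) : (forall t, curve_cont h t) ->
  (Cmod a < r)%R ->
  cderiv (fun b => CInt (fun t => h t * / (r * cis t - b)) 0 (2 * PI)) a
    (CInt (fun t => h t * (/ (r * cis t - a) * / (r * cis t - a))) 0 (2 * PI)).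
Proof.
intros Hh Ha. destruct (integrand_bounded h Hh) as [B [PB HB]].
set (d := (r - Cmod a)%R). assert (Pd : (0 < d)%R) by (unfold d; lra).
(* With w = r * cis t - a the remainder is h t * k^2 / (w^2 * (w - k)), where |w| >= d and |w - k|
   >= d / 2. *)
apply CInt_param_cderiv with (M := (B * (2 / (d * d * d)))%R) (d := (d / 2)%R); [lra| | |].
- intros b Hb t. apply curve_cont_mult; auto. apply kernel_cont.
  assert (T := Cmod_triangle (b - a) a). replace (b - a + a) with b in T by ring. unfold d in *. lra.
- curve_cont_tac; apply kernel_cont; auto.
- intros t k Ht Hk.
  assert (Hw := circle_dist_ge r a t Ha). fold d in Hw.
  set (w := r * cis t - a) in *.
  replace (r * cis t - (a + k)) with (w - k) by (unfold w; ring).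
  assert (Hwk := Cmod_sub_ge w k d Hw Hk).
  assert (w0 : w <> 0) by (apply Cmod_pos_neq; lra).
  assert (wk0 : w - k <> 0) by (apply Cmod_pos_neq; lra).
  replace (h t * / (w - k) - h t * / w - h t * (/ w * / w) * k) with
    (h t * / (w * w * (w - k)) * (k * k)) by (field; auto).
  rewrite !Cmod_mult, Cmod_inv, !Cmod_mult by (repeat apply Cmult_neq_0; auto).
  assert (Q := Cmod_ge_0 k). apply Rmult_le_compat_r; [nra|].
  apply Rmult_le_compat; auto using Cmod_ge_0.
  + left. apply Rinv_0_lt_compat. repeat apply Rmult_lt_0_compat; lra.
  + replace (2 / (d * d * d))%R with (/ (d * d * (d / 2)))%R by (field; lra).
    apply Rinv_le_contravar; [repeat apply Rmult_lt_0_compat; lra|].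
    apply Rmult_le_compat; try lra; [nra|]. apply Rmult_le_compat; lra.
Qed.

Lemma cauchy_kernel2_cderiv (r : R) (h : R -> C) (a : C) : (forall t, curve_cont h t) ->
  (Cmod a < r)%R ->
  exists l, cderiv (fun b => CInt (fun t => h t * (/ (r * cis t - b) * / (r * cis t - b))) 0 (2 * PI)) a l.
Proof.
intros Hh Ha. destruct (integrand_bounded h Hh) as [B [PB HB]].
set (d := (r - Cmod a)%R). assert (Pd : (0 < d)%R) by (unfold d; lra).
assert (Pa := Cmod_ge_0 a).
exists (CInt (fun t => 2 * h t * (/ (r * cis t - a) * (/ (r * cis t - a) * / (r * cis t - a)))) 0 (2 * PI)).
(* Here the remainder is h t * k^2 * (3w - 2k) / (w^3 * (w - k)^2). The numerator factor is at most
   6r + d <= 7r and the denominator at least d^5 / 4, whence 28. *)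
apply CInt_param_cderiv with
  (M := (B * (28 * r / (d * d * d * d * d)))%R) (d := (d / 2)%R); [lra| | |].
- intros b Hb t.
  assert (T := Cmod_triangle (b - a) a). replace (b - a + a) with b in T by ring.
  curve_cont_tac; apply kernel_cont; unfold d in *; lra.
- curve_cont_tac; apply kernel_cont; auto.
- intros t k Ht Hk.
  assert (Hw := circle_dist_ge r a t Ha). fold d in Hw.
  assert (Uw : (Cmod (r * cis t - a)%C <= 2 * r)%R).
  { unfold Cminus. eapply Rle_trans; [apply Cmod_triangle|]. rewrite Cmod_opp, Cmod_circle; lra. }
  set (w := r * cis t - a) in *.
  replace (r * cis t - (a + k)) with (w - k) by (unfold w; ring).
  assert (Hwk := Cmod_sub_ge w k d Hw Hk).
  assert (w0 : w <> 0) by (apply Cmod_pos_neq; lra).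
  assert (wk0 : w - k <> 0) by (apply Cmod_pos_neq; lra).
  replace (h t * (/ (w - k) * / (w - k)) - h t * (/ w * / w) - 2 * h t * (/ w * (/ w * / w)) * k) with
    (h t * ((3 * w - 2 * k) * / (w * w * w * ((w - k) * (w - k)))) * (k * k)) by (field; auto).
  rewrite !Cmod_mult, Cmod_inv, !Cmod_mult by (repeat apply Cmult_neq_0; auto).
  assert (Q := Cmod_ge_0 k). apply Rmult_le_compat_r; [nra|].
  assert (L : (0 < Cmod w * Cmod w * Cmod w * (Cmod (w - k)%C * Cmod (w - k)%C))%R)
    by (repeat apply Rmult_lt_0_compat; lra).
  assert (I0 := Rinv_0_lt_compat _ L).
  apply Rmult_le_compat; auto using Cmod_ge_0.
  { apply Rmult_le_pos; [apply Cmod_ge_0|lra]. }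
  replace (28 * r / (d * d * d * d * d))%R with (7 * r * / (d * d * d * (d / 2 * (d / 2))))%R
    by (field; lra).
  apply Rmult_le_compat; auto using Cmod_ge_0; [lra| |].
  + unfold Cminus. eapply Rle_trans; [apply Cmod_triangle|].
    rewrite Cmod_opp, !Cmod_mult, !Cmod_R, !Rabs_pos_eq by lra. unfold d in *; lra.
  + apply Rinv_le_contravar; [repeat apply Rmult_lt_0_compat; lra|].
    apply Rmult_le_compat; try nra; apply Rmult_le_compat; try nra.
Qed.

(** The derivative with respect to a is the integral of dz / (z - a)^2 up to a factor, and that form
    is exact. So the value is constant along the segment from 0 to a, and at 0 the integrand is
    1. *)
Lemma winding_integral (r : R) (a : C) : (Cmod a < r)%R ->
  CInt (fun t => r * cis t * / (r * cis t - a)) 0 (2 * PI) = (2 * PI)%R.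
Proof.
intros Ha. assert (Pa := Cmod_ge_0 a).
set (W := fun b => CInt (fun t => r * cis t * / (r * cis t - b)) 0 (2 * PI)).
assert (HW : forall b, (Cmod b < r)%R -> cderiv W b 0).
{ intros b Hb. assert (K := cauchy_kernel_cderiv r (fun t => r * cis t) b (circle_cont r) Hb).
  cbv beta in K. fold W in K.
  apply (cderiv_val _ _ (CInt (fun t => r * cis t * (/ (r * cis t - b) * / (r * cis t - b))) 0 (2 * PI)));
    [|exact K].
  rewrite (CInt_FTC (fun t => Ci * / (r * cis t - b))).
  - rewrite cis_0, cis_2PI. ring.
  - intros t.
    replace (r * cis t * (/ (r * cis t - b) * / (r * cis t - b))) with
      (Ci * (- / ((r * cis t - b) * (r * cis t - b)) * (1 - 0)) * (r * (Ci * cis t))).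
    + apply (curve_deriv_comp (fun w => Ci * / (w - b)) (fun s => r * cis s)); [|apply circle_deriv].
      apply cderiv_scal. apply (cderiv_comp (fun w => / w) (fun w => w - b)).
      * apply cderiv_inv, circle_neq, Hb.
      * apply cderiv_minus; [apply cderiv_id|apply cderiv_const].
    + replace (Ci * (- / ((r * cis t - b) * (r * cis t - b)) * (1 - 0)) * (r * (Ci * cis t)))
        with (- (Ci * Ci) * (r * cis t) * / ((r * cis t - b) * (r * cis t - b))) by ring.
      replace (Ci * Ci) with (- (1)) by (unfold Cmult, Copp, Ci, RtoC; simpl; f_equal; ring).
      field. apply circle_neq, Hb.
  - curve_cont_tac; lazymatch goal with
    | |- curve_cont (fun _ => / _) _ => apply kernel_cont, Hb
    | _ => apply cis_cont end. }
assert (E : W (0%R * a) = W (1%R * a)).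
{ apply (@eq_is_derive C_R_NormedModule (fun s : R => W (s * a)) 0 1); [|lra].
  intros s Hs. replace (@zero C_R_NormedModule) with (0 * (a * 1) : C) by (change (0 * (a * 1) = 0); ring).
  apply (curve_deriv_comp W (fun s : R => s * a)).
  - apply HW. rewrite Cmod_mult, Cmod_R, Rabs_pos_eq by lra. nra.
  - apply curve_deriv_eps. intros eps He. exists 1%R. split; [lra|]. intros k _.
    replace (RtoC (s + k)) with (RtoC s + RtoC k) by (rewrite RtoC_plus; auto).
    replace ((s + k) * a - s * a - k * (a * 1)) with (RtoC 0) by ring.
    rewrite Cmod_0. assert (Q := Rabs_pos k). nra. }
replace (0%R * a) with (RtoC 0) in E by ring. replace (1%R * a) with a in E by ring.
unfold W in E. rewrite <- E.
rewrite (CInt_ext _ (fun _ => 1)).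
- rewrite CInt_const. replace (2 * PI - 0)%R with (2 * PI)%R by ring. ring.
- intros t. assert (r0 : RtoC r <> 0) by (intros Z; injection Z; lra).
  field. split; auto. apply cis_neq_0.
Qed.

Lemma cauchy_formula f (r : R) (a : C) : entire f -> (Cmod a < r)%R ->
  f a = / (2 * PI)%R * CInt (fun t => f (r * cis t) * (r * cis t) * / (r * cis t - a)) 0 (2 * PI).
Proof.
intros Hf Ha. assert (K := diff_quot_circle f a r Hf).
rewrite (CInt_ext _ (fun t => f (r * cis t) * (r * cis t) * / (r * cis t - a)
  - f a * (r * cis t * / (r * cis t - a)))) in K.
- assert (C1 : forall t, curve_cont (fun t => r * cis t * / (r * cis t - a)) t).
  { intros t. apply curve_cont_mult; [apply circle_cont|apply kernel_cont, Ha]. }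
  rewrite CInt_minus, CInt_scal, winding_integral in K; auto.
  + set (I := CInt _ _ _) in *.
    replace I with (I - f a * (2 * PI)%R + f a * (2 * PI)%R) by ring. rewrite K.
    field. intros Z. injection Z. assert (Q := PI_RGT_0). lra.
  + intros t. apply curve_cont_mult; [apply curve_cont_mult|].
    * apply entire_circle_cont, Hf. * apply circle_cont. * apply kernel_cont, Ha.
  + intros t. apply curve_cont_scal, C1.
- intros t. assert (N := circle_neq r a t Ha).
  rewrite diff_quot_neq; [field; auto|]. intros E. apply N. rewrite E. ring.
Qed.

(** Within distance 1 of a, Cauchy's formula on the circle of radius |a| + 1 expresses f' by the
    squared kernel, and this integral can be differentiated once more. *)
Lemma entire_derive f : entire f -> entire (C_derive f).
Proof.
intros Hf a. assert (Pa := Cmod_ge_0 a).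
set (r := (Cmod a + 1)%R).
set (h := fun t => f (r * cis t) * (r * cis t)).
assert (Hh : forall t, curve_cont h t).
{ intros t. apply curve_cont_mult; [apply entire_circle_cont, Hf|apply circle_cont]. }
destruct (cauchy_kernel2_cderiv r h a Hh ltac:(unfold r; lra)) as [l Hl].
exists (/ (2 * PI)%R * l). apply cderiv_is_derive.
apply cderiv_ext_loc with (r := 1%R) (f := fun b =>
  / (2 * PI)%R * CInt (fun t => h t * (/ (r * cis t - b) * / (r * cis t - b))) 0 (2 * PI)); [lra| |].
- intros b Hb. symmetry. apply cderiv_C_derive.
  assert (T := Cmod_triangle (b - a) a). replace (b - a + a) with b in T by ring.
  assert (Hbr : (Cmod b < r)%R) by (unfold r; lra).
  apply cderiv_ext_loc with (r := (r - Cmod b)%R) (f := fun c =>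
    / (2 * PI)%R * CInt (fun t => h t * / (r * cis t - c)) 0 (2 * PI)); [lra| |].
  + intros c Hc. symmetry. apply cauchy_formula; auto.
    assert (T' := Cmod_triangle (c - b) b). replace (c - b + b) with c in T' by ring. lra.
  + apply cderiv_scal, cauchy_kernel_cderiv; auto.
- apply cderiv_scal, Hl.
Qed.

(** * The complex exponential *)

Lemma entire_C_derive f z : entire f -> cderiv f z (C_derive f z).
Proof. intros H. apply entire_cderiv, H. Qed.

Definition Cexp (z : C) : C := exp (fst z) * cis (snd z).

Lemma Cexp_plus a b : Cexp (a + b) = Cexp a * Cexp b.
Proof.
unfold Cexp. destruct a as [a1 a2], b as [b1 b2]. simpl fst; simpl snd.
rewrite exp_plus, cis_plus, RtoC_mult. ring.
Qed.

Lemma Cexp_0 : Cexp 0 = 1.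
Proof. unfold Cexp. simpl. rewrite exp_0, cis_0. ring. Qed.

Lemma Cmod_Cexp z : Cmod (Cexp z)%C = exp (fst z).
Proof.
unfold Cexp. rewrite Cmod_mult, Cmod_cis, Cmod_R, Rabs_pos_eq; [ring|left; apply exp_pos].
Qed.

Lemma Cexp_neq_0 z : Cexp z <> 0.
Proof. apply Cmod_pos_neq. rewrite Cmod_Cexp. apply exp_pos. Qed.

(** The derivative at 0 comes from those of [exp] and [cis]; the functional equation transports it
    to z. *)
Lemma Cexp_cderiv z : cderiv Cexp z (Cexp z).
Proof.
assert (K0 : cderiv Cexp 0 1).
{ intros eps He.
  assert (De := is_derive_exp 0). rewrite exp_0 in De.
  assert (Dc := cis_deriv 0). rewrite cis_0 in Dc.
  assert (Cc := curve_cont_eps_inv _ _ (cis_cont 0)).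
  destruct De as [_ De].
  destruct (De 0%R (fun P HP => HP) (mkposreal (eps / 3) ltac:(lra))) as [d1 H1].
  destruct (proj1 (curve_deriv_eps _ _ _) Dc (eps / 3)%R ltac:(lra)) as [d2 [Hd2 H2]].
  destruct (Cc (eps / 3)%R ltac:(lra)) as [d3 [Hd3 H3]].
  rewrite cis_0 in H2, H3.
  exists (Rmin d1 (Rmin d2 d3)). split.
  { apply Rmin_pos; [apply cond_pos|apply Rmin_pos; auto]. }
  intros [h1 h2] Hh.
  assert (A1 : (Rabs h1 <= Cmod (h1, h2)%C)%R)
    by (eapply Rle_trans; [|apply Rmax_Cmod]; apply Rmax_l).
  assert (A2 : (Rabs h2 <= Cmod (h1, h2)%C)%R)
    by (eapply Rle_trans; [|apply Rmax_Cmod]; apply Rmax_r).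
  assert (M1 := Rmin_l d1 (Rmin d2 d3)). assert (M2 := Rmin_r d1 (Rmin d2 d3)).
  assert (M3 := Rmin_l d2 d3). assert (M4 := Rmin_r d2 d3).
  assert (B1 : (Rabs (exp h1 - 1 - h1) <= eps / 3 * Rabs h1)%R).
  { specialize (H1 h1). rewrite exp_0 in H1.
    replace (exp h1 - 1 - h1)%R with (exp h1 - 1 - (h1 - 0) * 1)%R by ring.
    replace (Rabs h1) with (Rabs (h1 - 0))%R by (f_equal; ring).
    apply H1. change (Rabs (h1 - 0) < d1)%R. rewrite Rminus_0_r. lra. }
  specialize (H2 h2 ltac:(lra)). specialize (H3 h2 ltac:(lra)).
  rewrite Rplus_0_l in H2, H3.
  set (m := Cmod (h1, h2)%C) in *.
  rewrite Cplus_0_l, Cexp_0. unfold Cexp. simpl fst; simpl snd.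
  replace ((h1, h2) : C) with (RtoC h1 + Ci * RtoC h2)
    by (unfold Cplus, Cmult, RtoC, Ci; simpl; f_equal; ring).
  replace (exp h1 * cis h2 - 1 - 1 * (h1 + Ci * h2)) with
    (RtoC (exp h1 - 1 - h1) * cis h2 + (cis h2 - 1 - h2 * (Ci * 1)) + h1 * (cis h2 - 1)).
  2: { rewrite !RtoC_minus. ring. }
  eapply Rle_trans; [apply Cmod_triangle|].
  eapply Rle_trans; [apply Rplus_le_compat_r, Cmod_triangle|].
  rewrite !Cmod_mult, Cmod_cis, !Cmod_R.
  assert (Q := Rabs_pos h1). assert (Q2 := Cmod_ge_0 (cis h2 - 1)).
  assert (Rabs h1 * Cmod (cis h2 - 1)%C <= m * (eps / 3))%R by (apply Rmult_le_compat; lra).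
  nra. }
apply cderiv_ext with (fun w => Cexp z * Cexp (w + - z)).
- intros w. rewrite <- Cexp_plus. f_equal. ring.
- apply (cderiv_val _ _ (Cexp z * (1 * (1 + 0)))); [ring|].
  apply cderiv_scal, (cderiv_comp Cexp (fun w => w + - z)).
  + replace (z + - z) with (RtoC 0) by ring. exact K0.
  + apply cderiv_plus; [apply cderiv_id|apply cderiv_const].
Qed.

Lemma entire_Cexp : entire Cexp.
Proof. apply (cderiv_entire _ Cexp), Cexp_cderiv. Qed.

(** * Functions determined by their derivatives; logarithms of zero-free functions *)

Section Segment.
Variables (F F' : C -> C).
Hypothesis HF : forall z, cderiv F z (F' z).
Hypothesis HF' : forall z, ccont F' z.

Lemma segment_deriv z (s : R) : curve_deriv (fun s : R => s * z) s z.
Proof.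
apply curve_deriv_eps. intros eps He. exists 1%R. split; [lra|]. intros k _.
rewrite RtoC_plus. replace ((s + k) * z - s * z - k * z) with (RtoC 0) by ring.
rewrite Cmod_0. assert (Q := Rabs_pos k). nra.
Qed.

Lemma mean_value_inequality z M :
  (forall w, (Cmod w <= Cmod z)%R -> (Cmod (F' w)%C <= M)%R) ->
  (Cmod (F z - F 0)%C <= M * Cmod z)%R.
Proof.
intros HM.
assert (Cc : forall t, curve_cont (fun s : R => F' (s * z) * z) t).
{ intros t. apply curve_cont_mult; [|apply curve_cont_const].
  apply (ccont_comp_curve F' (fun s : R => s * z)); auto.
  eapply curve_deriv_cont, segment_deriv. }
replace (F z - F 0) with (CInt (fun s : R => F' (s * z) * z) 0 1).
- eapply Rle_trans; [apply Cmod_CInt_le with (M := (M * Cmod z)%R); auto|].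
  + rewrite Rmin_left, Rmax_right by lra. intros t Ht. rewrite Cmod_mult.
    apply Rmult_le_compat_r; [apply Cmod_ge_0|]. apply HM.
    rewrite Cmod_mult, Cmod_R, Rabs_pos_eq by lra. assert (Q := Cmod_ge_0 z). nra.
  + rewrite Rabs_pos_eq by lra. lra.
- rewrite (CInt_FTC (fun s : R => F (s * z))); auto.
  + f_equal; f_equal; ring_simplify; try f_equal; try ring.
  + intros t. apply (curve_deriv_comp F (fun s : R => s * z)); auto. apply segment_deriv.
Qed.

End Segment.

Lemma cderiv_0_const F : (forall z, cderiv F z 0) -> forall z, F z = F 0.
Proof.
intros H z.
assert (K := mean_value_inequality F (fun _ => 0) H (fun z => ccont_const 0 z) z 0%R).
assert (E : F z - F 0 = 0).
{ apply Cmod_eq_0. apply Rle_antisym; [|apply Cmod_ge_0].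
  eapply Rle_trans; [apply K|]; [|lra]. intros w _. rewrite Cmod_0. lra. }
replace (F z) with (F z - F 0 + F 0) by ring. rewrite E. ring.
Qed.

Lemma cderiv_eq_minus F G F' : (forall z, cderiv F z (F' z)) -> (forall z, cderiv G z (F' z)) ->
  forall z, F z = G z + (F 0 - G 0).
Proof.
intros HF HG z.
assert (K : F z - G z = F 0 - G 0).
{ apply (cderiv_0_const (fun z => F z - G z)). intros w.
  apply (cderiv_val _ _ (F' w - F' w)); [ring|]. apply cderiv_minus; auto. }
rewrite <- K. ring.
Qed.

(** h is any primitive of F' / F, for which F * exp (- h) has derivative zero. As h is not
    normalised, the constant k remains. *)
Lemma entire_zero_free F : entire F -> (forall z, F z <> 0) ->
  exists (h : C -> C) (k : C), entire h /\ k <> 0 /\ forall z, F z = k * Cexp (h z).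
Proof.
intros HF H0.
assert (D := fun z => entire_C_derive F z HF).
assert (D2 := fun z => entire_C_derive _ z (entire_derive F HF)).
assert (Eq : entire (fun z => C_derive F z * / F z)).
{ apply (cderiv_entire _ (fun z => C_derive (C_derive F) z * / F z +
    C_derive F z * (- / (F z * F z) * C_derive F z))).
  intros z. apply (cderiv_mult (C_derive F) (fun z => / F z)); auto. apply (cderiv_comp (fun w => / w) F); auto.
  apply cderiv_inv; auto. }
destruct (entire_primitive _ Eq) as [h Hh].
exists h, (F 0 * Cexp (- h 0)). split; [|split].
- apply (cderiv_entire _ _ Hh).
- apply Cmult_neq_0; auto. apply Cexp_neq_0.
- assert (K : forall z, F z * Cexp (- h z) = F 0 * Cexp (- h 0)).
  { apply (cderiv_0_const (fun z => F z * Cexp (- h z))). intros z.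
    apply (cderiv_val _ _ (C_derive F z * Cexp (- h z) +
      F z * (Cexp (- h z) * (0 - C_derive F z * / F z)))); [field; auto|].
    apply (cderiv_mult F (fun z => Cexp (- h z))); auto. apply (cderiv_comp Cexp (fun z => - h z)); [apply Cexp_cderiv|].
    apply cderiv_ext with (fun z => 0 - h z); [intros; ring|].
    apply cderiv_minus; auto. apply cderiv_const. }
  intros z. rewrite <- (K z), <- Cmult_assoc, <- Cexp_plus.
  replace (- h z + h z) with (RtoC 0) by ring. rewrite Cexp_0. ring.
Qed.

Lemma exists_gaussian_primitive : exists p : C -> C, forall z, cderiv p z (Cexp (z * z)).
Proof.
apply entire_primitive. apply (entire_comp Cexp (fun z => z * z)); [apply entire_Cexp|].
apply (cderiv_entire _ (fun z => 2 * z)), cderiv_sqr.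
Qed.

Lemma exp_le_mono x y : (x <= y)%R -> (exp x <= exp y)%R.
Proof. intros [H| ->]; [left; apply exp_increasing, H|right; reflexivity]. Qed.

Lemma Cmod_Cexp_le z : (Cmod (Cexp z)%C <= exp (Cmod z))%R.
Proof.
rewrite Cmod_Cexp. apply exp_le_mono.
eapply Rle_trans; [apply Rle_abs|]. eapply Rle_trans; [|apply Rmax_Cmod]. apply Rmax_l.
Qed.

Lemma gaussian_primitive_le p : (forall z, cderiv p z (Cexp (z * z))) ->
  forall z, (Cmod (p z)%C <= Cmod (p 0)%C + Cmod z * exp (Cmod z * Cmod z))%R.
Proof.
intros Hp z.
assert (K : (Cmod (p z - p 0)%C <= exp (Cmod z * Cmod z) * Cmod z)%R).
{ apply (mean_value_inequality p (fun z => Cexp (z * z))); auto.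
  - intros w. apply (entire_ccont (fun z => Cexp (z * z))).
    apply (entire_comp Cexp (fun z => z * z)); [apply entire_Cexp|].
    apply (cderiv_entire _ (fun z => 2 * z)), cderiv_sqr.
  - intros w Hw. eapply Rle_trans; [apply Cmod_Cexp_le|]. apply exp_le_mono.
    rewrite Cmod_mult. assert (Q := Cmod_ge_0 w). nra. }
replace (p z) with (p z - p 0 + p 0) by ring.
eapply Rle_trans; [apply Cmod_triangle|]. lra.
Qed.

(** * Circular means of radial functions *)

Definition dot (z w : C) : R := (fst z * fst w + snd z * snd w)%R.

(** |z|^2 as a polynomial in the coordinates: unlike [Cmod] it is smooth at 0, so radial functions
    are written as functions of [sq]. *)
Definition sq (z : C) : R := dot z z.

Lemma sq_ge_0 z : (0 <= sq z)%R.
Proof. unfold sq, dot. nra. Qed.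

Lemma Cmod_sq z : (Cmod z * Cmod z = sq z)%R.
Proof.
assert (K := Cmod2_alt z). unfold sq, dot, Re, Im in *.
replace (Cmod z * Cmod z)%R with (Cmod z ^ 2)%R by ring. rewrite K. ring.
Qed.

Lemma sq_mult a b : sq (a * b) = (sq a * sq b)%R.
Proof. unfold sq, dot, Cmult; simpl. ring. Qed.

Lemma is_derive_val (f : R -> R) (x a b : R) : a = b -> is_derive f x a -> is_derive f x b.
Proof. intros ->. auto. Qed.

Lemma dot_deriv a b t a' b' : curve_deriv a t a' -> curve_deriv b t b' ->
  is_derive (fun s => dot (a s) (b s)) t (dot a' (b t) + dot (a t) b')%R.
Proof.
intros Ha Hb.
assert (a1 := curve_deriv_fst _ _ _ Ha). assert (a2 := curve_deriv_snd _ _ _ Ha).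
assert (b1 := curve_deriv_fst _ _ _ Hb). assert (b2 := curve_deriv_snd _ _ _ Hb).
unfold dot.
apply (is_derive_val _ _ ((fst a' * fst (b t) + fst (a t) * fst b') +
  (snd a' * snd (b t) + snd (a t) * snd b'))%R); [ring|].
apply (is_derive_plus (fun s => fst (a s) * fst (b s))%R (fun s => snd (a s) * snd (b s))%R);
apply (is_derive_mult (K := R_AbsRing)); auto; apply Rmult_comm.
Qed.

Lemma ccont_2d F x t : (forall z, ccont F z) ->
  continuity_2d_pt (fun x t => fst (F (x, t))) x t /\
  continuity_2d_pt (fun x t => snd (F (x, t))) x t.
Proof.
intros HF.
assert (K : forall eps : posreal, exists d : posreal, forall u v : R,
  (Rabs (u - x) < d)%R -> (Rabs (v - t) < d)%R -> (Cmod (F (u, v) - F (x, t))%C < eps)%R).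
{ intros eps. destruct (HF (x, t) eps (cond_pos eps)) as [d [Hd H]].
  assert (Pd : (0 < d / 2)%R) by lra. exists (mkposreal _ Pd). simpl. intros u v Hu Hv.
  specialize (H ((u, v) - (x, t))). rewrite Cplus_sub_cancel in H. apply H.
  unfold Cminus, Cplus, Copp; simpl. eapply Rle_lt_trans; [apply Cmod_le_abs|].
  unfold Rminus in Hu, Hv. lra. }
split; intros eps; destruct (K eps) as [d Hd]; exists d; intros u v Hu Hv;
  (eapply Rle_lt_trans; [|apply (Hd u v Hu Hv)]);
  (eapply Rle_trans; [|apply Rmax_Cmod]); [apply Rmax_l|apply Rmax_r].
Qed.

Lemma dot_2d F H x t : (forall z, ccont F z) -> (forall z, ccont H z) ->
  continuity_2d_pt (fun x t => dot (F (x, t)) (H (x, t))) x t.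
Proof.
intros HF HH. destruct (ccont_2d F x t HF). destruct (ccont_2d H x t HH). unfold dot.
apply continuity_2d_pt_plus; apply continuity_2d_pt_mult; auto.
Qed.

Lemma continuity_2d_continuous_snd f x t : continuity_2d_pt f x t -> continuous (f x) t.
Proof.
intros H P [e HP]. destruct (H e) as [d Hd]. exists d. intros y Hy. apply HP.
apply (Hd x y); [|exact Hy]. rewrite Rminus_diag, Rabs_R0. apply cond_pos.
Qed.

Lemma continuity_2d_ex_RInt f x a b : (forall t, continuity_2d_pt f x t) -> ex_RInt (f x) a b.
Proof.
intros H. apply (@ex_RInt_continuous R_CompleteNormedModule). intros t _.
apply continuity_2d_continuous_snd, H.
Qed.

Lemma RInt_param_deriv (f fx : R -> R -> R) a b :
  (forall x t, is_derive (fun u => f u t) x (fx x t)) ->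
  (forall x t, continuity_2d_pt fx x t) -> (forall x t, continuity_2d_pt f x t) ->
  forall x, is_derive (fun x => RInt (f x) a b) x (RInt (fx x) a b).
Proof.
intros Hd Hfx Hf x.
assert (E : RInt (fun t => Derive (fun u => f u t) x) a b = RInt (fx x) a b).
{ apply RInt_ext. intros t _. apply is_derive_unique, Hd. }
rewrite <- E. apply (is_derive_RInt_param f).
- apply filter_forall. intros y t _. eexists. apply Hd.
- intros t _. apply continuity_2d_pt_ext with fx; auto.
  intros y s. symmetry. apply is_derive_unique, Hd.
- apply filter_forall. intros y. apply continuity_2d_ex_RInt. intros; apply Hf.
Qed.

(** The derivatives are demanded only for s >= 0, the range of [sq], because profiles such as ln (1
    + s) are not regular on the whole line. *)
Record radial_profile (phi phi1 phi2 : R -> R) : Prop := {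
  profile_d1 : forall s, (0 <= s)%R -> is_derive phi s (phi1 s);
  profile_d2 : forall s, (0 <= s)%R -> is_derive phi1 s (phi2 s);
  profile_cont : forall s, (0 <= s)%R -> continuity_pt phi2 s }.

Section RadialMean.
Variables G G1 G2 : C -> C.
Hypothesis HG : forall z, cderiv G z (G1 z).
Hypothesis HG1 : forall z, cderiv G1 z (G2 z).
Hypothesis HG2 : forall z, ccont G2 z.
Hypothesis perG : forall x, G (x, 2 * PI)%R = G (x, 0%R).
Hypothesis perG1 : forall x, G1 (x, 2 * PI)%R = G1 (x, 0%R).
Variables phi phi1 phi2 : R -> R.
Hypothesis Hphi : radial_profile phi phi1 phi2.

Let cG z : ccont G z. Proof. eapply cderiv_ccont, HG. Qed.
Let cG1 z : ccont G1 z. Proof. eapply cderiv_ccont, HG1. Qed.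
Let ciG1 z : ccont (fun z => Ci * G1 z) z.
Proof. eapply cderiv_ccont, cderiv_scal, HG1. Qed.

(** Integral over one vertical period of the strip. It will be used for G = F o exp, which makes it
    an integral over the circle of radius exp x. *)
Let mean (x : R) : R := RInt (fun t => phi (sq (G (x, t)))) 0 (2 * PI).
Let mean1 (x : R) : R := RInt (fun t => phi1 (sq (G (x, t))) * (2 * dot (G (x, t)) (G1 (x, t))))%R 0 (2 * PI).

Lemma profile_2d psi psi' x t : (forall s, (0 <= s)%R -> is_derive psi s (psi' s)) ->
  continuity_2d_pt (fun x t => psi (sq (G (x, t)))) x t.
Proof.
intros H. apply continuity_1d_2d_pt_comp.
- apply continuity_pt_filterlim. apply (ex_derive_continuous psi).
  eexists. apply H, sq_ge_0.
- unfold sq. apply dot_2d; auto.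
Qed.

Lemma curve_h F F' x (t : R) : (forall z, cderiv F z (F' z)) ->
  curve_deriv (fun s => F (s, t)) x (F' (x, t)).
Proof.
intros H. replace (F' (x, t)) with (F' (x, t) * 1) by ring.
apply (curve_deriv_comp F (fun s => (s, t))); [apply H|apply curve_deriv_pt_h].
Qed.

Lemma curve_v F F' (x : R) t : (forall z, cderiv F z (F' z)) ->
  curve_deriv (fun s => F (x, s)) t (Ci * F' (x, t)).
Proof.
intros H. rewrite Cmult_comm.
apply (curve_deriv_comp F (fun s => (x, s))); [apply H|apply curve_deriv_pt_v].
Qed.

Lemma radial_deriv (c : R -> C) v psi psi' s : curve_deriv c s v ->
  (forall s, (0 <= s)%R -> is_derive psi s (psi' s)) ->
  is_derive (fun u => psi (sq (c u))) s (psi' (sq (c s)) * (2 * dot (c s) v))%R.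
Proof.
intros Hc Hpsi.
apply (is_derive_val _ _ (scal (2 * dot (c s) v)%R (psi' (sq (c s))))).
{ unfold scal; simpl; unfold mult; simpl. ring. }
apply (is_derive_comp psi (fun u => sq (c u))).
- apply Hpsi, sq_ge_0.
- unfold sq. apply (is_derive_val _ _ (dot v (c s) + dot (c s) v)%R); [unfold dot; ring|].
  apply dot_deriv; auto.
Qed.

Lemma radial_mean_deriv x : is_derive mean x (mean1 x).
Proof.
apply (RInt_param_deriv (fun x t => phi (sq (G (x, t))))
  (fun x t => phi1 (sq (G (x, t))) * (2 * dot (G (x, t)) (G1 (x, t))))%R).
- intros y t. apply (radial_deriv (fun u => G (u, t))); [apply curve_h; auto|apply Hphi].
- intros y t. apply continuity_2d_pt_mult.
  + eapply profile_2d, profile_d2, Hphi.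
  + apply continuity_2d_pt_mult; [apply continuity_2d_pt_const|apply dot_2d; auto].
- intros y t. eapply profile_2d, profile_d1, Hphi.
Qed.

(** [sxx] and [stt] are the second derivatives of phi (|G|^2) in x and in t. Since G is holomorphic,
    its t-derivatives are i * G1 and - G2. In the sum the terms with G2 cancel, and the squares of
    the two scalar products add up to |G|^2 * |G1|^2. *)
Let sxx x t := (phi2 (sq (G (x, t))) * (2 * dot (G (x, t)) (G1 (x, t))) * (2 * dot (G (x, t)) (G1 (x, t)))
  + phi1 (sq (G (x, t))) * (2 * (sq (G1 (x, t)) + dot (G (x, t)) (G2 (x, t)))))%R.
Let stt x t := (phi2 (sq (G (x, t))) * (2 * dot (G (x, t)) (Ci * G1 (x, t))) * (2 * dot (G (x, t)) (Ci * G1 (x, t)))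
  + phi1 (sq (G (x, t))) * (2 * (sq (G1 (x, t)) - dot (G (x, t)) (G2 (x, t)))))%R.

Lemma phi2_2d x t : continuity_2d_pt (fun x t => phi2 (sq (G (x, t)))) x t.
Proof.
apply continuity_1d_2d_pt_comp.
- apply Hphi, sq_ge_0.
- unfold sq. apply dot_2d; auto.
Qed.

Lemma sxx_2d x t : continuity_2d_pt sxx x t.
Proof.
unfold sxx.
assert (K := phi2_2d x t).
assert (K1 := profile_2d _ _ x t (profile_d2 _ _ _ Hphi)).
assert (D1 := dot_2d G G1 x t cG cG1). assert (D2 := dot_2d G1 G1 x t cG1 cG1).
assert (D3 := dot_2d G G2 x t cG HG2).
apply continuity_2d_pt_plus; apply continuity_2d_pt_mult; auto;
try apply continuity_2d_pt_mult; auto; try apply continuity_2d_pt_mult; auto;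
try apply continuity_2d_pt_const. apply continuity_2d_pt_plus; auto.
Qed.

Lemma stt_2d x t : continuity_2d_pt stt x t.
Proof.
unfold stt.
assert (K := phi2_2d x t).
assert (K1 := profile_2d _ _ x t (profile_d2 _ _ _ Hphi)).
assert (D1 := dot_2d G _ x t cG ciG1). assert (D2 := dot_2d G1 G1 x t cG1 cG1).
assert (D3 := dot_2d G G2 x t cG HG2).
apply continuity_2d_pt_plus; apply continuity_2d_pt_mult; auto;
try apply continuity_2d_pt_mult; auto; try apply continuity_2d_pt_mult; auto;
try apply continuity_2d_pt_const. apply continuity_2d_pt_minus; auto.
Qed.

Lemma radial_mean_deriv_sxx x : is_derive mean1 x (RInt (sxx x) 0 (2 * PI)).
Proof.
apply (RInt_param_deriv
  (fun x t => phi1 (sq (G (x, t))) * (2 * dot (G (x, t)) (G1 (x, t))))%R sxx).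
- intros y t. unfold sxx.
  apply (is_derive_mult (K := R_AbsRing) (fun u => phi1 (sq (G (u, t))))
    (fun u => (2 * dot (G (u, t)) (G1 (u, t)))%R)); [| |apply Rmult_comm].
  + apply (radial_deriv (fun u => G (u, t))); [apply curve_h; auto|apply Hphi].
  + apply (is_derive_scal (fun u => dot (G (u, t)) (G1 (u, t))) y 2).
    apply (dot_deriv (fun u => G (u, t)) (fun u => G1 (u, t))); apply curve_h; auto.
- apply sxx_2d.
- intros y t. apply continuity_2d_pt_mult.
  + eapply profile_2d, profile_d2, Hphi.
  + apply continuity_2d_pt_mult; [apply continuity_2d_pt_const|apply dot_2d; auto].
Qed.

Lemma RInt_stt x : RInt (stt x) 0 (2 * PI) = 0%R.
Proof.
set (st := fun t => (phi1 (sq (G (x, t))) * (2 * dot (G (x, t)) (Ci * G1 (x, t))))%R).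
assert (K : is_RInt (stt x) 0 (2 * PI) (minus (st (2 * PI)%R) (st 0%R))).
{ apply (is_RInt_derive (V := R_CompleteNormedModule) st).
  - intros t _. unfold st, stt.
    apply (is_derive_val _ _ ((phi2 (sq (G (x, t))) * (2 * dot (G (x, t)) (Ci * G1 (x, t)))) *
      (2 * dot (G (x, t)) (Ci * G1 (x, t))) + phi1 (sq (G (x, t))) *
      (2 * (dot (Ci * G1 (x, t)) (Ci * G1 (x, t)) + dot (G (x, t)) (Ci * (Ci * G2 (x, t))))))%R).
    { f_equal. f_equal. f_equal. unfold sq, dot, Cmult, Ci; simpl. ring. }
    apply (is_derive_mult (K := R_AbsRing) (fun u => phi1 (sq (G (x, u))))
      (fun u => (2 * dot (G (x, u)) (Ci * G1 (x, u)))%R)); [| |apply Rmult_comm].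
    + apply (radial_deriv (fun u => G (x, u))); [apply curve_v; auto|apply Hphi].
    + apply (is_derive_scal (fun u => dot (G (x, u)) (Ci * G1 (x, u))) t 2).
      apply (dot_deriv (fun u => G (x, u)) (fun u => Ci * G1 (x, u))).
      * apply curve_v; auto.
      * apply (curve_v (fun z => Ci * G1 z) (fun z => Ci * G2 z)).
        intros z. apply cderiv_scal, HG1.
  - intros t _. apply continuity_2d_continuous_snd, stt_2d. }
apply (is_RInt_unique (V := R_CompleteNormedModule)) in K.
etransitivity; [exact K|]. unfold st. rewrite perG, perG1.
unfold minus, plus, opp; simpl. ring.
Qed.

(* The angular second derivative integrates to zero, which leaves the Laplacian. *)
Lemma radial_mean_deriv2 x : is_derive mean1 x
  (RInt (fun t => 4 * (phi1 (sq (G (x, t))) + sq (G (x, t)) * phi2 (sq (G (x, t)))) * sq (G1 (x, t)))%R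
     0 (2 * PI)).
Proof.
apply (is_derive_val _ _ _ _) with (2 := radial_mean_deriv_sxx x).
assert (E1 : ex_RInt (sxx x) 0 (2 * PI)) by (apply continuity_2d_ex_RInt, sxx_2d).
assert (E2 : ex_RInt (stt x) 0 (2 * PI)) by (apply continuity_2d_ex_RInt, stt_2d).
transitivity (RInt (sxx x) 0 (2 * PI) + RInt (stt x) 0 (2 * PI))%R; [rewrite RInt_stt; symmetry; apply Rplus_0_r|].
etransitivity; [symmetry; apply (RInt_plus (V := R_CompleteNormedModule) (sxx x) (stt x) 0 (2 * PI) E1 E2)|].
apply RInt_ext. intros t _. unfold plus; simpl. unfold sxx, stt, sq, dot, Cmult, Ci; simpl. ring.
Qed.

End RadialMean.

(** * Convexity and circle means in the variable ln r *)

Lemma abs_dot_le z w : (Rabs (dot z w) <= Cmod z * Cmod w)%R.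
Proof.
rewrite <- (Cmod_conj z), <- Cmod_mult.
replace (dot z w) with (fst (Cconj z * w)) by (unfold dot, Cconj, Cmult; simpl; ring).
eapply Rle_trans; [|apply Rmax_Cmod]. apply Rmax_l.
Qed.

Lemma nondecreasing_of_deriv (D D1 : R -> R) : (forall x, is_derive D x (D1 x)) ->
  (forall x, (0 <= D1 x)%R) -> forall x y, (x <= y)%R -> (D x <= D y)%R.
Proof.
intros HD H1 x y Hxy.
destruct (MVT_gen D x y D1) as [c [_ Hc]].
- intros; apply HD.
- intros z _. apply continuity_pt_filterlim. apply (ex_derive_continuous D). eexists; apply HD.
- specialize (H1 c). nra.
Qed.

(** The slope D1 is nondecreasing and tends to 0 at -infinity, so it cannot be negative anywhere.
    With x = ln r the limit expresses regularity at the centre of the circles. *)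
Lemma convex_nondecreasing (D D1 D2 : R -> R) : (forall x, is_derive D x (D1 x)) ->
  (forall x, is_derive D1 x (D2 x)) -> (forall x, (0 <= D2 x)%R) ->
  (forall eps, (0 < eps)%R -> exists X, forall x, (x <= X)%R -> (Rabs (D1 x) <= eps)%R) ->
  forall x, (0 <= D1 x)%R.
Proof.
intros HD HD1 H2 Hlim x.
apply Rnot_lt_le. intros N.
destruct (Hlim (- D1 x / 2)%R) as [X HX]; [lra|].
specialize (HX (Rmin x X) (Rmin_r _ _)).
assert (K := nondecreasing_of_deriv D1 D2 HD1 H2 _ _ (Rmin_l x X)).
assert (Q := Rle_abs (- D1 (Rmin x X))%R). rewrite Rabs_Ropp in Q. lra.
Qed.

(** The first argument is the logarithm of the radius. [Cexp (x, t)] reduces to [circ x t], so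
    results on the strip transfer by conversion. *)
Definition circ (x t : R) : C := exp x * cis t.

Lemma Cmod_circ x t : Cmod (circ x t) = exp x.
Proof. apply Cmod_circle. left. apply exp_pos. Qed.

Definition circle_mean (phi : R -> R) (F : C -> C) (x : R) : R :=
  RInt (fun t => phi (sq (F (circ x t)))) 0 (2 * PI).

Definition circle_mean1 (phi1 : R -> R) (F : C -> C) (x : R) : R :=
  RInt (fun t => phi1 (sq (F (circ x t)))
    * (2 * dot (F (circ x t)) (C_derive F (circ x t) * (circ x t))%C))%R 0 (2 * PI).

(** At s = |w|^2, the value 4 * (phi1 s + s * phi2 s) is the Laplacian of phi (|w|^2) in the plane
    of w = F z. The factor |F' z|^2 pulls it back to z, and |z|^2 comes from the variable ln r. *)
Definition circle_mean2 (phi1 phi2 : R -> R) (F : C -> C) (x : R) : R :=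
  RInt (fun t => 4 * (phi1 (sq (F (circ x t))) + sq (F (circ x t)) * phi2 (sq (F (circ x t))))
    * sq (C_derive F (circ x t) * (circ x t))%C)%R 0 (2 * PI).

Section CircleMean.
Variable F : C -> C.
Hypothesis HF : entire F.
Variables phi phi1 phi2 : R -> R.
Hypothesis Hphi : radial_profile phi phi1 phi2.

Let G z := F (Cexp z).
Let G1 z := C_derive F (Cexp z) * Cexp z.
Let G2 z := C_derive (C_derive F) (Cexp z) * Cexp z * Cexp z + C_derive F (Cexp z) * Cexp z.

Let HG z : cderiv G z (G1 z).
Proof. apply (cderiv_comp F Cexp); [apply entire_C_derive, HF|apply Cexp_cderiv]. Qed.

Let HG1 z : cderiv G1 z (G2 z).
Proof.
apply (cderiv_mult (fun z => C_derive F (Cexp z)) Cexp); [|apply Cexp_cderiv].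
apply (cderiv_comp (C_derive F) Cexp); [|apply Cexp_cderiv].
apply entire_C_derive, entire_derive, HF.
Qed.

Let HG2 z : ccont G2 z.
Proof.
assert (E1 := entire_derive _ HF). assert (E2 := entire_derive _ E1).
assert (D1 := entire_C_derive (C_derive F) (Cexp z) E1).
assert (D2 := entire_C_derive (C_derive (C_derive F)) (Cexp z) E2).
unfold G2. apply ccont_plus; eapply cderiv_ccont.
- apply (cderiv_mult (fun z => C_derive (C_derive F) (Cexp z) * Cexp z) Cexp); [|apply Cexp_cderiv].
  apply (cderiv_mult (fun z => C_derive (C_derive F) (Cexp z)) Cexp); [|apply Cexp_cderiv].
  apply (cderiv_comp (C_derive (C_derive F)) Cexp); [exact D2|apply Cexp_cderiv].
- apply (cderiv_mult (fun z => C_derive F (Cexp z)) Cexp); [|apply Cexp_cderiv].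
  apply (cderiv_comp (C_derive F) Cexp); [exact D1|apply Cexp_cderiv].
Qed.

Let per x : Cexp (x, 2 * PI)%R = Cexp (x, 0%R).
Proof. unfold Cexp; simpl. rewrite cis_0, cis_2PI. reflexivity. Qed.

Let perG x : G (x, 2 * PI)%R = G (x, 0%R).
Proof. unfold G. rewrite per. reflexivity. Qed.

Let perG1 x : G1 (x, 2 * PI)%R = G1 (x, 0%R).
Proof. unfold G1. rewrite per. reflexivity. Qed.

Lemma circle_mean_deriv x : is_derive (circle_mean phi F) x (circle_mean1 phi1 F x).
Proof. exact (radial_mean_deriv G G1 G2 HG HG1 phi phi1 phi2 Hphi x). Qed.

Lemma circle_mean_deriv2 x : is_derive (circle_mean1 phi1 F) x (circle_mean2 phi1 phi2 F x).
Proof. exact (radial_mean_deriv2 G G1 G2 HG HG1 HG2 perG perG1 phi phi1 phi2 Hphi x). Qed.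

Lemma circle_mean_ex_RInt x : ex_RInt (fun t => phi (sq (F (circ x t)))) 0 (2 * PI).
Proof.
apply (continuity_2d_ex_RInt (fun x t => phi (sq (G (x, t))))). intros t.
exact (profile_2d G G1 HG phi phi1 x t (profile_d1 _ _ _ Hphi)).
Qed.

Lemma circle_mean2_ex_RInt x : ex_RInt (fun t => 4 * (phi1 (sq (F (circ x t)))
    + sq (F (circ x t)) * phi2 (sq (F (circ x t))))
    * sq (C_derive F (circ x t) * (circ x t))%C)%R 0 (2 * PI).
Proof.
assert (cG : forall z, ccont G z) by (intros; eapply cderiv_ccont, HG).
assert (cG1 : forall z, ccont G1 z) by (intros; eapply cderiv_ccont, HG1).
apply (continuity_2d_ex_RInt (fun x t => 4 * (phi1 (sq (G (x, t)))
  + sq (G (x, t)) * phi2 (sq (G (x, t)))) * sq (G1 (x, t)))%R). intros t.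
assert (K1 := profile_2d G G1 HG phi1 phi2 x t (profile_d2 _ _ _ Hphi)).
assert (K2 := phi2_2d G G1 HG phi phi1 phi2 Hphi x t).
assert (K3 := dot_2d G G x t cG cG). assert (K4 := dot_2d G1 G1 x t cG1 cG1).
apply continuity_2d_pt_mult; [apply continuity_2d_pt_mult|exact K4].
- apply continuity_2d_pt_const.
- apply continuity_2d_pt_plus; [exact K1|]. apply continuity_2d_pt_mult; [exact K3|exact K2].
Qed.

Lemma circle_mean1_ex_RInt x : ex_RInt (fun t => phi1 (sq (F (circ x t)))
    * (2 * dot (F (circ x t)) (C_derive F (circ x t) * (circ x t))%C))%R 0 (2 * PI).
Proof.
assert (cG : forall z, ccont G z) by (intros; eapply cderiv_ccont, HG).
assert (cG1 : forall z, ccont G1 z) by (intros; eapply cderiv_ccont, HG1).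
apply (continuity_2d_ex_RInt (fun x t => phi1 (sq (G (x, t))) * (2 * dot (G (x, t)) (G1 (x, t))))%R).
intros t.
assert (K1 := profile_2d G G1 HG phi1 phi2 x t (profile_d2 _ _ _ Hphi)).
assert (K3 := dot_2d G G1 x t cG cG1).
apply continuity_2d_pt_mult; [exact K1|].
apply continuity_2d_pt_mult; [apply continuity_2d_pt_const|exact K3].
Qed.

(** The integrand contains F' z * z with |z| = exp x, while F and F' are bounded near 0 and phi1 is
    bounded by K. *)
Lemma circle_mean1_lim K : (forall s, (0 <= s)%R -> (Rabs (phi1 s) <= K)%R) ->
  forall eps, (0 < eps)%R -> exists X, forall x, (x <= X)%R -> (Rabs (circle_mean1 phi1 F x) <= eps)%R.
Proof.
intros HK eps He.
destruct (entire_ccont F 0 HF 1%R Rlt_0_1) as [d1 [Hd1 H1]].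
destruct (entire_ccont _ 0 (entire_derive F HF) 1%R Rlt_0_1) as [d2 [Hd2 H2]].
set (A := (Cmod (F 0)%C + 1)%R). set (B := (Cmod (C_derive F 0)%C + 1)%R).
assert (PA : (1 <= A)%R) by (assert (Q := Cmod_ge_0 (F 0)); unfold A; lra).
assert (PB : (1 <= B)%R) by (assert (Q := Cmod_ge_0 (C_derive F 0)); unfold B; lra).
assert (PK : (0 <= K)%R) by (eapply Rle_trans; [apply Rabs_pos|apply (HK 0%R); lra]).
assert (Pp := PI_RGT_0).
set (L := (2 * PI * (K * (2 * (A * B))) + 1)%R).
assert (PAB : (0 <= A * B)%R) by nra.
assert (PL0 : (0 <= 2 * PI * (K * (2 * (A * B))))%R).
{ apply Rmult_le_pos; [lra|]. apply Rmult_le_pos; lra. }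
assert (PL : (1 <= L)%R) by (unfold L; lra).
set (rho := Rmin (Rmin (d1 / 2) (d2 / 2)) (eps / L)).
assert (Pr : (0 < rho)%R).
{ apply Rmin_pos; [apply Rmin_pos; lra|]. apply Rdiv_lt_0_compat; lra. }
exists (ln rho). intros x Hx.
assert (Ex : (exp x <= rho)%R).
{ rewrite <- (exp_ln rho Pr). apply exp_le_mono, Hx. }
assert (Px := exp_pos x).
assert (R1 : (rho <= d1 / 2)%R) by (eapply Rle_trans; apply Rmin_l).
assert (R2 : (rho <= d2 / 2)%R) by (eapply Rle_trans; [apply Rmin_l|apply Rmin_r]).
assert (R3 : (rho <= eps / L)%R) by apply Rmin_r.
apply Rle_trans with (Rabs (2 * PI - 0) * (K * (2 * (A * (B * exp x)))))%R.
- apply (norm_RInt_le_const_abs (V := R_NormedModule)) with (f := fun t => (phi1 (sq (F (circ x t)))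
    * (2 * dot (F (circ x t)) (C_derive F (circ x t) * (circ x t))%C))%R).
  2: { apply (RInt_correct (V := R_CompleteNormedModule)), circle_mean1_ex_RInt. }
  intros t _. change (@norm R_AbsRing R_NormedModule) with Rabs.
  set (z := circ x t).
  assert (Mz : Cmod z = exp x) by (apply Cmod_circ).
  specialize (H1 z ltac:(lra)). specialize (H2 z ltac:(lra)). rewrite Cplus_0_l in H1, H2.
  assert (Fz : (Cmod (F z)%C <= A)%R).
  { replace (F z) with (F z - F 0 + F 0) by ring. eapply Rle_trans; [apply Cmod_triangle|unfold A; lra]. }
  assert (F'z : (Cmod (C_derive F z)%C <= B)%R).
  { replace (C_derive F z) with (C_derive F z - C_derive F 0 + C_derive F 0) by ring.
    eapply Rle_trans; [apply Cmod_triangle|unfold B; lra]. }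
  rewrite !Rabs_mult, (Rabs_pos_eq 2) by lra.
  apply Rmult_le_compat; try apply Rabs_pos; [|apply HK, sq_ge_0|].
  { apply Rmult_le_pos; [lra|apply Rabs_pos]. }
  apply Rmult_le_compat_l; [lra|].
  eapply Rle_trans; [apply abs_dot_le|]. rewrite Cmod_mult, Mz.
  apply Rmult_le_compat; auto using Cmod_ge_0.
  + apply Rmult_le_pos; [apply Cmod_ge_0|lra].
  + apply Rmult_le_compat_r; lra.
- rewrite Rabs_pos_eq by lra.
  apply Rle_trans with (L * exp x)%R; [unfold L; nra|].
  apply Rle_trans with (L * (eps / L))%R; [apply Rmult_le_compat_l; lra|].
  right. field. lra.
Qed.

End CircleMean.

(** Up to normalisation, the Ahlfors-Shimizu form of Nevanlinna's characteristic at radius exp x;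
    the factor 1 / (2 * PI) is omitted. *)
Definition log_mean (F : C -> C) (x : R) : R := circle_mean (fun s => ln (1 + s)) F x.

Lemma log_profile : radial_profile (fun s => ln (1 + s)) (fun s => / (1 + s))%R
  (fun s => - / ((1 + s) * (1 + s)))%R.
Proof.
split; intros s Hs.
- auto_derive; [lra|field; lra].
- auto_derive; [lra|field; lra].
- apply continuity_pt_filterlim.
  apply (ex_derive_continuous (fun s => - / ((1 + s) * (1 + s)))%R). auto_derive. nra.
Qed.

(* [ln (1 + |w|^2) - 3 / (1 + |w|^2)] grows like [2 ln |w|], but its Laplacian
   [4 (4 - 2 |w|^2) / (1 + |w|^2)^3] is positive only near the origin. *)
Definition bump_log (s : R) : R := (ln (1 + s) - 3 / (1 + s))%R.

Lemma bump_log_profile : radial_profile bump_log (fun s => / (1 + s) + 3 / ((1 + s) * (1 + s)))%R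
  (fun s => - / ((1 + s) * (1 + s)) - 6 / ((1 + s) * (1 + s) * (1 + s)))%R.
Proof.
assert (P : forall s, (0 <= s)%R -> (1 + s)%R <> 0%R) by (intros; lra).
split; intros s Hs; specialize (P s Hs).
- unfold bump_log. auto_derive; [lra|field; lra].
- auto_derive.
  + split; [lra|]. split; [|exact I]. apply Rmult_integral_contrapositive; auto.
  + field; lra.
- apply continuity_pt_filterlim.
  apply (ex_derive_continuous (fun s => - / ((1 + s) * (1 + s)) - 6 / ((1 + s) * (1 + s) * (1 + s)))%R).
  auto_derive. repeat split; repeat apply Rmult_integral_contrapositive_currified; auto.
Qed.

Lemma ln_1_plus_ge_0 s : (0 <= s)%R -> (0 <= ln (1 + s))%R.
Proof.
intros H. rewrite <- ln_1. destruct H as [H|H].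
- left. apply ln_increasing; lra.
- rewrite <- H, Rplus_0_r. lra.
Qed.

Lemma ln_le_mono x y : (0 < x)%R -> (x <= y)%R -> (ln x <= ln y)%R.
Proof. intros Hx [H| ->]; [left; apply ln_increasing; auto|lra]. Qed.

Lemma log_mean_ex_RInt F x : entire F -> ex_RInt (fun t => ln (1 + sq (F (circ x t)))) 0 (2 * PI).
Proof. intros H. exact (circle_mean_ex_RInt F H _ _ _ log_profile x). Qed.

Lemma log_mean_ge_0 F x : entire F -> (0 <= log_mean F x)%R.
Proof.
intros HF. apply RInt_ge_0; [assert (Q := PI_RGT_0); lra|apply log_mean_ex_RInt, HF|].
intros t _. apply ln_1_plus_ge_0, sq_ge_0.
Qed.

(** * Growth of composite functions *)

Lemma C_derive_comp f g z : entire f -> entire g ->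
  C_derive (fun z => f (g z)) z = C_derive f (g z) * C_derive g z.
Proof.
intros Hf Hg. apply cderiv_C_derive, (cderiv_comp f g); apply entire_C_derive; auto.
Qed.

Lemma entire_affine_comp g w0 k : entire g -> entire (fun z => k * (g z - w0)) /\
  forall z, C_derive (fun z => k * (g z - w0)) z = k * C_derive g z.
Proof.
intros Hg.
assert (K : forall z, cderiv (fun z => k * (g z - w0)) z (k * C_derive g z)).
{ intros z. apply cderiv_scal. apply (cderiv_val _ _ (C_derive g z - 0)); [ring|].
  apply cderiv_minus; [apply entire_C_derive, Hg|apply cderiv_const]. }
split; [apply (cderiv_entire _ _ K)|]. intros z. apply cderiv_C_derive, K.
Qed.

Lemma sq_plus_le a b : (sq (a + b) <= 2 * sq a + 2 * sq b)%R.
Proof.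
unfold sq, dot, Cplus; simpl.
assert (0 <= (fst a - fst b) * (fst a - fst b))%R by apply Rle_0_sqr.
assert (0 <= (snd a - snd b) * (snd a - snd b))%R by apply Rle_0_sqr. lra.
Qed.

Lemma RInt_le_const (u v : R -> R) (k : R) a b : (a <= b)%R -> ex_RInt u a b -> ex_RInt v a b ->
  (forall t, (u t <= v t + k)%R) -> (RInt u a b <= RInt v a b + (b - a) * k)%R.
Proof.
intros Hab Hu Hv H.
assert (Hk : is_RInt (fun _ => k) a b ((b - a) * k)%R)
  by apply (is_RInt_const (V := R_NormedModule)).
assert (Hs : is_RInt (fun t => v t + k)%R a b (RInt v a b + (b - a) * k)%R).
{ apply (is_RInt_plus (V := R_NormedModule)); auto.
  apply (RInt_correct (V := R_CompleteNormedModule)), Hv. }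
apply (is_RInt_le u (fun t => v t + k)%R a b); auto.
apply (RInt_correct (V := R_CompleteNormedModule)), Hu.
Qed.

Section LogMeanComp.
Variables f g : C -> C.
Hypothesis Hf : entire f.
Hypothesis Hg : entire g.
Variable w0 : C.
Hypothesis Hw0 : C_derive f w0 <> 0.

(** The quantity bounded below is the squared spherical derivative of f, a quarter of the Laplacian
    of ln (1 + |f|^2). It is continuous and positive at w0. *)
Lemma spherical_deriv_lower_bound : exists c d, (0 < c)%R /\ (0 < d)%R /\
  forall w, (Cmod (w - w0)%C < d)%R ->
    (c <= sq (C_derive f w) * / ((1 + sq (f w)) * (1 + sq (f w))))%R.
Proof.
assert (Pm : (0 < Cmod (C_derive f w0)%C)%R) by (apply (proj1 (Cmod_gt_0 _)); exact Hw0).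
destruct (entire_ccont f w0 Hf 1%R Rlt_0_1) as [d1 [Hd1 H1]].
destruct (entire_ccont _ w0 (entire_derive f Hf) (Cmod (C_derive f w0)%C / 2)%R ltac:(lra)) as [d2 [Hd2 H2]].
set (m := Cmod (C_derive f w0)%C) in *.
set (A := (Cmod (f w0)%C + 1)%R).
assert (PA : (1 <= A)%R) by (assert (Q := Cmod_ge_0 (f w0)); unfold A; lra).
assert (PA2 : (0 < 1 + A * A)%R) by nra.
exists (m / 2 * (m / 2) * / ((1 + A * A) * (1 + A * A)))%R, (Rmin d1 d2).
split; [|split].
- apply Rmult_lt_0_compat; [nra|]. apply Rinv_0_lt_compat. nra.
- apply Rmin_pos; auto.
- intros w Hw.
  specialize (H1 (w - w0) (Rlt_le_trans _ _ _ Hw (Rmin_l _ _))).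
  specialize (H2 (w - w0) (Rlt_le_trans _ _ _ Hw (Rmin_r _ _))).
  rewrite Cplus_sub_cancel in H1, H2.
  assert (B1 : (Cmod (f w)%C <= A)%R).
  { replace (f w) with (f w - f w0 + f w0) by ring.
    eapply Rle_trans; [apply Cmod_triangle|unfold A; lra]. }
  assert (B2 : (m / 2 <= Cmod (C_derive f w)%C)%R).
  { assert (T := Cmod_triangle (C_derive f w0 - C_derive f w) (C_derive f w)).
    replace (C_derive f w0 - C_derive f w + C_derive f w) with (C_derive f w0) in T by ring.
    rewrite Cmod_minus_sym in T. fold m in T. lra. }
  rewrite <- !Cmod_sq. assert (Q := Cmod_ge_0 (f w)).
  apply Rmult_le_compat.
  + nra.
  + left. apply Rinv_0_lt_compat. nra.
  + apply Rmult_le_compat; lra.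
  + apply Rinv_le_contravar; [nra|]. apply Rmult_le_compat; nra.
Qed.

(* [ln (1 + |f|^2)] minus a small multiple of a rescaled [bump_log] centred at
   [w0] is subharmonic, hence so is its composition with [g]. *)
Lemma log_mean_comp : exists K, (0 < K)%R /\ forall x, (0 <= x)%R ->
  (log_mean g x <= K * (1 + log_mean (fun z => f (g z)) x))%R.
Proof.
destruct spherical_deriv_lower_bound as (c1 & d & Pc1 & Pd & Hc1).
(* Rescaled by dl, the bump has positive Laplacian only where |w - w0|^2 < 2 * dl^2 = d^2 / 2,
   inside the disc on which [Hc1] holds. *)
set (dl := (d / 2)%R). assert (Pdl : (0 < dl)%R) by (unfold dl; lra).
assert (dl0 : RtoC dl <> 0) by (intros E; injection E; lra).
(* The Laplacian of the rescaled bump is at most 16 / dl^2, its value at w0. Times c this is 4 * c1,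
   the lower bound for the Laplacian of ln (1 + |f|^2) near w0. *)
set (c := (c1 * (dl * dl) / 4)%R).
assert (Pc : (0 < c)%R) by (unfold c; apply Rdiv_lt_0_compat; [repeat apply Rmult_lt_0_compat|]; lra).
set (FV := fun z => f (g z)). set (FU := fun z => / dl * (g z - w0)).
assert (EV : entire FV) by exact (entire_comp f g Hf Hg).
destruct (entire_affine_comp g w0 (/ dl) Hg) as [EU DU]. fold FU in EU, DU.
assert (DV : forall z, C_derive FV z = C_derive f (g z) * C_derive g z)
  by (intros z; exact (C_derive_comp f g z Hf Hg)).
set (D := fun x => (log_mean FV x - c * circle_mean bump_log FU x)%R).
set (D1 := fun x => (circle_mean1 (fun s => / (1 + s)) FV x -
  c * circle_mean1 (fun s => / (1 + s) + 3 / ((1 + s) * (1 + s))) FU x)%R).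
set (V2 := circle_mean2 (fun s => / (1 + s))%R (fun s => - / ((1 + s) * (1 + s)))%R FV).
set (U2 := circle_mean2 (fun s => / (1 + s) + 3 / ((1 + s) * (1 + s)))%R
  (fun s => - / ((1 + s) * (1 + s)) - 6 / ((1 + s) * (1 + s) * (1 + s)))%R FU).
assert (HD : forall x, is_derive D x (D1 x)).
{ intros x. apply (is_derive_minus (log_mean FV)).
  - apply (circle_mean_deriv FV EV _ _ _ log_profile).
  - apply is_derive_scal. apply (circle_mean_deriv FU EU _ _ _ bump_log_profile). }
assert (HD1 : forall x, is_derive D1 x (V2 x - c * U2 x)%R).
{ intros x. apply (is_derive_minus (circle_mean1 (fun s => / (1 + s))%R FV)).
  - apply (circle_mean_deriv2 FV EV _ _ _ log_profile).
  - apply is_derive_scal. apply (circle_mean_deriv2 FU EU _ _ _ bump_log_profile). }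
assert (P1 : forall x, (0 <= D1 x)%R).
{ apply (convex_nondecreasing D D1 _ HD HD1).
  - intros x. apply (proj1 (Rminus_le_0 _ _)). unfold V2, U2, circle_mean2.
    rewrite <- (RInt_scal (V := R_CompleteNormedModule))
      by apply (circle_mean2_ex_RInt FU EU _ _ _ bump_log_profile).
    apply RInt_le; [assert (Q := PI_RGT_0); lra| | |].
    + apply (ex_RInt_scal (V := R_NormedModule)), (circle_mean2_ex_RInt FU EU _ _ _ bump_log_profile).
    + apply (circle_mean2_ex_RInt FV EV _ _ _ log_profile).
    + intros t _. set (z := circ x t). rewrite DU, DV.
      unfold scal; simpl; unfold mult; simpl.
      rewrite <- !Cmult_assoc, (sq_mult (C_derive f (g z))), (sq_mult (/ dl)).
      set (Y := sq (C_derive g z * z)). assert (PY : (0 <= Y)%R) by apply sq_ge_0.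
      assert (Eidl : sq (/ dl) = (/ (dl * dl))%R).
      { rewrite <- RtoC_inv by lra. unfold sq, dot, RtoC; simpl. field. lra. }
      rewrite Eidl. unfold FV.
      set (a := sq (f (g z))). assert (Pa : (0 <= a)%R) by apply sq_ge_0.
      set (n := sq (FU z)). assert (Pn : (0 <= n)%R) by apply sq_ge_0.
      set (q := sq (C_derive f (g z))). assert (Pq : (0 <= q)%R) by apply sq_ge_0.
      assert (En : (Cmod (g z - w0)%C * Cmod (g z - w0)%C = n * (dl * dl))%R).
      { rewrite Cmod_sq. unfold n, FU. rewrite sq_mult, Eidl. field. lra. }
      replace (4 * (/ (1 + a) + a * - / ((1 + a) * (1 + a))) * (q * Y))%R with
        (4 * (q * / ((1 + a) * (1 + a))) * Y)%R by (field; lra).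
      replace (c * (4 * (/ (1 + n) + 3 / ((1 + n) * (1 + n)) +
          n * (- / ((1 + n) * (1 + n)) - 6 / ((1 + n) * (1 + n) * (1 + n)))) *
          (/ (dl * dl) * Y)))%R with
        (4 * (c1 * ((1 - n / 2) * / ((1 + n) * (1 + n) * (1 + n)))) * Y)%R
        by (unfold c; field; lra).
      apply Rmult_le_compat_r; auto. apply Rmult_le_compat_l; [lra|].
      assert (P3 : (1 <= (1 + n) * (1 + n) * (1 + n))%R) by nra.
      assert (I3 : (0 < / ((1 + n) * (1 + n) * (1 + n)) <= 1)%R).
      { split; [apply Rinv_0_lt_compat; lra|]. rewrite <- Rinv_1. apply Rinv_le_contravar; lra. }
      destruct (Rle_lt_dec 2 n) as [L|L].
      * apply Rle_trans with 0%R.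
        -- assert ((1 - n / 2) * / ((1 + n) * (1 + n) * (1 + n)) <= 0)%R by nra. nra.
        -- apply Rmult_le_pos; auto. left. apply Rinv_0_lt_compat. nra.
      * apply Rle_trans with c1.
        -- assert ((1 - n / 2) * / ((1 + n) * (1 + n) * (1 + n)) <= 1)%R by nra. nra.
        -- apply Hc1. apply Rnot_le_lt. intros Hd.
           assert (n * (dl * dl) < d * d)%R by (unfold dl; nra). nra.
  - intros eps He.
    destruct (circle_mean1_lim FV EV _ _ _ log_profile 1) with (eps := (eps / 2)%R) as [X1 H1].
    { intros s Hs. rewrite Rabs_pos_eq by (left; apply Rinv_0_lt_compat; lra).
      rewrite <- Rinv_1. apply Rinv_le_contravar; lra. }
    { lra. }
    destruct (circle_mean1_lim FU EU _ _ _ bump_log_profile 4) with (eps := (eps / (2 * c))%R) as [X2 H2].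
    { intros s Hs.
      assert (J : (0 < / (1 + s) <= 1)%R).
      { split; [apply Rinv_0_lt_compat; lra|]. rewrite <- Rinv_1. apply Rinv_le_contravar; lra. }
      replace (3 / ((1 + s) * (1 + s)))%R with (3 * (/ (1 + s) * / (1 + s)))%R by (field; lra).
      rewrite Rabs_pos_eq; nra. }
    { apply Rdiv_lt_0_compat; lra. }
    exists (Rmin X1 X2). intros x Hx.
    specialize (H1 x (Rle_trans _ _ _ Hx (Rmin_l _ _))).
    specialize (H2 x (Rle_trans _ _ _ Hx (Rmin_r _ _))).
    unfold D1, Rminus. eapply Rle_trans; [apply Rabs_triang|].
    rewrite Rabs_Ropp, Rabs_mult, (Rabs_pos_eq c) by lra.
    apply Rmult_le_compat_l with (r := c) in H2; [|lra].
    replace (c * (eps / (2 * c)))%R with (eps / 2)%R in H2 by (field; lra). lra. }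
(* Comparison with radius 1, that is x = 0: it bounds c times the bump mean of g by the logarithmic
   mean of f o g plus |D 0|. *)
assert (Mono : forall x, (0 <= x)%R -> (D 0 <= D x)%R).
{ intros x Hx. apply (nondecreasing_of_deriv D D1); auto. }
(* kap absorbs the affine change of variable, as 1 + |g|^2 <= kap * (1 + |FU|^2). The 3 in K0 below
   compensates the term - 3 / (1 + s) of [bump_log]. *)
set (kap := (1 + 2 * sq w0 + 2 * (dl * dl))%R).
assert (Pkap : (1 <= kap)%R) by (assert (Q := sq_ge_0 w0); unfold kap; nra).
assert (Pln : (0 <= ln kap)%R) by (rewrite <- ln_1; apply ln_le_mono; lra).
assert (Pp := PI_RGT_0).
set (K0 := (2 * PI * (ln kap + 3))%R).
assert (PK0 : (0 <= K0)%R) by (unfold K0; apply Rmult_le_pos; lra).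
assert (Comp : forall x, (log_mean g x <= circle_mean bump_log FU x + K0)%R).
{ intros x. unfold K0. replace (2 * PI)%R with (2 * PI - 0)%R by ring.
  unfold log_mean, circle_mean. replace (2 * PI - 0 - 0)%R with (2 * PI - 0)%R by ring.
  replace (2 * PI - 0)%R with (2 * PI)%R at 1 2 by ring.
  apply RInt_le_const; [lra|apply log_mean_ex_RInt, Hg|
    apply (circle_mean_ex_RInt FU EU _ _ _ bump_log_profile)|].
  intros t. set (z := circ x t). set (n := sq (FU z)).
  assert (Pn : (0 <= n)%R) by apply sq_ge_0.
  assert (Bg : (1 + sq (g z) <= kap * (1 + n))%R).
  { assert (Eg : g z = w0 + dl * FU z) by (unfold FU; field; auto).
    assert (S := sq_plus_le w0 (dl * FU z)). rewrite <- Eg, sq_mult in S. fold n in S.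
    assert (Edl : sq dl = (dl * dl)%R) by (unfold sq, dot; simpl; ring).
    rewrite Edl in S. assert (Q := sq_ge_0 w0). unfold kap.
    assert (0 <= n * (1 + 2 * sq w0))%R by nra. nra. }
  apply ln_le_mono in Bg; [|assert (Q := sq_ge_0 (g z)); lra].
  rewrite ln_mult in Bg by lra.
  unfold bump_log.
  assert (3 / (1 + n) <= 3)%R.
  { apply Rle_div_l; lra. }
  lra. }
set (D0 := Rabs (D 0)). assert (PD0 := Rabs_pos (D 0)). fold D0 in PD0.
assert (QD0 : (- D0 <= D 0)%R).
{ assert (Q := Rle_abs (- D 0)%R). rewrite Rabs_Ropp in Q. unfold D0. lra. }
exists (1 / c + D0 / c + K0)%R. split.
{ assert (0 < 1 / c)%R by (apply Rdiv_lt_0_compat; lra).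
  assert (0 <= D0 / c)%R by (apply Rmult_le_pos; [auto|left; apply Rinv_0_lt_compat; lra]). lra. }
intros x Hx. specialize (Mono x Hx). specialize (Comp x).
assert (PT := log_mean_ge_0 FV x EV). fold FV.
set (T := log_mean FV x) in *. set (Um := circle_mean bump_log FU x) in *.
assert (HU : (Um <= (T + D0) / c)%R).
{ apply Rle_div_r; [lra|]. change (D x) with (T - c * Um)%R in Mono. lra. }
eapply Rle_trans; [exact Comp|].
assert (Q1 : (0 < / c)%R) by (apply Rinv_0_lt_compat; lra).
replace ((T + D0) / c)%R with (T * / c + D0 * / c)%R in HU by (unfold Rdiv; ring).
unfold Rdiv. rewrite Rmult_1_l.
assert (0 <= T * (D0 * / c))%R by (repeat apply Rmult_le_pos; lra).
assert (0 <= T * K0)%R by nra.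
nra.
Qed.

End LogMeanComp.

(* The circular Laplacian of [ln (1 + |g|^2)] dominates [|g'|^2 / (1 + |g|^2)^2], and
   convexity bounds it at suitable radii: this replaces the lemma on the
   logarithmic derivative. *)
Lemma log_mean_derive g K n : entire g -> (0 <= K)%R ->
  (forall x, (0 <= x)%R -> (log_mean g x <= K * (1 + exp x ^ n))%R) ->
  exists K', (0 <= K')%R /\ forall X, exists x, (X <= x)%R /\ (0 <= x)%R /\
    (log_mean (C_derive g) x <= K' * (1 + exp x ^ n))%R.
Proof.
intros Hg PK HK.
set (J1 := circle_mean1 (fun s => / (1 + s))%R g).
set (J2 := circle_mean2 (fun s => / (1 + s))%R (fun s => - / ((1 + s) * (1 + s)))%R g).
assert (HJ : forall x, is_derive (log_mean g) x (J1 x))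
  by (intros; apply (circle_mean_deriv g Hg _ _ _ log_profile)).
assert (HJ1 : forall x, is_derive J1 x (J2 x))
  by (intros; apply (circle_mean_deriv2 g Hg _ _ _ log_profile)).
assert (E2 : forall x t, (4 * (/ (1 + sq (g (circ x t))) + sq (g (circ x t)) *
   - / ((1 + sq (g (circ x t))) * (1 + sq (g (circ x t))))) * sq (C_derive g (circ x t) * circ x t) =
   4 * (sq (C_derive g (circ x t)) * / ((1 + sq (g (circ x t))) * (1 + sq (g (circ x t))))) *
     (exp x * exp x))%R).
{ intros x t. rewrite sq_mult, <- (Cmod_sq (circ x t)), Cmod_circ.
  assert (Q := sq_ge_0 (g (circ x t))). field. lra. }
assert (PJ2 : forall x, (0 <= J2 x)%R).
{ intros x. apply RInt_ge_0; [assert (Q := PI_RGT_0); lra|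
    apply (circle_mean2_ex_RInt g Hg _ _ _ log_profile)|].
  intros t _. rewrite E2. assert (Q := sq_ge_0 (g (circ x t))).
  assert (Q' := sq_ge_0 (C_derive g (circ x t))). assert (Px := exp_pos x).
  apply Rmult_le_pos; [|nra]. apply Rmult_le_pos; [lra|]. apply Rmult_le_pos; auto.
  left. apply Rinv_0_lt_compat. nra. }
assert (PJ1 : forall x, (0 <= J1 x)%R).
{ apply (convex_nondecreasing (log_mean g) J1 J2 HJ HJ1 PJ2).
  apply (circle_mean1_lim g Hg _ _ _ log_profile 1).
  intros s Hs. rewrite Rabs_pos_eq by (left; apply Rinv_0_lt_compat; lra).
  rewrite <- Rinv_1. apply Rinv_le_contravar; lra. }
assert (MonoJ1 := nondecreasing_of_deriv J1 J2 HJ1 PJ2).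
(* Put q = |g'|^2 / (1 + |g|^2)^2. Then ln (1 + |g'|^2) <= ln (1 + q) + 2 ln (1 + |g|^2), and ln (1
   + q) <= q <= q * exp (2x) because x >= 0; the last term integrates to J2 x / 4. *)
assert (HI : forall x, (0 <= x)%R -> (log_mean (C_derive g) x <= J2 x / 4 + 2 * log_mean g x)%R).
{ intros x Hx. set (W := fun t => ((/ 4) * (4 * (/ (1 + sq (g (circ x t))) + sq (g (circ x t)) *
   - / ((1 + sq (g (circ x t))) * (1 + sq (g (circ x t))))) * sq (C_derive g (circ x t) * circ x t)%C)
   + 2 * ln (1 + sq (g (circ x t))))%R).
  assert (IW : is_RInt W 0 (2 * PI) (J2 x / 4 + 2 * log_mean g x)%R).
  { apply (is_RInt_plus (V := R_NormedModule)).
    - replace (J2 x / 4)%R with (/ 4 * J2 x)%R by field. apply (is_RInt_scal (V := R_NormedModule)).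
      apply (RInt_correct (V := R_CompleteNormedModule)), (circle_mean2_ex_RInt g Hg _ _ _ log_profile).
    - apply (is_RInt_scal (V := R_NormedModule)).
      apply (RInt_correct (V := R_CompleteNormedModule)), log_mean_ex_RInt, Hg. }
  apply (is_RInt_le (fun t => ln (1 + sq (C_derive g (circ x t)))) W 0 (2 * PI)); auto.
  - assert (Q := PI_RGT_0); lra.
  - apply (RInt_correct (V := R_CompleteNormedModule)), log_mean_ex_RInt, entire_derive, Hg.
  - intros t _. unfold W. rewrite E2.
    set (a := sq (g (circ x t))). assert (Pa : (0 <= a)%R) by apply sq_ge_0.
    set (b := sq (C_derive g (circ x t))). assert (Pb : (0 <= b)%R) by apply sq_ge_0.
    set (q := (b * / ((1 + a) * (1 + a)))%R).
    assert (Pq : (0 <= q)%R).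
    { apply Rmult_le_pos; auto. left. apply Rinv_0_lt_compat. nra. }
    assert (Eb : b = (q * ((1 + a) * (1 + a)))%R) by (unfold q; field; lra).
    assert (L1 : (ln (1 + b) <= ln ((1 + q) * ((1 + a) * (1 + a))))%R).
    { apply ln_le_mono; [lra|]. rewrite Eb. nra. }
    rewrite ln_mult, ln_mult in L1 by nra.
    assert (L2 : (ln (1 + q) <= q)%R).
    { rewrite <- (ln_exp q) at 2. apply ln_le_mono; [lra|]. apply exp_ineq1_le. }
    assert (Ex : (1 <= exp x)%R) by (rewrite <- exp_0; apply exp_le_mono, Hx).
    assert (1 <= exp x * exp x)%R by nra.
    assert (q <= q * (exp x * exp x))%R by nra. lra. }
set (e2n := (exp 2 ^ n)%R). assert (Pe : (1 <= e2n)%R).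
{ apply pow_R1_Rle. rewrite <- exp_0. apply exp_le_mono. lra. }
exists (K * e2n / 4 + 2 * K)%R. split.
{ assert (0 <= K * e2n)%R by nra. lra. }
intros X0. set (X := Rmax X0 0).
assert (PX : (0 <= X)%R) by apply Rmax_r.
(* Two mean values with T = [log_mean g]: J2 x = J1 (X + 1) - J1 X <= J1 (X + 1) <= J1 y = T (X + 2)
   - T (X + 1) <= T (X + 2). Moving from x to X + 2 costs at most the factor [e2n]. *)
destruct (MVT_gen J1 X (X + 1) J2) as [x [Hx Ex]].
{ intros; apply HJ1. }
{ intros y _. apply continuity_pt_filterlim, (ex_derive_continuous J1). eexists; apply HJ1. }
rewrite Rmin_left, Rmax_right in Hx by lra.
destruct (MVT_gen (log_mean g) (X + 1) (X + 1 + 1) J1) as [y [Hy Ey]].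
{ intros; apply HJ. }
{ intros y _. apply continuity_pt_filterlim, (ex_derive_continuous (log_mean g)). eexists; apply HJ. }
rewrite Rmin_left, Rmax_right in Hy by lra.
exists x. split; [|split]; [assert (Q := Rmax_l X0 0); fold X in Q; lra|lra|].
assert (Q1 := MonoJ1 (X + 1)%R y ltac:(lra)). assert (Q2 := PJ1 X).
assert (Q3 := log_mean_ge_0 g (X + 1) Hg). assert (Q4 := HK (X + 1 + 1)%R ltac:(lra)).
assert (Q5 : (exp (X + 1 + 1) ^ n <= e2n * exp x ^ n)%R).
{ unfold e2n. rewrite <- Rpow_mult_distr, <- exp_plus. apply pow_incr. split; [left; apply exp_pos|].
  apply exp_le_mono. lra. }
assert (Q6 := HK x ltac:(lra)). specialize (HI x ltac:(lra)).
assert (Pxn : (0 <= exp x ^ n)%R) by (left; apply pow_lt, exp_pos).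
assert (J2x : (J2 x <= K * (1 + e2n * exp x ^ n))%R).
{ apply Rle_trans with (K * (1 + exp (X + 1 + 1) ^ n))%R; [lra|]. apply Rmult_le_compat_l; lra. }
assert (K * (1 + e2n * exp x ^ n) <= K * e2n * (1 + exp x ^ n))%R.
{ rewrite Rmult_assoc. apply Rmult_le_compat_l; auto. nra. }
nra.
Qed.

(** * Taylor coefficients and real parts *)

Lemma curve_deriv_val (c : R -> C) t (a b : C) : a = b -> curve_deriv c t a -> curve_deriv c t b.
Proof. intros ->. auto. Qed.

Lemma curve_deriv_mult a b t a' b' : curve_deriv a t a' -> curve_deriv b t b' ->
  curve_deriv (fun s => a s * b s) t (a' * b t + a t * b').
Proof.
intros Ha Hb.
assert (a1 := curve_deriv_fst _ _ _ Ha). assert (a2 := curve_deriv_snd _ _ _ Ha).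
assert (b1 := curve_deriv_fst _ _ _ Hb). assert (b2 := curve_deriv_snd _ _ _ Hb).
apply curve_deriv_pair; simpl.
- apply (is_derive_val _ _ ((fst a' * fst (b t) + fst (a t) * fst b') -
    (snd a' * snd (b t) + snd (a t) * snd b'))%R); [ring|].
  apply (is_derive_minus (fun s => fst (a s) * fst (b s))%R (fun s => snd (a s) * snd (b s))%R);
  apply (is_derive_mult (K := R_AbsRing)); auto; apply Rmult_comm.
- apply (is_derive_val _ _ ((fst a' * snd (b t) + fst (a t) * snd b') +
    (snd a' * fst (b t) + snd (a t) * fst b'))%R); [ring|].
  apply (is_derive_plus (fun s => fst (a s) * snd (b s))%R (fun s => snd (a s) * fst (b s))%R);
  apply (is_derive_mult (K := R_AbsRing)); auto; apply Rmult_comm.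
Qed.

Lemma cis_scal_deriv (a t : R) : curve_deriv (fun s => cis (a * s)) t (a * Ci * cis (a * t)).
Proof.
apply curve_deriv_pair; simpl; auto_derive; auto; ring.
Qed.

Lemma cis_scal_cont (a t : R) : curve_cont (fun s => cis (a * s)) t.
Proof. eapply curve_deriv_cont, cis_scal_deriv. Qed.

Lemma cis_nat_2PI (m : nat) : cis (INR m * (2 * PI)) = 1 /\ cis (- INR m * (2 * PI)) = 1.
Proof.
assert (K : cis (INR m * (2 * PI)) = 1).
{ induction m.
  - simpl. rewrite Rmult_0_l. apply cis_0.
  - rewrite S_INR. replace ((INR m + 1) * (2 * PI))%R with (INR m * (2 * PI) + 2 * PI)%R by ring.
    rewrite cis_plus, IHm, cis_2PI. ring. }
split; auto.
assert (E : cis (INR m * (2 * PI)) * cis (- INR m * (2 * PI)) = 1).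
{ rewrite <- cis_plus. replace (INR m * (2 * PI) + - INR m * (2 * PI))%R with 0%R by ring. apply cis_0. }
rewrite K in E. rewrite <- E. ring.
Qed.

Lemma circ_F_cont F x t : entire F -> curve_cont (fun s => F (circ x s)) t.
Proof. intros H. apply (entire_circle_cont F (exp x)), H. Qed.

Lemma circle_mean_value F x : entire F -> CInt (fun t => F (circ x t)) 0 (2 * PI) = (2 * PI)%R * F 0.
Proof. intros H. apply mean_value; auto. assert (Q := exp_pos x). lra. Qed.

Definition nth_derive (m : nat) (F : C -> C) : C -> C := Nat.iter m C_derive F.

Lemma nth_derive_S m F : nth_derive (S m) F = nth_derive m (C_derive F).
Proof. unfold nth_derive. induction m; simpl; auto. rewrite <- IHm. reflexivity. Qed.

Definition fourier_coef (F : C -> C) (m : nat) (x : R) : C :=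
  CInt (fun t => F (circ x t) * cis (- INR m * t)) 0 (2 * PI).

(** F (circ x t) * cis (-(m+1) t) has period 2 * PI, so its t-derivative integrates to zero. That
    derivative combines coefficient m + 1 of F with coefficient m of F'. *)
Lemma fourier_coef_S F m x : entire F ->
  INR (S m) * fourier_coef F (S m) x = exp x * fourier_coef (C_derive F) m x.
Proof.
intros HF. unfold fourier_coef.
assert (HF1 := entire_derive F HF).
set (u := fun t => F (circ x t) * cis (- INR (S m) * t)).
set (v := fun t => C_derive F (circ x t) * cis (- INR m * t)).
assert (Cu : forall t, curve_cont u t).
{ intros t. apply curve_cont_mult; [apply circ_F_cont, HF|apply cis_scal_cont]. }
assert (Cv : forall t, curve_cont v t).
{ intros t. apply curve_cont_mult; [apply circ_F_cont, HF1|apply cis_scal_cont]. }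
assert (K : CInt (fun t => (Ci * exp x) * v t - (Ci * INR (S m)) * u t) 0 (2 * PI) = 0).
{ rewrite (CInt_FTC u).
  - unfold u. rewrite (proj2 (cis_nat_2PI (S m))), Rmult_0_r, cis_0.
    unfold circ. rewrite cis_0, cis_2PI. ring.
  - intros t. apply (curve_deriv_val _ _ ((C_derive F (circ x t) * (exp x * (Ci * cis t))) * cis (- INR (S m) * t)
      + F (circ x t) * ((- INR (S m))%R * Ci * cis (- INR (S m) * t)))).
    + unfold u, v.
      replace (cis (- INR m * t)) with (cis t * cis (- INR (S m) * t)).
      * rewrite RtoC_opp. ring.
      * rewrite <- cis_plus. f_equal. rewrite S_INR. ring.
    + apply (curve_deriv_mult (fun s => F (circ x s)) (fun s => cis (- INR (S m) * s))).
      * apply (curve_deriv_comp F (circ x)); [apply entire_C_derive, HF|apply circle_deriv].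
      * apply cis_scal_deriv.
  - intros t. apply curve_cont_minus; apply curve_cont_scal; auto. }
rewrite CInt_minus, !CInt_scal in K by (intros; try apply curve_cont_scal; auto).
set (U := CInt u 0 (2 * PI)) in *. set (V := CInt v 0 (2 * PI)) in *.
replace (INR (S m) * U) with (INR (S m) * U + / Ci * (Ci * exp x * V - Ci * INR (S m) * U)).
- field. apply Ci_neq_0.
- rewrite K. ring.
Qed.

(** Descending m times with [fourier_coef_S] leads to the mean value property of the m-th
    derivative. *)
Lemma fourier_coef_eq m : forall F x, entire F ->
  INR (fact m) * fourier_coef F m x = (exp x ^ m)%R * ((2 * PI)%R * nth_derive m F 0).
Proof.
induction m; intros F x HF.
- unfold fourier_coef. rewrite (CInt_ext _ (fun t => F (circ x t))).
  + rewrite circle_mean_value by auto. simpl. ring.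
  + intros t. simpl. replace (- 0 * t)%R with 0%R by ring. rewrite cis_0. ring.
- replace (INR (fact (S m))) with (INR (fact m) * INR (S m))%R
    by (rewrite <- mult_INR; f_equal; simpl; ring).
  rewrite RtoC_mult, <- Cmult_assoc, fourier_coef_S by auto.
  rewrite nth_derive_S.
  replace (exp x ^ S m)%R with (exp x * exp x ^ m)%R by (simpl; ring).
  rewrite RtoC_mult, <- Cmult_assoc, <- IHm by (apply entire_derive, HF). ring.
Qed.

Lemma cderiv_pow m : forall z, cderiv (fun w => w ^ m) z (INR m * z ^ pred m).
Proof.
induction m; intros z.
- apply (cderiv_val _ _ 0); [simpl; ring|]. apply (cderiv_const 1).
- apply (cderiv_val _ _ (1 * z ^ m + z * (INR m * z ^ pred m))).
  + rewrite S_INR, RtoC_plus. destruct m; simpl; ring.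
  + apply (cderiv_mult (fun w => w) (fun w => w ^ m)); [apply cderiv_id|apply IHm].
Qed.

Lemma entire_mult f g : entire f -> entire g -> entire (fun z => f z * g z).
Proof.
intros Hf Hg.
apply (cderiv_entire _ (fun z => C_derive f z * g z + f z * C_derive g z)). intros z.
apply cderiv_mult; apply entire_C_derive; auto.
Qed.

(** Up to a power of the radius this is the mean of F z * z^(m+1), an entire function vanishing at
    0. *)
Lemma negative_fourier_coef F m x : entire F ->
  CInt (fun t => F (circ x t) * cis (INR (S m) * t)) 0 (2 * PI) = 0.
Proof.
intros HF.
assert (K := circle_mean_value (fun z => F z * z ^ S m) x).
rewrite (CInt_ext _ (fun t => RtoC (exp x ^ S m) * (F (circ x t) * cis (INR (S m) * t)))) in K.
- rewrite CInt_scal in K.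
  + assert (P : (exp x ^ S m)%R <> 0%R) by (apply pow_nonzero; assert (Q := exp_pos x); lra).
    assert (P' : RtoC (exp x ^ S m) <> 0) by (intros E; apply P; injection E; auto).
    set (I := CInt _ _ _) in *.
    replace I with (/ RtoC (exp x ^ S m) * (RtoC (exp x ^ S m) * I)) by (field; auto).
    rewrite K.
    + simpl. ring.
    + apply entire_mult; auto. eapply cderiv_entire, cderiv_pow.
  + intros t. apply curve_cont_mult; [apply circ_F_cont, HF|apply cis_scal_cont].
- intros t. unfold circ at 2. rewrite Cpow_mult_l, <- RtoC_pow.
  assert (E : forall k, cis t ^ k = cis (INR k * t)).
  { induction k.
    - simpl. rewrite Rmult_0_l, cis_0. reflexivity.
    - rewrite S_INR. replace ((INR k + 1) * t)%R with (t + INR k * t)%R by ring.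
      rewrite cis_plus, <- IHk. reflexivity. }
  rewrite E. ring.
Qed.

(* Testing [Re F] against the nonnegative kernel [2 + 2 Re (theta e^{-imt})] isolates
   the [m]-th Taylor coefficient. *)
Lemma nth_derive_0_of_re_le F m n K : entire F -> (n <= m)%nat -> (0 <= K)%R ->
  (forall X, exists x q, (X <= x)%R /\ (forall t, (0 <= q t)%R /\ (fst (F (circ x t)) <= q t)%R) /\
     ex_RInt q 0 (2 * PI) /\ (RInt q 0 (2 * PI) <= K * (1 + exp x ^ n))%R) ->
  nth_derive (S m) F 0 = 0.
Proof.
intros HF Hnm PK H.
set (c := nth_derive (S m) F 0). apply Cmod_eq_0.
apply Rle_antisym; [|apply Cmod_ge_0]. apply Rnot_lt_le. intros Pc.
assert (Pp := PI_RGT_0).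
assert (c0 : RtoC (Cmod c) <> 0) by (intros E; injection E; lra).
(* The rotation with th * c = |c| makes the contribution of c real and positive. *)
set (th := Cconj c * / Cmod c).
assert (Mth : Cmod th = 1%R).
{ unfold th. rewrite Cmod_mult, Cmod_conj, Cmod_inv, Cmod_R, Rabs_pos_eq by (auto; lra). field. lra. }
assert (Tc : th * c = Cmod c).
{ unfold th. replace (Cconj c * / Cmod c * c) with ((c * Cconj c) * / Cmod c) by ring.
  rewrite <- Cmod2_conj, RtoC_pow. simpl. field. auto. }
set (Nf := INR (fact (S m))). assert (PN : (0 < Nf)%R) by apply INR_fact_lt_0.
set (L := (2 * PI * Cmod c / Nf)%R). assert (PL : (0 < L)%R).
{ apply Rdiv_lt_0_compat; auto. apply Rmult_lt_0_compat; lra. }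
(* With k = Re (th * e t) the kernel 2 + 2k lies in [0, 4], so (2 + 2k) * Re F <= (2 + 2k) * q <= 4
   * q. On the left the integral retains F 0 and c; the conjugate term is a negative Fourier
   coefficient and vanishes. *)
assert (Main : forall x q, (forall t, (0 <= q t)%R /\ (fst (F (circ x t)) <= q t)%R) ->
  ex_RInt q 0 (2 * PI) ->
  (4 * PI * fst (F 0) + L * exp x ^ S m <= 4 * RInt q 0 (2 * PI))%R).
{ intros x q Hq Eq.
  set (e := fun t => cis (- INR (S m) * t)). set (e' := fun t => cis (INR (S m) * t)).
  set (w := fun t => 2 * F (circ x t) + (th * (F (circ x t) * e t) + Cconj th * (F (circ x t) * e' t))).
  assert (C0 : forall t, curve_cont (fun t => F (circ x t)) t) by (intros; apply circ_F_cont, HF).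
  assert (C1 : forall t, curve_cont (fun t => F (circ x t) * e t) t)
    by (intros; apply curve_cont_mult; [apply C0|apply cis_scal_cont]).
  assert (C2 : forall t, curve_cont (fun t => F (circ x t) * e' t) t)
    by (intros; apply curve_cont_mult; [apply C0|apply cis_scal_cont]).
  assert (Cw : forall t, curve_cont w t).
  { intros. apply curve_cont_plus; [apply curve_cont_scal, C0|].
    apply curve_cont_plus; apply curve_cont_scal; [apply C1|apply C2]. }
  assert (Ew : CInt w 0 (2 * PI) = (4 * PI * 1)%R * F 0 + RtoC (L * exp x ^ S m)).
  { unfold w.
    rewrite (CInt_plus (fun t => 2 * F (circ x t))
      (fun t => th * (F (circ x t) * e t) + Cconj th * (F (circ x t) * e' t)));
      [|intros t; apply curve_cont_scal, C0
       |intros t; apply curve_cont_plus; apply curve_cont_scal; [apply C1|apply C2]].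
    rewrite (CInt_plus (fun t => th * (F (circ x t) * e t)) (fun t => Cconj th * (F (circ x t) * e' t)));
      [|intros t; apply curve_cont_scal, C1|intros t; apply curve_cont_scal, C2].
    rewrite (CInt_scal 2 _ _ _ C0), (CInt_scal th _ _ _ C1), (CInt_scal (Cconj th) _ _ _ C2).
    rewrite circle_mean_value by auto. unfold e'. rewrite negative_fourier_coef by auto.
    change (CInt (fun t => F (circ x t) * e t) 0 (2 * PI)) with (fourier_coef F (S m) x).
    assert (K0 := fourier_coef_eq (S m) F x HF). fold c in K0. fold Nf in K0.
    assert (Nf0 : RtoC Nf <> 0) by (intros E; injection E; lra).
    replace (fourier_coef F (S m) x) with (/ Nf * (Nf * fourier_coef F (S m) x)) by (field; auto).
    rewrite K0. unfold L, Rdiv. rewrite !RtoC_mult, RtoC_inv, <- Tc by lra. ring. }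
  assert (Iw := is_CInt_fst _ _ _ _ (CInt_correct w 0 (2 * PI) Cw)). rewrite Ew in Iw.
  assert (Iq : is_RInt (fun t => 4 * q t)%R 0 (2 * PI) (4 * RInt q 0 (2 * PI))%R).
  { apply (is_RInt_scal (V := R_NormedModule)), (RInt_correct (V := R_CompleteNormedModule)), Eq. }
  replace (4 * PI * fst (F 0) + L * exp x ^ S m)%R with
    (fst ((4 * PI * 1)%R * F 0 + RtoC (L * exp x ^ S m))) by (simpl; ring).
  refine (is_RInt_le (fun t => fst (w t)) (fun t => 4 * q t)%R 0 (2 * PI) _ _ _ Iw Iq _); [lra|].
  intros t _. destruct (Hq t) as [Q1 Q2].
  assert (Ee : e' t = Cconj (e t)).
  { unfold e, e', cis, Cconj; simpl. f_equal.
    - rewrite <- cos_neg. f_equal. ring.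
    - rewrite <- sin_neg. f_equal. ring. }
  set (k := fst (th * e t)).
  assert (Bk : (Rabs k <= 1)%R).
  { replace 1%R with (Cmod (th * e t)%C) by (rewrite Cmod_mult, Mth; unfold e; rewrite Cmod_cis; ring).
    eapply Rle_trans; [|apply Rmax_Cmod]. apply Rmax_l. }
  apply Rabs_le_between in Bk.
  replace (fst (w t)) with (fst (F (circ x t)) * (2 + 2 * k))%R.
  - nra.
  - unfold w, k. rewrite Ee. unfold Cconj, Cplus, Cmult; simpl. ring. }
set (A := (Rabs (4 * PI * fst (F 0)) + 8 * K)%R).
assert (PA : (0 <= A)%R) by (assert (Q := Rabs_pos (4 * PI * fst (F 0))); unfold A; lra).
(* The radius satisfies L * exp x >= A + 1, so L * exp x ^ S m exceeds the available bound A * exp x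
   ^ n. *)
destruct (H (Rmax 0 (ln ((A + 1) / L)))) as (x & q & Hx & Hq & Eq & Iq).
specialize (Main x q Hq Eq).
assert (Hx0 : (0 <= x)%R) by (eapply Rle_trans; [apply Rmax_l|exact Hx]).
assert (PAL : (0 < (A + 1) / L)%R) by (apply Rdiv_lt_0_compat; lra).
assert (Ex : ((A + 1) / L <= exp x)%R).
{ rewrite <- (exp_ln _ PAL). apply exp_le_mono. eapply Rle_trans; [apply Rmax_r|exact Hx]. }
apply Rle_div_l in Ex; [|lra].
assert (E1 : (1 <= exp x)%R) by (rewrite <- exp_0; apply exp_le_mono, Hx0).
assert (En : (1 <= exp x ^ n)%R) by (apply pow_R1_Rle, E1).
assert (Em : (exp x * exp x ^ n <= exp x ^ S m)%R).
{ change (exp x ^ S m)%R with (exp x * exp x ^ m)%R. apply Rmult_le_compat_l; [lra|].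
  apply Rle_pow; auto. }
assert (Q := Rle_abs (- (4 * PI * fst (F 0)))%R). rewrite Rabs_Ropp in Q.
assert (B1 : (L * (exp x * exp x ^ n) <= A * exp x ^ n)%R).
{ apply Rle_trans with (L * exp x ^ S m)%R; [apply Rmult_le_compat_l; lra|].
  unfold A. assert (Q2 := Rabs_pos (4 * PI * fst (F 0))). nra. }
assert (B2 : ((A + 1) * exp x ^ n <= exp x * L * exp x ^ n)%R) by (apply Rmult_le_compat_r; lra).
nra.
Qed.

(** * Factorizations of the Gaussian primitive *)

Definition shift (z0 : C) (F : C -> C) (z : C) : C := F (z0 + z).

Lemma shift_cderiv z0 F z l : cderiv F (z0 + z) l -> cderiv (shift z0 F) z l.
Proof.
intros H. apply (cderiv_val _ _ (l * (0 + 1))); [ring|].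
apply (cderiv_comp F (fun w => z0 + w)); auto.
apply cderiv_plus; [apply cderiv_const|apply cderiv_id].
Qed.

Lemma entire_shift z0 F : entire F -> entire (shift z0 F).
Proof.
intros H. apply (cderiv_entire _ (shift z0 (C_derive F))). intros z.
apply shift_cderiv, entire_C_derive, H.
Qed.

Lemma C_derive_shift z0 F : entire F -> C_derive (shift z0 F) = shift z0 (C_derive F).
Proof.
intros H. apply functional_extensionality. intros z.
apply cderiv_C_derive, shift_cderiv, entire_C_derive, H.
Qed.

Lemma nth_derive_shift z0 m : forall F, entire F ->
  nth_derive m (shift z0 F) = shift z0 (nth_derive m F).
Proof.
induction m; intros F H; [reflexivity|].
rewrite !nth_derive_S, C_derive_shift by auto. apply IHm, entire_derive, H.
Qed.

Lemma log_mean_le F x M : entire F -> (forall t, (ln (1 + sq (F (circ x t))) <= M)%R) ->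
  (log_mean F x <= 2 * PI * M)%R.
Proof.
intros HF HM. assert (Pp := PI_RGT_0).
replace (2 * PI * M)%R with ((2 * PI - 0) * M)%R by ring.
apply (is_RInt_le (fun t => ln (1 + sq (F (circ x t)))) (fun _ => M) 0 (2 * PI)).
- lra.
- apply (RInt_correct (V := R_CompleteNormedModule)), log_mean_ex_RInt, HF.
- apply (is_RInt_const (V := R_NormedModule)).
- auto.
Qed.

Lemma C_derive_0_const F : entire F -> (forall z, C_derive F z = 0) -> forall z, F z = F 0.
Proof.
intros HF H. apply cderiv_0_const. intros z. rewrite <- (H z). apply entire_C_derive, HF.
Qed.

Lemma C_derive_const_linear F beta : entire F -> (forall z, C_derive F z = beta) ->
  forall z, F z = F 0 + beta * z.
Proof.
intros HF H z.
rewrite (cderiv_eq_minus F (fun z => beta * z) (fun _ => beta)).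
- ring.
- intros w. rewrite <- (H w). apply entire_C_derive, HF.
- intros w. apply cderiv_linear.
Qed.

(** The constant may depend on the centre z0: the bound is used at one centre at a time, to make a
    Taylor coefficient vanish there. *)
Definition log_growth (F : C -> C) (n : nat) : Prop :=
  forall z0, exists K, (0 <= K)%R /\
    forall x, (0 <= x)%R -> (log_mean (shift z0 F) x <= K * (1 + exp x ^ n))%R.

Lemma log_growth_right_factor f g w0 n : entire f -> entire g -> C_derive f w0 <> 0 ->
  log_growth (fun z => f (g z)) n -> log_growth g n.
Proof.
intros Hf Hg Hw HG z0. destruct (HG z0) as [K [PK HK]].
destruct (log_mean_comp f (shift z0 g) Hf (entire_shift z0 g Hg) w0 Hw) as [L [PL HL]].
exists (L * (1 + K))%R. split; [nra|].
intros x Hx. specialize (HK x Hx). specialize (HL x Hx).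
change (log_mean (fun z => f (shift z0 g z)) x) with (log_mean (shift z0 (fun z => f (g z))) x) in HL.
assert (P : (0 < exp x ^ n)%R) by apply pow_lt, exp_pos.
eapply Rle_trans; [exact HL|]. rewrite Rmult_assoc. apply Rmult_le_compat_l; lra.
Qed.

(** The weaker form that [log_mean_derive] yields for a derivative and that [nth_derive_0_of_re_le]
    accepts. *)
Definition log_growth_often (F : C -> C) (n : nat) : Prop :=
  forall z0, exists K, (0 <= K)%R /\ forall X, exists x, (X <= x)%R /\ (0 <= x)%R /\
    (log_mean (shift z0 F) x <= K * (1 + exp x ^ n))%R.

Lemma log_growth_log_growth_often F n : log_growth F n -> log_growth_often F n.
Proof.
intros H z0. destruct (H z0) as [K [PK HK]]. exists K. split; auto.
intros X. exists (Rmax X 0). split; [apply Rmax_l|]. split; [apply Rmax_r|].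
apply HK, Rmax_r.
Qed.

Lemma log_growth_derive g n : entire g -> log_growth g n -> log_growth_often (C_derive g) n.
Proof.
intros Hg H z0. destruct (H z0) as [K [PK HK]].
rewrite <- C_derive_shift by auto.
apply (log_mean_derive (shift z0 g) K n (entire_shift z0 g Hg) PK HK).
Qed.

(** Re h = (ln |F|^2 - ln |k|^2) / 2 is at most ln (1 + |F|^2) + c, a nonnegative majorant with
    controlled means around every centre. *)
Lemma exponent_polynomial F h (k : C) n : entire F -> entire h -> k <> 0 ->
  (forall z, F z = k * Cexp (h z)) -> log_growth_often F n ->
  forall z, nth_derive (S n) h z = 0.
Proof.
intros HF Hh Hk E HG z0.
replace (nth_derive (S n) h z0) with (nth_derive (S n) (shift z0 h) 0).
2: { rewrite nth_derive_shift by auto. unfold shift. f_equal. ring. }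
destruct (HG z0) as [K [PK HK]].
assert (Pk : (0 < sq k)%R).
{ rewrite <- Cmod_sq. assert (Q := proj1 (Cmod_gt_0 k) Hk). nra. }
set (c := Rabs (/ 2 * ln (sq k))). assert (Pc : (0 <= c)%R) by apply Rabs_pos.
assert (Pp := PI_RGT_0).
apply (nth_derive_0_of_re_le (shift z0 h) n n (K + 2 * PI * c)%R); auto.
{ apply entire_shift, Hh. } { nra. }
intros X. destruct (HK X) as (x & Hx & Hx0 & HL).
exists x, (fun t => ln (1 + sq (shift z0 F (circ x t))) + c)%R.
assert (I0 := log_mean_ex_RInt (shift z0 F) x (entire_shift z0 F HF)).
assert (I1 : is_RInt (fun t => ln (1 + sq (shift z0 F (circ x t))) + c)%R 0 (2 * PI)
  (log_mean (shift z0 F) x + (2 * PI - 0) * c)%R).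
{ apply (is_RInt_plus (V := R_NormedModule)).
  - apply (RInt_correct (V := R_CompleteNormedModule)), I0.
  - apply (is_RInt_const (V := R_NormedModule)). }
split; auto. split; [|split].
- intros t. set (w := z0 + circ x t).
  change (shift z0 F (circ x t)) with (F w). change (shift z0 h (circ x t)) with (h w).
  assert (L0 := ln_1_plus_ge_0 (sq (F w)) (sq_ge_0 _)). split; [lra|].
  assert (L1 : (ln (sq (F w)) <= ln (1 + sq (F w)))%R).
  { apply ln_le_mono; [|lra]. rewrite E, sq_mult. apply Rmult_lt_0_compat; auto.
    rewrite <- Cmod_sq, Cmod_Cexp. assert (Q := exp_pos (fst (h w))). nra. }
  rewrite E in L1 at 1. rewrite sq_mult, <- (Cmod_sq (Cexp _)), Cmod_Cexp in L1.
  assert (Q := exp_pos (fst (h w))).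
  rewrite ln_mult, ln_mult, ln_exp in L1 by nra.
  assert (B := Rle_abs (- (/ 2 * ln (sq k)))). rewrite Rabs_Ropp in B. fold c in B. lra.
- eexists; exact I1.
- replace (RInt _ 0 (2 * PI)) with (log_mean (shift z0 F) x + (2 * PI - 0) * c)%R
    by (symmetry; apply (is_RInt_unique (V := R_CompleteNormedModule)), I1).
  assert (P : (0 < exp x ^ n)%R) by apply pow_lt, exp_pos.
  assert (0 <= 2 * PI * c * exp x ^ n)%R by (apply Rmult_le_pos; [apply Rmult_le_pos|]; lra). lra.
Qed.

Lemma Cexp_linear_periodic (h : C -> C) (beta : C) : beta <> 0 -> (forall z, h z = h 0 + beta * z) ->
  exists T : C, T <> 0 /\ forall z, Cexp (h (z + T)) = Cexp (h z).
Proof.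
intros Hb Hh.
assert (Pp := PI_RGT_0).
set (tau := (0, 2 * PI)%R : C).
assert (E1 : Cexp tau = 1).
{ unfold Cexp, tau; simpl. rewrite exp_0, cis_2PI. ring. }
exists (tau / beta). split.
- intros E0. assert (E2 : tau = 0) by (replace tau with (tau / beta * beta) by (field; auto); rewrite E0; ring).
  unfold tau in E2. injection E2. lra.
- intros z. rewrite (Hh (z + tau / beta)), (Hh z).
  replace (h 0 + beta * (z + tau / beta)) with (h 0 + beta * z + tau) by (field; auto).
  rewrite Cexp_plus, E1. ring.
Qed.

(** F is the translation w + a composed with F - a, so the bound for right factors applies. *)
Lemma log_growth_minus_const F a n : entire F -> log_growth F n -> log_growth (fun z => F z - a) n.
Proof.
intros HF H. apply (log_growth_right_factor (fun w => w + a) (fun z => F z - a) 0).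
- apply (cderiv_entire _ (fun _ => 1 + 0)). intros z.
  apply cderiv_plus; [apply cderiv_id|apply cderiv_const].
- apply (cderiv_entire _ (fun z => C_derive F z - 0)). intros z.
  apply cderiv_minus; [apply entire_C_derive, HF|apply cderiv_const].
- rewrite (cderiv_C_derive _ _ (1 + 0)).
  + intros E. injection E. lra.
  + apply cderiv_plus; [apply cderiv_id|apply cderiv_const].
- replace (fun z => F z - a + a) with F; auto.
  apply functional_extensionality. intros z. ring.
Qed.

Lemma quadratic_of_derive3 F : entire F -> (forall z, nth_derive 3 F z = 0) ->
  forall z, F z = F 0 + C_derive F 0 * z + C_derive (C_derive F) 0 * / 2 * (z * z).
Proof.
intros HF H z.
assert (E1 := entire_derive _ HF). assert (E2 := entire_derive _ E1).
assert (K2 := C_derive_0_const _ E2 H).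
set (c2 := C_derive (C_derive F) 0) in *. set (c1 := C_derive F 0) in *.
assert (K1 := C_derive_const_linear _ c2 E1 K2). fold c1 in K1.
rewrite (cderiv_eq_minus F (fun z => c1 * z + c2 * / 2 * (z * z)) (C_derive F)).
- ring.
- intros w. apply entire_C_derive, HF.
- intros w. rewrite K1. apply (cderiv_val _ _ (c1 + c2 * / 2 * (2 * w))); [field|].
  apply cderiv_plus; [apply cderiv_linear|]. apply cderiv_scal, cderiv_sqr.
Qed.

(** The exponent 1 is cruder than O(ln r), but it already forces the exponent of g' to be linear,
    and it follows from 1 + |q w| <= exp (M + 2 |w|). *)
Lemma quadratic_log_growth c0 c1 c2 : log_growth (fun z => c0 + c1 * z + c2 * (z * z)) 1.
Proof.
intros z0. set (q := fun z => c0 + c1 * z + c2 * (z * z)).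
assert (Eq : entire q).
{ apply (cderiv_entire _ (fun z => 0 + c1 + c2 * (2 * z))). intros z.
  apply cderiv_plus; [apply cderiv_plus|].
  - apply cderiv_const. - apply cderiv_linear. - apply cderiv_scal, cderiv_sqr. }
set (a := Cmod z0). assert (Pa : (0 <= a)%R) by apply Cmod_ge_0.
set (M := (Cmod c0 + Cmod c1 + Cmod c2)%R).
assert (P0 := Cmod_ge_0 c0). assert (P1 := Cmod_ge_0 c1). assert (P2 := Cmod_ge_0 c2).
assert (Pp := PI_RGT_0).
exists (2 * PI * (2 * (M + 2 * (a + 1))))%R. split.
{ unfold M. apply Rmult_le_pos; lra. }
intros x Hx.
assert (Ex : (1 <= exp x)%R) by (rewrite <- exp_0; apply exp_le_mono, Hx).
eapply Rle_trans; [apply log_mean_le with (M := (2 * (M + 2 * (a + 1)) * (1 + exp x ^ 1))%R)|].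
- apply entire_shift, Eq.
- intros t. unfold shift. set (w := z0 + circ x t). set (rho := Cmod w).
  assert (Pr : (0 <= rho)%R) by apply Cmod_ge_0.
  assert (Br : (rho <= (a + 1) * exp x)%R).
  { eapply Rle_trans; [apply Cmod_triangle|]. rewrite Cmod_circ. fold a. nra. }
  set (m := Cmod (q w)%C). assert (Pm : (0 <= m)%R) by apply Cmod_ge_0.
  assert (Bm : (m <= Cmod c0 + Cmod c1 * rho + Cmod c2 * (rho * rho))%R).
  { unfold m, q. eapply Rle_trans; [apply Cmod_triangle|].
    eapply Rle_trans; [apply Rplus_le_compat_r, Cmod_triangle|].
    rewrite !Cmod_mult. fold rho. lra. }
  assert (B1 : (1 + m <= exp (M + 2 * rho))%R).
  { replace (M + 2 * rho)%R with (M + (rho + rho))%R by ring. rewrite !exp_plus.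
    assert (e1 := exp_ineq1_le M). assert (e2 := exp_ineq1_le rho).
    apply Rle_trans with ((1 + M) * ((1 + rho) * (1 + rho)))%R.
    - unfold M in *. assert (0 <= Cmod c1 * rho)%R by nra. assert (0 <= Cmod c2 * rho)%R by nra.
      assert (0 <= Cmod c0 * rho)%R by nra. assert (0 <= rho * rho)%R by nra.
      assert (0 <= Cmod c0 * (rho * rho))%R by nra. assert (0 <= Cmod c1 * (rho * rho))%R by nra. nra.
    - apply Rmult_le_compat; try lra; [unfold M; lra|nra|]. apply Rmult_le_compat; lra. }
  assert (B2 : (1 + sq (q w) <= (1 + m) * (1 + m))%R).
  { rewrite <- Cmod_sq. fold m. nra. }
  apply ln_le_mono in B2; [|assert (Q := sq_ge_0 (q w)); lra].
  rewrite ln_mult in B2 by lra.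
  apply ln_le_mono in B1; [|lra]. rewrite ln_exp in B1.
  rewrite pow_1. assert (0 <= M * exp x)%R by (unfold M; apply Rmult_le_pos; lra). nra.
- right. ring.
Qed.

(** * The primitive of exp(z^2) and its factors *)

Section GaussianPrimitive.
Variable p : C -> C.
Hypothesis Hp : forall z, cderiv p z (Cexp (z * z)).

Lemma entire_p : entire p.
Proof. apply (cderiv_entire _ _ Hp). Qed.

(** With rho = |w|, 1 + |p w| <= (1 + b) * (1 + rho * exp (rho^2)) <= exp (b + rho + rho^2), and rho
    is at most (|z0| + 1) * exp x on the circle. *)
Lemma p_log_growth : log_growth p 2.
Proof.
intros z0.
set (a := Cmod z0). set (b := Cmod (p 0)%C).
assert (Pa : (0 <= a)%R) by apply Cmod_ge_0. assert (Pb : (0 <= b)%R) by apply Cmod_ge_0.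
assert (Pp := PI_RGT_0).
set (K := (2 * PI * (2 * (b + 2 * ((a + 1) * (a + 1)))))%R).
exists K.
assert (PK : (0 <= K)%R).
{ assert (0 <= (a + 1) * (a + 1))%R by nra. unfold K. apply Rmult_le_pos; lra. }
split; auto. intros x Hx.
assert (Ex : (1 <= exp x)%R) by (rewrite <- exp_0; apply exp_le_mono, Hx).
eapply Rle_trans; [apply log_mean_le with
  (M := (2 * (b + 2 * ((a + 1) * (a + 1))) * (1 + exp x ^ 2))%R)|].
- apply entire_shift, entire_p.
- intros t. unfold shift. set (w := z0 + circ x t). set (rho := Cmod w).
  assert (Pr : (0 <= rho)%R) by apply Cmod_ge_0.
  assert (Br : (rho <= (a + 1) * exp x)%R).
  { eapply Rle_trans; [apply Cmod_triangle|]. rewrite Cmod_circ. fold a. nra. }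
  assert (Bp := gaussian_primitive_le p Hp w). fold b rho in Bp.
  set (m := Cmod (p w)%C) in *. assert (Pm : (0 <= m)%R) by apply Cmod_ge_0.
  assert (B1 : (1 + m <= exp (b + (rho + rho * rho)))%R).
  { rewrite !exp_plus.
    assert (e1 := exp_ineq1_le b). assert (e2 := exp_ineq1_le rho).
    assert (e3 := exp_ineq1_le (rho * rho)).
    assert (Q0 : (1 + b <= exp b)%R) by lra.
    set (X := exp (rho * rho)) in *. assert (PX : (1 <= X)%R) by nra.
    assert (Q1 : (1 + rho * X <= exp rho * X)%R) by nra.
    apply Rle_trans with ((1 + b) * (1 + rho * X))%R.
    - assert (0 <= b * (rho * X))%R by (repeat apply Rmult_le_pos; lra). nra.
    - apply Rmult_le_compat; try lra. assert (0 <= rho * X)%R by nra. lra. }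
  assert (B2 : (1 + sq (p w) <= (1 + m) * (1 + m))%R).
  { rewrite <- Cmod_sq. fold m. nra. }
  apply ln_le_mono in B2; [|assert (Q := sq_ge_0 (p w)); lra].
  rewrite ln_mult in B2 by lra.
  apply ln_le_mono in B1; [|lra]. rewrite ln_exp in B1.
  assert (B3 : (rho + rho * rho <= 2 * ((a + 1) * (a + 1)) * exp x ^ 2)%R).
  { assert (E2 : (1 <= (a + 1) * exp x)%R) by nra.
    set (y := ((a + 1) * exp x)%R) in *.
    replace (2 * ((a + 1) * (a + 1)) * exp x ^ 2)%R with (2 * (y * y))%R by (unfold y; ring).
    nra. }
  assert (0 <= b * exp x ^ 2)%R by (apply Rmult_le_pos; [auto|apply pow2_ge_0]).
  assert (0 <= (a + 1) * (a + 1))%R by nra. nra.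
- right. unfold K. ring.
Qed.

Lemma p_not_periodic (T : C) : T <> 0 -> ~ (forall z, p (z + T) = p z).
Proof.
intros HT Hper.
assert (E : forall z, Cexp ((z + T) * (z + T)) = Cexp (z * z)).
{ intros z. rewrite <- (cderiv_C_derive _ _ _ (Hp z)). symmetry. apply cderiv_C_derive.
  apply cderiv_ext with (fun z => p (z + T)); [exact Hper|].
  apply (cderiv_val _ _ (Cexp ((z + T) * (z + T)) * (1 + 0))); [ring|].
  apply (cderiv_comp p (fun z => z + T)); [apply Hp|].
  apply cderiv_plus; [apply cderiv_id|apply cderiv_const]. }
assert (R : forall z, (fst ((z + T) * (z + T)) = fst (z * z))%C).
{ intros z. apply exp_inv. rewrite <- !Cmod_Cexp, E. reflexivity. }
(* Let T = u + iv. The point 0 gives u^2 = v^2; the point conj T, where z + T = 2u, gives 4 * u^2 =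
   u^2 - v^2 = 0. *)
apply HT. assert (R0 := R 0). assert (R1 := R (Cconj T)).
destruct T as [u v]. unfold Cmult, Cplus, Cconj in R0, R1. simpl in R0, R1.
assert (u = 0)%R by nra. assert (v = 0)%R by nra. subst. reflexivity.
Qed.

Section Factorization.
Variables f g : C -> C.
Hypothesis Hf : entire f.
Hypothesis Hg : entire g.
Hypothesis Hfg : forall z, p z = f (g z).

Lemma factor_derive z : C_derive f (g z) * C_derive g z = Cexp (z * z).
Proof.
rewrite <- (C_derive_comp f g z Hf Hg). apply cderiv_C_derive.
apply cderiv_ext with p; auto.
Qed.

Lemma left_factor_derive_neq_0 z : C_derive f (g z) <> 0.
Proof. intros E. apply (Cexp_neq_0 (z * z)). rewrite <- factor_derive, E. ring. Qed.

Lemma right_factor_derive_neq_0 z : C_derive g z <> 0.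
Proof. intros E. apply (Cexp_neq_0 (z * z)). rewrite <- factor_derive, E. ring. Qed.

Lemma right_factor_log_growth : log_growth g 2.
Proof.
apply (log_growth_right_factor f g (g 0) 2 Hf Hg (left_factor_derive_neq_0 0)).
replace (fun z => f (g z)) with p; [apply p_log_growth|].
apply functional_extensionality, Hfg.
Qed.

Lemma right_factor_not_periodic (T : C) : T <> 0 -> ~ (forall z, g (z + T) = g z).
Proof.
intros HT H. apply (p_not_periodic T HT). intros z. rewrite !Hfg, H. reflexivity.
Qed.

Lemma left_factor_derive_zero_free a : C_derive f a <> 0.
Proof.
intros Ha.
assert (N : forall z, g z - a <> 0).
{ intros z. apply Cminus_neq. intros E. apply (left_factor_derive_neq_0 z). rewrite E. exact Ha. }
assert (Dga : forall z, cderiv (fun z => g z - a) z (C_derive g z)).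
{ intros z. apply (cderiv_val _ _ (C_derive g z - 0)); [ring|].
  apply cderiv_minus; [apply entire_C_derive, Hg|apply cderiv_const]. }
assert (Ega : entire (fun z => g z - a)) by (apply (cderiv_entire _ _ Dga)).
destruct (entire_zero_free _ Ega N) as (h & k & Eh & Hk & E).
assert (H3 := exponent_polynomial _ h k 2 Ega Eh Hk E
  (log_growth_log_growth_often _ _ (log_growth_minus_const g a 2 Hg right_factor_log_growth))).
assert (Eh1 := entire_derive _ Eh). assert (Eh2 := entire_derive _ Eh1).
assert (Hh1 : forall z, C_derive h z <> 0).
{ intros z E0. apply (right_factor_derive_neq_0 z).
  rewrite <- (cderiv_C_derive _ _ _ (Dga z)).
  rewrite (cderiv_C_derive _ _ (k * (Cexp (h z) * C_derive h z))).
  - rewrite E0. ring.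
  - apply cderiv_ext with (fun z => k * Cexp (h z)); [intros; symmetry; apply E|].
    apply cderiv_scal, (cderiv_comp Cexp h); [apply Cexp_cderiv|apply entire_C_derive, Eh]. }
assert (K2 := C_derive_0_const _ Eh2 H3).
set (c2 := C_derive (C_derive h) 0) in *.
assert (K1 := C_derive_const_linear _ c2 Eh1 K2).
assert (c20 : c2 = 0).
(* The witness is the zero that the affine function h' would have if c2 were nonzero. *)
{ apply NNPP. intros Hc. apply (Hh1 (- C_derive h 0 / c2)). rewrite K1. field. exact Hc. }
assert (K0 := C_derive_const_linear h (C_derive h 0) Eh).
destruct (Cexp_linear_periodic h (C_derive h 0)) as [T [HT PT]].
- apply Hh1.
- apply K0. intros z. rewrite K1, c20. ring.
- apply (right_factor_not_periodic T HT). intros z.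
  replace (g (z + T)) with (g (z + T) - a + a) by ring.
  rewrite E, PT, <- E. ring.
Qed.

Lemma factor_affine : affine f \/ affine g.
Proof.
apply NNPP. intros N. apply not_or_and in N. destruct N as [Nf Ng].
assert (Ef1 := entire_derive _ Hf). assert (Eg1 := entire_derive _ Hg).
destruct (entire_zero_free _ Ef1 left_factor_derive_zero_free) as (A & k1 & EA & Hk1 & E1).
destruct (entire_zero_free _ Eg1 right_factor_derive_neq_0) as (B & k2 & EB & Hk2 & E2).
assert (EAg := entire_comp A g EA Hg).
assert (HB3 := exponent_polynomial _ B k2 2 Eg1 EB Hk2 E2 (log_growth_derive g 2 Hg right_factor_log_growth)).
(* exp (u) is constant for u = A o g + B - z^2; differentiating this gives u' = 0, so no branch of
   the logarithm has to be chosen. *)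
assert (EAB : exists c, forall z, A (g z) = c + (z * z - B z)).
{ set (u := fun z => A (g z) + B z - z * z).
  assert (Du : forall z, cderiv u z (C_derive (fun z => A (g z)) z + C_derive B z - 2 * z)).
  { intros z. apply cderiv_minus; [apply cderiv_plus; apply entire_C_derive; auto|apply cderiv_sqr]. }
  assert (Eu : forall z, Cexp (u z) = / (k1 * k2)).
  { intros z. assert (K := factor_derive z). rewrite E1, E2 in K.
    assert (K3 : Cexp (u z) * Cexp (z * z) = Cexp (A (g z)) * Cexp (B z)).
    { rewrite <- !Cexp_plus. f_equal. unfold u. ring. }
    assert (Q := Cexp_neq_0 (z * z)).
    replace (Cexp (u z)) with (Cexp (u z) * Cexp (z * z) / Cexp (z * z)) by (field; auto).
    rewrite K3, <- K. field. repeat split; auto; apply Cexp_neq_0. }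
  exists (u 0). intros z.
  assert (K : u z = u 0).
  { apply cderiv_0_const. intros w.
    apply (cderiv_val _ _ (C_derive (fun z => A (g z)) w + C_derive B w - 2 * w)); [|apply Du].
    set (d := C_derive (fun z => A (g z)) w + C_derive B w - 2 * w).
    assert (Z : Cexp (u w) * d = 0).
    { assert (Z0 := cderiv_C_derive _ _ _ (cderiv_comp Cexp u w _ _ (Cexp_cderiv (u w)) (Du w))).
      fold d in Z0. rewrite <- Z0.
      apply cderiv_C_derive. apply cderiv_ext with (fun _ => / (k1 * k2)).
      - intros v. symmetry. apply Eu.
      - apply cderiv_const. }
    assert (Q := Cexp_neq_0 (u w)).
    replace d with (/ Cexp (u w) * (Cexp (u w) * d)) by (field; auto). rewrite Z. ring. }
  rewrite <- K. unfold u. ring. }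
destruct EAB as [c Hc].
assert (GA : log_growth (fun z => A (g z)) 1).
{ assert (K := quadratic_of_derive3 B EB HB3).
  set (b0 := B 0) in *. set (b1 := C_derive B 0) in *. set (b2 := C_derive (C_derive B) 0) in *.
  replace (fun z => A (g z)) with
    (fun z => (c - b0) + (- b1) * z + (1 - b2 * / 2) * (z * z)); [apply quadratic_log_growth|].
  apply functional_extensionality. intros z. rewrite Hc, K. ring. }
assert (Aw : exists w, C_derive A w <> 0).
{ apply NNPP. intros Na. apply Nf.
  assert (A0 : forall w, C_derive A w = 0).
  { intros w. apply NNPP. intros Hw. apply Na. exists w. exact Hw. }
  exists (k1 * Cexp (A 0)), (f 0). split; [apply Cmult_neq_0; auto; apply Cexp_neq_0|].
  intros z. rewrite (C_derive_const_linear f (k1 * Cexp (A 0)) Hf); [ring|].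
  intros w. rewrite E1, (C_derive_0_const A EA A0 w). reflexivity. }
destruct Aw as [w Hw].
assert (HB2 := exponent_polynomial _ B k2 1 Eg1 EB Hk2 E2
  (log_growth_derive g 1 Hg (log_growth_right_factor A g w 1 EA Hg Hw GA))).
assert (EB1 := entire_derive _ EB).
assert (K1 := C_derive_0_const _ EB1 HB2).
set (beta := C_derive B 0) in *.
assert (K0 := C_derive_const_linear B beta EB K1).
destruct (classic (beta = 0)) as [Hb|Hb].
- apply Ng. exists (k2 * Cexp (B 0)), (g 0). split; [apply Cmult_neq_0; auto; apply Cexp_neq_0|].
  intros z. rewrite (C_derive_const_linear g (k2 * Cexp (B 0)) Hg); [ring|].
  intros v. rewrite E2, K0, Hb. f_equal. f_equal. ring.
- destruct (Cexp_linear_periodic B beta Hb K0) as [T [HT PT]].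
  apply (right_factor_not_periodic T HT).
  (* As g' = k2 * exp (B) with B' = beta, g' / beta is a primitive of g'. Hence g differs from it by
     a constant and inherits the period of g'. *)
  assert (Kg : forall z, g z = / beta * C_derive g z + (g 0 - / beta * C_derive g 0)).
  { apply (cderiv_eq_minus g (fun z => / beta * C_derive g z) (C_derive g)).
    - intros z. apply entire_C_derive, Hg.
    - intros z. apply (cderiv_val _ _ (/ beta * (k2 * (Cexp (B z) * beta)))).
      + rewrite E2. field. exact Hb.
      + apply cderiv_scal. apply cderiv_ext with (fun z => k2 * Cexp (B z)); [intros; symmetry; apply E2|].
        apply cderiv_scal, (cderiv_comp Cexp B); [apply Cexp_cderiv|].
        rewrite <- (K1 z). apply entire_C_derive, EB. }
  intros z. rewrite (Kg (z + T)), (Kg z), !E2, PT. reflexivity.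
Qed.

End Factorization.
End GaussianPrimitive.

Theorem theorem7p15 : exists p : C -> C, elh_prime p.
Proof.
destruct exists_gaussian_primitive as [p Hp].
assert (Dp : forall z, C_derive p z = Cexp (z * z)) by (intros; apply cderiv_C_derive, Hp).
exists p. split; [|split].
- split; [|split].
  + apply (cderiv_entire _ _ Hp).
  + intros z. rewrite Dp. apply Cexp_neq_0.
  + rewrite Dp. replace (0 * 0) with (RtoC 0) by ring. apply Cexp_0.
- intros [a Ha].
  (* A translation would have derivative 1 at the point 1, where p' takes the value e. *)
  assert (E : C_derive p 1 = 1).
  { apply cderiv_C_derive. apply cderiv_ext with (fun z => z + a); [intros; symmetry; apply Ha|].
    apply (cderiv_val _ _ (1 + 0)); [ring|]. apply cderiv_plus; [apply cderiv_id|apply cderiv_const]. }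
  rewrite Dp in E. apply (f_equal Cmod) in E. rewrite Cmod_Cexp, Cmod_1 in E. simpl in E.
  assert (Q := exp_ineq1_le (1 * 1 - 0 * 0)). lra.
- intros [_ (f & g & Hf & Hg & Nf & Ng & E)].
  destruct (factor_affine p Hp f g Hf Hg E); auto.
Qed.
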